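(* For every rational $d \geq 2$, there is a unimodular random planar graph $(G,\rho)$ such that almost surely: (1) $G$ has uniform polynomial growth of degree $d$; (2) the complement of every graph ball in $G$ is connected.
   Context: Graphs are connected, locally finite, undirected, with path metric $d_G$ and closed balls $B_G(v,r)=\{u: d_G(u,v)\le r\}$. A graph $G$ has uniform polynomial growth of degree $d$ if there are constants $C,c>0$ with $c\,r^d\le |B_G(v,r)|\le C\,r^d$ for all $v\in V(G)$, $r\ge1$. A random rooted graph $(G,\rho)$ is unimodular if it satisfies the Mass Transport Principle: for every nonnegative Borel function $F$ on isomorphism classes of doubly rooted connected locally finite graphs, $\mathbb{E}\sum_{x\in V(G)}F(G,\rho,x)=\mathbb{E}\sum_{x\in V(G)}F(G,x,\rho)$. The complement of a ball $B$ is connected if the subgraph of $G$ induced on $V(G)\setminus B$ is connected. *)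

(* Defs.v *)
From HB Require Import structures.
From mathcomp Require Import all_boot all_order all_algebra.
From mathcomp Require Import all_classical all_reals all_analysis.
From mathcomp Require Import measurable_realfun.

Set Implicit Arguments.
Unset Strict Implicit.
Unset Printing Implicit Defensive.

Import Order.TTheory GRing.Theory Num.Theory.
Import numFieldNormedType.Exports.

Local Open Scope classical_set_scope.
Local Open Scope ring_scope.

(* The subirooted_base of (T, e) induced on A is connected (vacuous for A empty). *)
Definition connected_in (T : eqType) (e : rel T) (A : set T) : Prop :=
  forall x y, A x -> A y ->
    exists p : seq T,
      [/\ path e x p, last x p = y & forall z, z \in p -> A z].

(* Simple connected locally finite graphs. Such a graph is countable, so up to
   isomorphism its vertex set can be taken to be a (possibly finite) subset of
   nat; this makes the graphs into a type without losing any isomorphism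
   class. *)
Record graph := Graph {
  vset : pred nat;
  edge : rel {x : nat | vset x};
  edge_sym : symmetric edge;
  edge_irr : irreflexive edge;
  edge_connected : connected_in edge setT;
  edge_locally_finite : forall x, finite_set [set y | edge x y] }.

Notation vertex G := {x : nat | vset G x}.

Definition walk_length (G : graph) (x y : vertex G) : set nat :=
  [set n | exists p : seq (vertex G),
             [/\ path (@edge G) x p, last x p = y & size p = n]].

(* The default value 0 is never used, as G is connected. *)
Definition gdist (G : graph) (x y : vertex G) : nat :=
  xget 0%N [set n | walk_length x y n /\
                    forall m, walk_length x y m -> (n <= m)%N].

Definition gball (K : realDomainType) (G : graph) (x : vertex G) (r : K) :
    set (vertex G) :=
  [set y | (gdist x y)%:R <= r].

(* [counting A] is the number of elements of A, with value +oo if A is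
   infinite. *)
Definition uniform_polynomial_growth (R : realType) (d : R) (G : graph) : Prop :=
  exists c C : R, [/\ 0 < c, 0 < C &
    forall (v : vertex G) (r : R), 1 <= r ->
      ((c * r `^ d)%:E <= counting (gball v r) <= (C * r `^ d)%:E)%E].

Definition ball_complements_connected (R : realType) (G : graph) : Prop :=
  forall (v : vertex G) (r : R), connected_in (@edge G) (~` gball v r).

Definition is_arc (R : realType) (A : set (R * R)) (a b : R * R) : Prop :=
  exists gamma : R -> R * R,
    [/\ {within `[0, 1], continuous gamma},
        {in `[0, 1] &, injective gamma},
        gamma 0 = a, gamma 1 = b & gamma @` `[0, 1] = A].

(* A drawing of G in the plane: [pos] places the vertices, and [arc u v] is the
   point set of the edge uv. The vertices may accumulate in the plane. *)
Record plane_drawing (R : realType) (G : graph) (pos : vertex G -> R * R)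
    (arc : vertex G -> vertex G -> set (R * R)) : Prop := PlaneDrawing {
  pos_inj : injective pos;
  arc_sym : forall u v, edge u v -> arc u v = arc v u;
  arcP : forall u v, edge u v -> is_arc (arc u v) (pos u) (pos v);
  arc_vertex : forall u v w,
    edge u v -> arc u v (pos w) -> w = u \/ w = v;
  arc_arc : forall u v u' v', edge u v -> edge u' v' ->
    [set u; v] <> [set u'; v'] ->
    arc u v `&` arc u' v' `<=` [set pos u; pos v] }.

Definition planar (R : realType) (G : graph) : Prop :=
  exists pos arc, @plane_drawing R G pos arc.

(* Rooted and doubly rooted graphs, with the local topology. *)

Record rooted_graph := Rooted {
  rooted_base : graph;
  groot : vertex rooted_base }.

Record birooted_graph := Birooted {
  birooted_base : graph;
  root1 : vertex birooted_base;
  root2 : vertex birooted_base }.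

(* f restricts to an isomorphism between the induced subgraphs on A and B. *)
Definition induced_iso (G H : graph) (A : set (vertex G)) (B : set (vertex H))
    (f : vertex G -> vertex H) : Prop :=
  set_bij A B f /\ forall u v, A u -> A v -> edge (f u) (f v) = edge u v.

Definition rooted_ball (n : nat) (G : rooted_graph) :
    set (vertex (rooted_base G)) :=
  gball (groot G) n%:Z.
Arguments rooted_ball : clear implicits.

Definition rooted_ball_iso (n : nat) (G H : rooted_graph) : Prop :=
  exists f, induced_iso (rooted_ball n G) (rooted_ball n H) f /\
            f (groot G) = groot H.

Definition birooted_ball (n : nat) (G : birooted_graph) :
    set (vertex (birooted_base G)) :=
  gball (root1 G) n%:Z `|` gball (root2 G) n%:Z.
Arguments birooted_ball : clear implicits.

Definition birooted_ball_iso (n : nat) (G H : birooted_graph) : Prop :=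
  exists f, [/\ induced_iso (birooted_ball n G) (birooted_ball n H) f,
                f (root1 G) = root1 H & f (root2 G) = root2 H].

Section one_vertex_graph.

Let V := {x : nat | pred1 0%N x}.
Let e : rel V := fun _ _ => false.

Let e_sym : symmetric e. Proof. by []. Qed.
Let e_irr : irreflexive e. Proof. by []. Qed.

Let e_connected : connected_in e setT.
Proof.
move=> [x px] [y py] _ _; exists [::]; split => //=.
by apply: val_inj; rewrite /= (eqP px) (eqP py).
Qed.

Let e_locally_finite x : finite_set [set y | e x y].
Proof. by rewrite (_ : [set y | e x y] = set0) //; apply/seteqP; split. Qed.

Definition one_vertex_graph : graph :=
  Graph e_sym e_irr e_connected e_locally_finite.

Definition one_vertex : vertex one_vertex_graph := exist _ 0%N (eqxx 0%N).

End one_vertex_graph.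

HB.instance Definition _ := gen_eqMixin rooted_graph.
HB.instance Definition _ := gen_choiceMixin rooted_graph.
HB.instance Definition _ := isPointed.Build rooted_graph (Rooted one_vertex).

HB.instance Definition _ := gen_eqMixin birooted_graph.
HB.instance Definition _ := gen_choiceMixin birooted_graph.
HB.instance Definition _ :=
  isPointed.Build birooted_graph (Birooted one_vertex one_vertex).

(* The local topologies: G' is near G when balls of large radius around the
   roots of G and G' are isomorphic. *)
HB.instance Definition _ := isSubBaseTopological.Build rooted_graph
  (I := (nat * rooted_graph)%type) setT
  (fun i => [set G | rooted_ball_iso i.1 i.2 G]).

HB.instance Definition _ := isSubBaseTopological.Build birooted_graph
  (I := (nat * birooted_graph)%type) setT
  (fun i => [set G | birooted_ball_iso i.1 i.2 G]).

(* The subbasic open sets are unions of isomorphism classes, hence so are all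
   Borel sets, and Borel functions are isomorphism-invariant. Thus these are the
   Borel structures of the spaces of isomorphism classes. *)
Notation borel_rooted := (g_sigma_algebraType (@open rooted_graph)).
Notation borel_birooted := (g_sigma_algebraType (@open birooted_graph)).

(* The law of a random rooted graph satisfies the Mass Transport Principle. *)
Definition unimodular (R : realType) (P : probability borel_rooted R) : Prop :=
  forall F : borel_birooted -> \bar R,
    measurable_fun setT F -> (forall G, (0 <= F G)%E) ->
    (\int[P]_G (\esum_(x in [set: vertex (rooted_base G)])
       F (Birooted (groot G) x)) =
     \int[P]_G (\esum_(x in [set: vertex (rooted_base G)])
       F (Birooted x (groot G))))%E.

(* Main.v *)
From HB Require Import structures.
Require Import Defs.
From mathcomp Require Import all_boot all_order all_algebra.
From mathcomp Require Import finmap.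
From mathcomp Require Import all_classical all_reals all_analysis.
From mathcomp Require Import measurable_realfun.
From mathcomp Require Import zify lra.

Set Implicit Arguments.
Unset Strict Implicit.
Unset Printing Implicit Defensive.

Import Order.TTheory GRing.Theory Num.Theory.
Import numFieldNormedType.Exports.

Local Open Scope classical_set_scope.
Local Open Scope ring_scope.

(** Write [d = p / q], [k = 3 ^ q] and [M = 3 ^ p], so that [k ^ d = M] and
    [k ^ 2 <= M]. Cut a square into [k] columns of equal width and cut each column
    into [k] tiles of equal height, except the second, which is cut into as many as
    it takes to have [M] tiles in all. Repeat this in every tile, using affine
    images of the subdivided square. The tiles of the [n]-fold subdivision
    correspond to the sequences of [n] digits below [M]. Zooming out from a tile,
    with a sequence [om] of digits to say where each block of [M ^ n] tiles lies in
    the next larger one, yields a tiling of the plane by rectangles as soon as some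
    tile off the boundary of the square occurs infinitely often in [om]
    ([infinite_tiling]). The graph of [om] has the tiles as its vertices, tiles
    being adjacent when they share more than a corner, and [om] as its root. The
    random graph is that of a sequence of independent uniform digits.

    Tiles are arranged in columns of constant width, and have equal heights within
    a column. This structure alone makes the graph planar, with straight segments
    joining lower left corners ([tiling_planar]), and makes the complements of
    balls connected: a ball meets every column in an interval around the height of
    its centre ([ball_convex]), so that from any other vertex one can go
    vertically to infinity without meeting the ball, and then around it
    ([tiling_ball_complements_connected]).

    The growth is of degree [d] because blocks of [M ^ n] tiles are comparable to
    balls of radius [k ^ n] ([tiling_uniform_growth]). Such a block has [k ^ n]
    columns, and its leftmost column has [k ^ n] tiles, hence its diameter is at
    most [3 * k ^ n] ([block_diameter]). Conversely all its columns have at least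
    [k ^ n] tiles, and neighbouring blocks have comparable heights, so a ball of
    radius [k ^ n] meets boundedly many blocks ([ball_coarse]). The heights are
    comparable because the first and the last columns of a subdivided square have
    equally many tiles ([adjacent_columns]).

    The vertices of the graph of [om] are the sequences that differ from [om] in
    finitely many places, and a vertex is labelled by the number whose digits are
    the differences. Seen from the vertex with label [x], the graph is that of the
    sequence [om] translated by the digits of [x] ([reroot_iso]). As
    translations preserve the law of the digits, the expected mass sent from the
    root to the vertex [x] is the expected mass received from the vertex [- x], and
    the sum over [x] is the Mass Transport Principle
    ([tiling_law_unimodular]).

    Finally, the properties hold almost surely in the strong sense that a Borel
    set of probability one consists of graphs isomorphic to tiling graphs. Ask that
    the distinguished tile occur in [om] with gaps bounded by a given function [L]
    of the position; this has probability as close to one as desired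
    ([recurrent_prob]). The graphs whose balls all occur as balls around the root
    in the graphs of such sequences form a Borel set, and a compactness argument
    shows that they are isomorphic to tiling graphs ([limit_of_samples]). *)

(** * Walks and distances in graphs *)

Section walks.
Variables (T : eqType) (e : rel T).

Inductive walk (A : set T) : nat -> T -> T -> Prop :=
| walk_nil x : walk A 0 x x
| walk_cons n x y z : e x y -> A y -> walk A n y z -> walk A n.+1 x z.

Lemma walk_cat A m n x y z : walk A m x y -> walk A n y z -> walk A (m + n) x z.
Proof. by elim=> // {}m {}x y' z' exy Ay _ IH /IH; apply: walk_cons exy Ay. Qed.

Lemma walk_rcons A n x y z : walk A n x y -> e y z -> A z -> walk A n.+1 x z.
Proof.
move=> w eyz Az; rewrite -addn1; apply: walk_cat w _.
exact: walk_cons eyz Az (walk_nil _ _).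
Qed.

Lemma walk_sub A B n x y : A `<=` B -> walk A n x y -> walk B n x y.
Proof.
move=> AB; elim=> [?|{}n {}x y' z exy Ay _ IH]; first exact: walk_nil.
exact: walk_cons exy (AB _ Ay) IH.
Qed.

Lemma walk_sym A n x y : symmetric e -> A x -> walk A n x y -> walk A n y x.
Proof.
move=> es + w; elim: w => [? _|{}n {}x y' z exy Ay _ IH Ax]; first exact: walk_nil.
by apply: walk_rcons (IH Ay) _ Ax; rewrite es.
Qed.

Lemma walkP A n x y : walk A n x y <->
  exists p, [/\ path e x p, last x p = y, size p = n & forall z, z \in p -> A z].
Proof.
split.
  elim=> [?|{}n {}x y' z exy Ay _ [p [pp lp sp Ap]]]; first by exists [::].
  exists (y' :: p); split=> //=; [by rewrite exy|by rewrite sp|].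
  by move=> t; rewrite inE => /orP[/eqP->//|/Ap].
move=> [p]; elim: p n x => [|a p IH] [|n] x [] //=.
  by move=> _ -> _ _; exact: walk_nil.
move=> /andP[exa pp] lp [sp] Ap; apply: (walk_cons exa).
  by apply: Ap; rewrite mem_head.
by apply: IH; split=> // z zp; apply: Ap; rewrite inE zp orbT.
Qed.

Lemma connected_inP (A : set T) :
  (forall x y, A x -> A y -> exists n, walk A n x y) -> connected_in e A.
Proof.
move=> h x y Ax Ay; have [n /walkP[p [pp lp _ Ap]]] := h x y Ax Ay.
by exists p.
Qed.

End walks.

Section graph_distance.
Variable G : graph.
Implicit Types x y z : vertex G.
Local Notation gwalk := (walk (@edge G) setT).

Lemma walk_lengthP x y n : walk_length x y n <-> gwalk n x y.
Proof.
split=> [[p [pp lp sp]]|/walkP[p [pp lp sp _]]]; last by exists p.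
by apply/walkP; exists p.
Qed.

Lemma gdistP x y : gwalk (gdist x y) x y /\ forall m, gwalk m x y -> (gdist x y <= m)%N.
Proof.
have [n wn] : exists n, walk_length x y n.
  by have [p [pp lp _]] := @edge_connected G x y I I; exists (size p), p.
have exw : exists n, `[< walk_length x y n >] by exists n; apply/asboolP.
case: (ex_minnP exw) => m /asboolP wm mmin.
have : [set n | walk_length x y n /\ forall m, walk_length x y m -> (n <= m)%N]
   (gdist x y).
  apply: (xgetPex 0%N); exists m; split=> // j wj; apply: mmin; exact/asboolP.
move=> [/walk_lengthP gw gmin]; split=> // j /walk_lengthP; exact: gmin.
Qed.

Lemma gdist_leP x y n : (gdist x y <= n)%N <-> exists2 m, (m <= n)%N & gwalk m x y.
Proof.
have [gw gm] := gdistP x y; split; first by exists (gdist x y).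
by move=> [m mn /gm h]; exact: leq_trans h mn.
Qed.

Lemma gdist_walk x y m : gwalk m x y -> (gdist x y <= m)%N.
Proof. by move=> w; apply/gdist_leP; exists m. Qed.

Lemma gdist0 x : gdist x x = 0%N.
Proof. by apply/eqP; rewrite -leqn0; apply: gdist_walk; exact: walk_nil. Qed.

Lemma gdist_eq0 x y : gdist x y = 0%N -> x = y.
Proof. by have [+ _] := gdistP x y => /[swap] ->; inversion 1. Qed.

Lemma gdist_sym x y : gdist x y = gdist y x.
Proof.
wlog: x y / (gdist x y <= gdist y x)%N => [h|].
  by have [/h//|/ltnW/h//] := leqP (gdist x y) (gdist y x).
move=> le; apply/eqP; rewrite eqn_leq le /=; apply: gdist_walk.
apply: walk_sym => //; [exact: edge_sym|exact: (gdistP x y).1].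
Qed.

Lemma gdist_triangle y x z : (gdist x z <= gdist x y + gdist y z)%N.
Proof. by apply: gdist_walk; exact: walk_cat (gdistP x y).1 (gdistP y z).1. Qed.

Lemma gdist_edge x y : edge x y -> (gdist x y <= 1)%N.
Proof. by move=> exy; apply: gdist_walk; exact: walk_cons exy I (walk_nil _ _ _). Qed.

(** Induction along the concentric balls around a vertex. *)
Lemma gdistS x y n : (gdist x y <= n.+1)%N ->
  x = y \/ exists2 z, edge z y & (gdist x z <= n)%N.
Proof.
move=> /gdist_leP[m mn w]; have {w} := walk_sym (@edge_sym G) I w.
case: m mn => [_ w|m mn w]; first by left; inversion w.
inversion w as [|? ? z ? eyz _ w' e1 [e2 e3]]; right; exists z.
  by rewrite edge_sym.
by rewrite gdist_sym; exact: leq_trans (gdist_walk w') mn.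
Qed.

Lemma finite_gdist_ball x n : finite_set [set y | (gdist x y <= n)%N].
Proof.
elim: n => [|n IH].
  apply: (@sub_finite_set _ _ [set x]); last exact: finite_set1.
  by move=> y /=; rewrite leqn0 => /eqP/gdist_eq0.
apply: (@sub_finite_set _ _ ([set x] `|`
    \bigcup_(z in [set z | (gdist x z <= n)%N]) [set y | edge z y])).
  by move=> y /= /gdistS[->|[z ezy dz]]; [left|right; exists z].
rewrite finite_setU; split; first exact: finite_set1.
by apply: bigcup_finite => // z _; exact: edge_locally_finite.
Qed.

End graph_distance.

(** * Tilings of the plane by columns of rectangles *)

(** The plane is cut into vertical strips of equal width and each strip into
    rectangles of equal height, the height depending on the strip. The vertices
    are the rectangles, [col] is the strip of a rectangle, [lo] the height of its
    bottom and [ht] its own height. Rectangles are adjacent when they share more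
    than a corner. *)
Record column_tiling (R : realType) (V : eqType) (e : rel V)
    (col : V -> int) (lo ht : V -> R) : Prop := ColumnTiling {
  ct_pos : forall v, 0 < ht v;
  ct_ht : forall u v, col u = col v -> ht u = ht v;
  ct_cover : forall c t, exists v, [/\ col v = c, lo v <= t & t < lo v + ht v];
  ct_sep : forall u v, col u = col v -> lo u < lo v + ht v ->
    lo v < lo u + ht u -> u = v;
  ct_edge : forall u v, e u v =
    [&& col u == col v & (lo v == lo u + ht u) || (lo u == lo v + ht v)] ||
    [&& (col v == col u + 1) || (col u == col v + 1),
        lo u < lo v + ht v & lo v < lo u + ht u] }.

Section column_tiling_theory.
Variables (R : realType) (V : eqType) (e : rel V).
Variables (col : V -> int) (lo ht : V -> R).
Hypothesis H : column_tiling e col lo ht.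
Implicit Types (u v w x y : V) (A : set V) (t : R).

Let pos := ct_pos H.

Definition covers v t := lo v <= t < lo v + ht v.

Lemma tile_sym : symmetric e.
Proof.
move=> u v; rewrite !(ct_edge H) (eq_sym (col u)) (orbC (lo v == _)).
by rewrite (orbC (col v == _)) (andbC (lo u < _)).
Qed.

Lemma tile_irr : irreflexive e.
Proof.
move=> u; rewrite (ct_edge H) eqxx orbb /= orbb.
have -> : (lo u == lo u + ht u) = false by apply/eqP; have := pos u; lra.
by have -> : (col u == col u + 1) = false by apply/eqP; lia.
Qed.

Lemma covers_lo v : covers v (lo v).
Proof. by rewrite /covers lexx /= ltrDl. Qed.

Lemma tile_cover c t : exists2 v, col v = c & covers v t.
Proof. by have [v [? ? ?]] := ct_cover H c t; exists v => //; apply/andP. Qed.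

Lemma tile_ltP u v : col u = col v -> lo u < lo v + ht v ->
  u = v \/ lo u + ht u <= lo v.
Proof.
move=> c l; have [?|l'] := leP (lo u + ht u) (lo v); first by right.
by left; exact: (ct_sep H).
Qed.

Lemma covers_edge u v t : `|col u - col v|%N = 1%N -> covers u t -> covers v t ->
  e u v.
Proof.
move=> c /andP[? ?] /andP[? ?]; rewrite (ct_edge H); apply/orP; right.
by apply/and3P; split; [lia|lra|lra].
Qed.

Lemma tile_above u : exists v, [/\ col v = col u, lo v = lo u + ht u & e u v].
Proof.
have [v cv /andP[l1 l2]] := tile_cover (col u) (lo u + ht u).
have lv : lo v = lo u + ht u.
  have [||uv|?] := @tile_ltP u v => //; last by apply/eqP; rewrite eq_le l1.
    by have := pos u; lra.
  by move: l2; rewrite uv ltxx.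
by exists v; split=> //; rewrite (ct_edge H) cv lv !eqxx.
Qed.

(** The tiles of a column have equal heights, so that the difference of height
    bounds the number of steps. *)
Lemma tile_climb A j u v : col u = col v -> lo u <= lo v ->
  lo v < lo u + j.+1%:R * ht u ->
  (forall w, col w = col u -> lo u <= lo w <= lo v -> A w) ->
  exists2 m, (m <= j)%N & walk e A m u v.
Proof.
elim: j u => [|j IH] u cuv luv lvj Aw.
  exists 0%N => //; rewrite (@ct_sep _ _ _ _ _ _ H u v) //.
  - exact: walk_nil.
  - by have := pos v; lra.
  - by move: lvj; rewrite mul1r.
have [->|nuv] := eqVneq u v; first by exists 0%N => //; exact: walk_nil.
have lu : lo u + ht u <= lo v.
  by have [||/eqP|//] := @tile_ltP u v; rewrite ?(negPf nuv) //; have := pos v; lra.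
have [w [cw lw euw]] := tile_above u.
have hw : ht w = ht u by apply: (ct_ht H).
have [||||m mj wm] := IH w.
- by rewrite cw.
- by rewrite lw.
- by rewrite lw hw; move: lvj; rewrite -[in X in X -> _](natr1 j.+1); lra.
- move=> z cz /andP[z1 z2]; apply: Aw; first by rewrite cz.
  by rewrite z2 andbT; have := pos u; lra.
exists m.+1 => //; apply: walk_cons euw _ wm; apply: Aw => //.
by rewrite lw lu andbT; have := pos u; lra.
Qed.

Lemma tile_climb_ex A u v : col u = col v -> lo u <= lo v ->
  (forall w, col w = col u -> lo u <= lo w <= lo v -> A w) ->
  exists m, walk e A m u v.
Proof.
move=> c l Aw.
have [//|//||//|m _ wm] := @tile_climb A `|Num.floor ((lo v - lo u) / ht u)|%N u v;
  last by exists m.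
have := floorD1_gt ((lo v - lo u) / ht u); rewrite ltr_pdivrMr // ltrBlDl.
have f0 : 0 <= Num.floor ((lo v - lo u) / ht u).
  by rewrite floor_ge0 divr_ge0 ?subr_ge0 // ltW.
by rewrite -natr1 natr_absz ger0_norm // intrD.
Qed.

(** Tiles of consecutive columns that meet a common height are adjacent, so that
    one can move sideways at constant height. *)
Lemma tile_slide A n (s : bool) u t : covers u t ->
  (forall w, covers w t -> A w) ->
  exists v, [/\ col v = col u + (if s then n%:Z else - n%:Z), covers v t &
                walk e A n u v].
Proof.
move=> cu Aw; elim: n => [|n [v [cv tv wv]]].
  by exists u; split=> //; [case: s; lia|exact: walk_nil].
have [w cw tw] := tile_cover (col u + (if s then n.+1%:Z else - n.+1%:Z)) t.
exists w; split=> //; apply: walk_rcons wv _ (Aw _ tw).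
by apply: covers_edge tv tw; rewrite cv cw; case: s {cv cw}; lia.
Qed.

Lemma tile_slide_to A u t c : covers u t -> (forall w, covers w t -> A w) ->
  exists v, [/\ col v = c, covers v t & walk e A `|c - col u|%N u v].
Proof.
move=> cu Aw; have [v [cv tv wv]] := @tile_slide A `|c - col u|%N (col u <= c) u t cu Aw.
by exists v; split=> //; rewrite cv; case: ifP; lia.
Qed.

Lemma tile_connected x y : exists n, walk e setT n x y.
Proof.
have [v [cv tv wv]] := @tile_slide_to setT x (lo x) (col y) (covers_lo x) (fun _ _ => I).
have [le|/ltW le] := leP (lo v) (lo y).
  have [m wm] := @tile_climb_ex setT v y cv le (fun _ _ _ => I).
  by eexists; exact: walk_cat wv wm.
have [m wm] := @tile_climb_ex setT y v (esym cv) le (fun _ _ _ => I).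
by eexists; apply: walk_cat wv (walk_sym tile_sym I wm).
Qed.

Lemma edge_lo u v : e u v -> `|lo u - lo v| <= Num.max (ht u) (ht v).
Proof.
rewrite (ct_edge H) ler_norml => euv.
have pu := pos u; have pv := pos v.
have m1 : ht u <= Num.max (ht u) (ht v) by rewrite le_max lexx.
have m2 : ht v <= Num.max (ht u) (ht v) by rewrite le_max lexx orbT.
by case/orP: euv => [/andP[_ /orP[]/eqP->]|/and3P[_ ? ?]]; lra.
Qed.

Lemma edge_col u v : e u v -> (`|col u - col v| <= 1)%N.
Proof.
by rewrite (ct_edge H) => /orP[/andP[/eqP-> _]|/andP[/orP[]/eqP-> _]]; lia.
Qed.

Lemma walk_col A n u v : walk e A n u v -> (`|col u - col v| <= n)%N.
Proof. by elim=> [|{}n {}u w {}v /edge_col + _ _ +]; lia. Qed.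

(** The tiles visited lie in the columns at distance at most [n] from that of
    [u], so only their heights matter. *)
Lemma walk_lo A n u v (T : R) : walk e A n u v ->
  (forall w, (`|col u - col w| <= n)%N -> ht w <= T) ->
  `|lo u - lo v| <= n%:R * T.
Proof.
elim=> [?|{}n {}u w {}v euw _ wv IH] hT; first by rewrite subrr normr0 mul0r.
have cuw := edge_col euw.
have /IH h1 : forall z, (`|col w - col z| <= n)%N -> ht z <= T.
  by move=> z cz; apply: hT; lia.
have h2 : `|lo u - lo w| <= T.
  apply: le_trans (edge_lo euw) _; rewrite ge_max !hT //; lia.
have -> : lo u - lo v = (lo u - lo w) + (lo w - lo v) by lra.
apply: le_trans (ler_normD _ _) _; rewrite -(natr1 n); lra.
Qed.

(** The bottoms of the tiles of a column are at least [s] apart, hence are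
    separated by rounding to multiples of [s]. This serves to count tiles. *)
Lemma tile_window_inj (a s : R) u v : col u = col v -> 0 < s -> s <= ht u ->
  Num.floor ((lo u - a) / s) = Num.floor ((lo v - a) / s) -> u = v.
Proof.
move=> c s0 su f.
have hv : ht v = ht u by rewrite (ct_ht H c).
have bd w : (Num.floor ((lo w - a) / s))%:~R * s <= lo w - a <
    (Num.floor ((lo w - a) / s))%:~R * s + s.
  rewrite -ler_pdivlMr // floor_le /=.
  by have := floorD1_gt ((lo w - a) / s); rewrite ltr_pdivrMr // intrD; lra.
have := bd u; have := bd v; rewrite f => /andP[? ?] /andP[? ?].
by apply: (ct_sep H) => //; lra.
Qed.

End column_tiling_theory.

(** * Planarity and balls of the graphs of tilings *)

Lemma finite_upper_bound (R : realType) (T : eqType) (A : set T) (f : T -> R) :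
  finite_set A -> exists M, forall x, A x -> f x <= M.
Proof.
move=> /finite_seqP[s ->]; elim: s => [|a s [M IH]]; first by exists 0.
exists (Num.max (f a) M) => x /=; rewrite inE le_max => /orP[/eqP->|/IH->].
  by rewrite lexx.
by rewrite orbT.
Qed.

Lemma finite_gball (R : realType) (G : graph) (v : vertex G) (r : R) :
  finite_set (gball v r).
Proof.
apply: sub_finite_set (finite_gdist_ball v (Num.truncn r)) => y /= yr.
by rewrite truncn_ge_nat // (le_trans _ yr).
Qed.

Section tiling_graphs.
Variables (R : realType) (G : graph).
Variables (col : vertex G -> int) (lo ht : vertex G -> R).
Hypothesis H : column_tiling (@edge G) col lo ht.
Implicit Types u v w x y : vertex G.
Let pos := ct_pos H.
Let tsym := tile_sym H.

(** In the column of [x], the tiles between [x] and the height of the bottom of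
    [v]. *)
Definition between v x y :=
  (lo x <= lo y <= lo v) \/ (lo y <= lo x /\ lo v < lo y + ht y).

Let between_self v y : col y = col v -> between v v y -> y = v.
Proof.
move=> c vy; apply: (ct_sep H) => //; have := pos v; have := pos y.
  by case: vy => [|[]]; lra.
by case: vy => [|[]]; lra.
Qed.

(** A ball meets each column in an interval around the height of its centre [v].
    By induction on the radius: a geodesic from [v] to [x] passes through a
    neighbour [x'] of [x]. If [x'] is in the column of [x], then [y] is between
    [v] and [x'] too. Otherwise, at the height of the bottom of [v] if [y] is there,
    and else at that of the bottom of [y], the column of [x'] has a tile adjacent
    to [y] that is between [v] and [x']. *)
Lemma ball_convex v x y : col y = col x -> between v x y ->
  (gdist v y <= gdist v x)%N.
Proof.
suff gen n : forall x y, (gdist v x <= n)%N -> col y = col x ->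
    between v x y -> (gdist v y <= n)%N by exact: gen.
elim: n => [|n IH] {}x {}y dvx cyx xy.
  move: dvx; rewrite leqn0 => /eqP/gdist_eq0 ex; subst x.
  by rewrite (between_self cyx xy) gdist0.
have [<-//|/eqP nxy] := eqVneq x y.
have [ex|[x' ex'x dx']] := gdistS dvx.
  by subst x; rewrite (between_self cyx xy) gdist0.
have px := pos x; have py := pos y; have px' := pos x'.
have hxy := ct_ht H cyx.
(* It suffices to find, in the column of [x'], a tile between [x'] and the
   height of [v] that is adjacent to [y]. *)
have viaE y' : col y' = col x' -> between v x' y' -> edge y' y ->
    (gdist v y <= n.+1)%N.
  move=> c' b' /gdist_edge e'; have := IH _ _ dx' c' b' => d'.
  by apply: leq_trans (gdist_triangle y' _ _) _; rewrite -addn1; exact: leq_add.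
have nyx : y <> x by move=> /esym.
move: ex'x; rewrite (ct_edge H) => /orP[/andP[/eqP cx' lx']|/and3P[cx' l1 l2]].
  (* [x'] is the tile above or below [x]. *)
  have hx' := ct_ht H cx'.
  apply: leq_trans (leqnSn n); apply: IH dx' _ _; first by rewrite cyx cx'.
  case: xy => [/andP[xy yv]|[yx vy]].
    have [|/nxy//|?] := tile_ltP H (esym cyx); first lra.
    by left; case/orP: lx' => /eqP; lra.
  have [|/nyx//|?] := tile_ltP H cyx; first lra.
  by right; case/orP: lx' => /eqP; lra.
have cd : `|col x' - col y|%N = 1%N by rewrite cyx; case/orP: cx' => /eqP; lia.
case: xy => [/andP[xy yv]|[yx vy]].
  have [|/nxy//|l3] := tile_ltP H (esym cyx); first lra.
  have [y' cy' ty'] := tile_cover H (col x') (lo y).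
  apply: (viaE y') => //; last first.
    apply: (covers_edge H) ty' (covers_lo H y); by rewrite cy'.
  move: ty' => /andP[ty1 ty2]; left; apply/andP; split; last lra.
  have py' := pos y'.
  by have [|->//|?] := tile_ltP H (esym cy'); lra.
have [|/nyx//|l3] := tile_ltP H cyx; first lra.
pose t := Num.max (lo y) (lo v).
have t1 : lo y <= t by rewrite /t le_max lexx.
have t2 : lo v <= t by rewrite /t le_max lexx orbT.
have t3 : t < lo y + ht y by rewrite /t gt_max vy andbT; lra.
have [y' cy' ty'] := tile_cover H (col x') t.
apply: (viaE y') => //; last first.
  by apply: (covers_edge H) ty' _; [rewrite cy'|apply/andP].
move: ty' => /andP[ty1 ty2]; right; split; last lra.
have py' := pos y'.
by have [|->//|?] := tile_ltP H cy'; lra.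
Qed.

(** From a vertex outside the ball one can leave vertically, away from the height
    of the centre, by convexity of the ball in the columns; then, beyond the ball,
    move sideways to a column [c] that the ball does not meet. *)
Theorem tiling_ball_complements_connected : ball_complements_connected R G.
Proof.
move=> v r; apply: connected_inP; set A := ~` _.
have [T1 hT1] := finite_upper_bound (fun y => lo y + ht y) (finite_gball v r).
have [T2 hT2] := finite_upper_bound (fun y => 1 - lo y) (finite_gball v r).
have [C hC] := finite_upper_bound (fun y => (col y)%:~R + 1 : R) (finite_gball v r).
pose c := Num.ceil C.
have Ac y : col y = c -> A y.
  move=> cy /hC; rewrite cy => h; have := ceil_ge C; rewrite -/c; lra.
have A1 y t : T1 <= t -> covers lo ht y t -> A y.
  by move=> ? /andP[? ?] /hT1; lra.
have A2 y t : t <= - T2 -> covers lo ht y t -> A y.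
  by move=> ? /andP[? ?] /hT2; lra.
have convex x y : col y = col x -> between v y x -> A x -> A y.
  move=> cyx b Ax; apply: contra_not Ax => /= yr; apply: le_trans yr.
  by rewrite ler_nat; exact: ball_convex.
have to_c x : A x -> exists n z, col z = c /\ walk (@edge G) A n x z.
  move=> Ax; have [up|dn] := ltP (lo v) (lo x).
    pose t := Num.max T1 (lo x).
    have t1 : T1 <= t by rewrite /t le_max lexx.
    have t2 : lo x <= t by rewrite /t le_max lexx orbT.
    have [w cw tw] := tile_cover H (col x) t.
    have xw : lo x <= lo w.
      have [//|l] := leP (lo x) (lo w); have px := pos x.
      move: (tw) => /andP[? ?].
      by have [|e|?] := tile_ltP H cw; [lra|move: l; rewrite e ltxx|lra].
    have [|m wm] := tile_climb_ex H (A := A) (esym cw) xw.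
      move=> z cz /andP[z1 z2]; apply: convex cz _ Ax.
      by right; split=> //; have := pos x; lra.
    have [z [cz _ wz]] := tile_slide_to H c tw (fun u => A1 u t t1).
    by exists (m + `|(c - col w)%R|)%N, z; split=> //; exact: walk_cat wm wz.
  pose t := Num.min (- T2) (lo x).
  have t1 : t <= - T2 by rewrite /t ge_min lexx.
  have t2 : t <= lo x by rewrite /t ge_min lexx orbT.
  have [w cw tw] := tile_cover H (col x) t.
  have wx : lo w <= lo x by move: (tw) => /andP[? ?]; lra.
  have [|m wm] := tile_climb_ex H (A := A) cw wx.
    move=> z; rewrite cw => cz /andP[z1 z2]; apply: convex cz _ Ax.
    by left; rewrite z2.
  have Aw : A w by exact: A2 t1 tw.
  have [z [cz _ wz]] := tile_slide_to H c tw (fun u => A2 u t t1).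
  exists (m + `|(c - col w)%R|)%N, z; split=> //.
  exact: walk_cat (walk_sym tsym Aw wm) wz.
have in_c x y : col x = c -> col y = c -> exists n, walk (@edge G) A n x y.
  move=> cx cy; have cxy : col x = col y by rewrite cx.
  have [l|/ltW l] := leP (lo x) (lo y).
    by apply: (tile_climb_ex H) => // w cw _; apply: Ac; rewrite cw.
  have [|m wm] := tile_climb_ex H (A := A) (esym cxy) l.
    by move=> w cw _; apply: Ac; rewrite cw.
  by exists m; apply: walk_sym wm => //; exact: Ac.
move=> x y Ax Ay.
have [m [x' [cx' wx]]] := to_c x Ax; have [n [y' [cy' wy]]] := to_c y Ay.
have [l wl] := in_c x' y' cx' cy'.
exists (m + l + n)%N; apply: walk_cat (walk_cat wx wl) _.
exact: walk_sym wy.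
Qed.

Definition tile_point u : R * R := ((col u)%:~R, lo u).

Definition segment_point (a b : R * R) (t : R) : R * R :=
  ((1 - t) * a.1 + t * b.1, (1 - t) * a.2 + t * b.2).

Definition segment (a b : R * R) := segment_point a b @` `[0, 1].

Lemma segment_is_arc a b : a <> b -> is_arc (segment a b) a b.
Proof.
move=> ab; exists (segment_point a b); split => //.
- apply: continuous_subspaceT => /= t.
  have c1 (c d : R) : {for t, continuous (fun s : R => (1 - s) * c + s * d)}.
    apply: cvgD; last by apply: cvgM; [exact: cvg_id|exact: cvg_cst].
    by apply: cvgM; [apply: cvgB; [exact: cvg_cst|exact: cvg_id]|exact: cvg_cst].
  exact: (cvg_pair (c1 _ _) (c1 _ _)).
- move=> s t _ _ [e1 e2]; apply: contrapT => st; apply: ab.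
  have st0 : s - t != 0 by rewrite subr_eq0; apply/eqP.
  by rewrite (surjective_pairing a) (surjective_pairing b); congr pair;
    apply: (mulfI st0); lra.
- by rewrite /segment_point (surjective_pairing a) /=; congr pair; lra.
- by rewrite /segment_point (surjective_pairing b) /=; congr pair; lra.
Qed.

Lemma segment_sym a b : segment a b = segment b a.
Proof.
suff sub c d : segment c d `<=` segment d c by apply/seteqP; split; exact: sub.
move=> z [t /=]; rewrite in_itv /= => /andP[t0 t1] <-{z}.
exists (1 - t); first by rewrite /= in_itv /=; lra.
by congr pair; lra.
Qed.

Lemma tile_point_inj : injective tile_point.
Proof.
move=> u v [/intr_inj c l]; have := pos u; have := pos v => ? ?.
by apply: (ct_sep H) => //; lra.
Qed.

(* Every edge joins a tile to the one above it or to one in the next column. *)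
Let up u v := col v = col u /\ lo v = lo u + ht u.
Let right u v := [/\ col v = col u + 1, lo u < lo v + ht v & lo v < lo u + ht u].

Let edge_orient u v : edge u v ->
  exists a b, ((a = u /\ b = v) \/ (a = v /\ b = u)) /\ (up a b \/ right a b).
Proof.
rewrite (ct_edge H) => /orP[/andP[/eqP c /orP[]/eqP l]|/and3P[/orP[]/eqP c l1 l2]].
- by exists u, v; split; left.
- by exists v, u; split; [right|left].
- by exists u, v; split; [left|right].
- by exists v, u; split; right.
Qed.

Let right_point a b (t : R) : right a b -> 0 <= t <= 1 ->
  segment_point (tile_point a) (tile_point b) t =
  ((col a)%:~R + t, (1 - t) * lo a + t * lo b).
Proof. by move=> [c _ _] _; rewrite /segment_point /= c intrD; congr pair; lra. Qed.

(* A segment between consecutive columns meets the lattice of vertical lines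
   only at its ends. *)
Let right_int a b z (c : int) : right a b ->
  segment (tile_point a) (tile_point b) z -> z.1 = c%:~R ->
  z = tile_point a \/ z = tile_point b.
Proof.
move=> r [t /=]; rewrite in_itv /= => t01 <-.
rewrite (right_point r t01) /= => e.
have te : t = (c - col a)%:~R by rewrite intrB -e; lra.
have [m0 m1] : 0 <= c - col a /\ c - col a <= 1.
  by move: t01; rewrite te ler0z -[1]/(1%:~R) ler_int => /andP.
have [m|m] : c - col a = 0 \/ c - col a = 1 by lia.
- by left; rewrite te m /tile_point; congr pair; lra.
- by right; have [cb _ _] := r; rewrite te m /tile_point cb intrD; congr pair; lra.
Qed.

Let up_le a b z : up a b -> segment (tile_point a) (tile_point b) z ->
  z.1 = (col a)%:~R /\ lo a <= z.2 <= lo a + ht a.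
Proof.
move=> [c l] [t /=]; rewrite in_itv /= => /andP[t0 t1] <- /=.
have := pos a => ?; rewrite c l; split; [lra|nra].
Qed.

Let oriented_vertex a b w : up a b \/ right a b ->
  segment (tile_point a) (tile_point b) (tile_point w) -> w = a \/ w = b.
Proof.
case=> [u|r] seg.
  have [/= /intr_inj c lw] := up_le u seg; have [cb lb] := u.
  have pa := pos a; have pw := pos w.
  have [||->|l] := @tile_ltP _ _ _ _ _ _ H a w; [by []|lra|by left|].
  right; apply: (tile_point_inj); rewrite /tile_point c cb lb; congr pair; lra.
have [/tile_point_inj|/tile_point_inj] := right_int r seg erefl; by [left|right].
Qed.

(* Segments joining the same two columns are ordered by the heights of their
   ends, weakly and in the same order on both sides. *)
Let right_mono a b a' b' : right a b -> right a' b' -> col a = col a' ->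
  lo a < lo a' -> lo b <= lo b'.
Proof.
move=> [cb l1 l2] [cb' l1' l2'] c l.
have pa := pos a; have pa' := pos a'.
have [||e|l3] := @tile_ltP _ _ _ _ _ _ H a a'; [by []|lra|by move: l; rewrite e ltxx|].
have pb := pos b; have pb' := pos b'.
have [||->//|?] := @tile_ltP _ _ _ _ _ _ H b b'; [by rewrite cb cb' c|lra|lra].
Qed.

Let up_up a b a' b' z : up a b -> up a' b' ->
  segment (tile_point a) (tile_point b) z ->
  segment (tile_point a') (tile_point b') z ->
  (a = a' /\ b = b') \/ (z = tile_point a \/ z = tile_point b).
Proof.
move=> u u' /(up_le u)[z1 z2] /(up_le u')[z1' z2'].
have c : col a = col a' by apply: (@intr_inj R); rewrite -z1 -z1'.
case: u u' => [cb lb] [cb' lb'].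
have pa := pos a; have pa' := pos a'.
have [l|l|l] := ltgtP (lo a) (lo a').
- right; right; have [||e|l3] := @tile_ltP _ _ _ _ _ _ H a a'; [by []|lra| |].
    by move: l; rewrite e ltxx.
  by rewrite (surjective_pairing z) /tile_point z1 cb lb; congr pair; lra.
- right; left; have [||e|l3] := @tile_ltP _ _ _ _ _ _ H a' a; [by []|lra| |].
    by move: l; rewrite e ltxx.
  by rewrite (surjective_pairing z) /tile_point z1; congr pair; lra.
- left; have e : a = a' by apply: tile_point_inj; rewrite /tile_point c l.
  by split=> //; apply: tile_point_inj; rewrite /tile_point cb cb' lb lb' e.
Qed.

Let right_right a b a' b' z : right a b -> right a' b' ->
  segment (tile_point a) (tile_point b) z ->
  segment (tile_point a') (tile_point b') z ->
  (a = a' /\ b = b') \/ (z = tile_point a \/ z = tile_point b).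
Proof.
move=> r r' zab za'b'.
have [t] := zab; have [t'] := za'b'; rewrite /= !in_itv /= => t01' ez' t01 ez.
have := etrans ez (esym ez').
rewrite (right_point r t01) (right_point r' t01') => -[e1 e2].
have [c|nc] := eqVneq (col a) (col a'); last first.
  right; suff z1 : z.1 = (Num.max (col a) (col a'))%:~R by exact: right_int r zab z1.
  rewrite -ez (right_point r t01) /=.
  have [cc|cc] : col a + 1 <= col a' \/ col a' + 1 <= col a by lia.
    have : (col a)%:~R + 1 <= (col a')%:~R :> R by move: cc; rewrite -(ler_int R) intrD.
    by rewrite (max_idPr _) ?ler_int; [lra|lia].
  have : (col a')%:~R + 1 <= (col a)%:~R :> R by move: cc; rewrite -(ler_int R) intrD.
  by rewrite (max_idPl _) ?ler_int; [lra|lia].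
have ett : t' = t by move: e1; rewrite c; lra.
subst t'; have [l|l|l] := ltgtP (lo a) (lo a').
- right; right; have := right_mono r r' c l => l'.
  have t1 : t = 1.
    have : (1 - t) * (lo a' - lo a) = 0 by move: t01 => /andP[? ?]; nra.
    by move/eqP; rewrite mulf_eq0 => /orP[]/eqP; lra.
  by rewrite -ez t1 /segment_point /tile_point; congr pair => /=; lra.
- right; right; have := right_mono r' r (esym c) l => l'.
  have t1 : t = 1.
    have : (1 - t) * (lo a - lo a') = 0 by move: t01 => /andP[? ?]; nra.
    by move/eqP; rewrite mulf_eq0 => /orP[]/eqP; lra.
  by rewrite -ez t1 /segment_point /tile_point; congr pair => /=; lra.
- have ea : a = a' by apply: tile_point_inj; rewrite /tile_point c l.
  have : t * (lo b - lo b') = 0 by move: e2; rewrite l; lra.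
  move/eqP; rewrite mulf_eq0 => /orP[/eqP t0|/eqP lb].
    by right; left; rewrite -ez t0 /segment_point /tile_point; congr pair => /=; lra.
  left; split=> //; apply: tile_point_inj; rewrite /tile_point.
  by have [-> _ _] := r; have [-> _ _] := r'; rewrite c; congr pair; lra.
Qed.

Let oriented_cross a b a' b' z : up a b \/ right a b -> up a' b' \/ right a' b' ->
  segment (tile_point a) (tile_point b) z ->
  segment (tile_point a') (tile_point b') z ->
  (a = a' /\ b = b') \/ (z = tile_point a \/ z = tile_point b).
Proof.
move=> ab; case: (ab) => [u|r] [u'|r'] s s'; first exact: up_up s s'.
- right; have [z1 _] := up_le u s.
  have [e|e] := right_int r' s' z1; rewrite e;
  by have [->|->] : _ = a \/ _ = b := oriented_vertex ab (eq_ind _ _ s _ e); [left|right].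
- by right; have [z1 _] := up_le u' s'; exact: right_int r s z1.
- exact: right_right s s'.
Qed.

(** Vertices are joined by straight segments. Those inside a column are stacked,
    and those from a column to the next one keep the vertical order of the tiles,
    so that they only meet at their ends. *)
Theorem tiling_planar : planar R G.
Proof.
exists tile_point, (fun u v => segment (tile_point u) (tile_point v)); split.
- exact: tile_point_inj.
- by move=> u v _; exact: segment_sym.
- move=> u v euv; apply: segment_is_arc => /tile_point_inj uv.
  by move: euv; rewrite uv edge_irr.
- move=> u v w /edge_orient[a [b [[[-> ->]|[-> ->]] o]]].
    exact: oriented_vertex.
  by rewrite segment_sym => /(oriented_vertex o)[]; [right|left].
- move=> u v u' v' /edge_orient[a [b [ab o]]] /edge_orient[a' [b' [ab' o']]] n z [z1 z2].
  have {z1} z1 : segment (tile_point a) (tile_point b) z.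
    by case: ab => -[-> ->] //; rewrite segment_sym.
  have {z2} z2 : segment (tile_point a') (tile_point b') z.
    by case: ab' => -[-> ->] //; rewrite segment_sym.
  have [[e1 e2]|] := oriented_cross o o' z1 z2.
    exfalso; apply: n; move: ab ab'; rewrite -e1 -e2.
    by move=> [[<- <-]|[<- <-]] [[-> ->]|[-> ->]] //; rewrite setUC.
  by case: ab => -[-> ->] [] ->; by [left|right].
Qed.

End tiling_graphs.

(** * Subdivisions of a square *)

Section base_tile.
Set Default Proof Using "All".
Variables (k m : nat).
Hypotheses (k3 : (3 <= k)%N) (km : (k ^ 2 <= m.+1)%N).
Implicit Types s t : 'I_m.+1.

(** The square is cut into [k] columns of equal width, the [i]-th one into
    [rows i] tiles of equal height. All columns are cut into [k] tiles, except the
    second, whose number of tiles makes the total [m.+1]. The first and the last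
    column have to be cut alike, so that the heights on both sides of a common
    side of two squares stay comparable under iteration. *)
Definition rows (i : nat) : nat := if i == 1%N then (m.+1 - k ^ 2 + k)%N else k.

(** Tiles are numbered row by row, the additional ones of the second column coming
    last. *)
Definition tcol (t : 'I_m.+1) : nat := if (t < k ^ 2)%N then (t %% k)%N else 1%N.

Definition trow (t : 'I_m.+1) : nat :=
  if (t < k ^ 2)%N then (t %/ k)%N else (t - k ^ 2 + k)%N.

Lemma rows_ge i : (k <= rows i)%N.
Proof. by rewrite /rows; case: ifP => _; lia. Qed.

Lemma rows_le i : (rows i <= m.+1)%N.
Proof. by move: km; rewrite /rows expnS expn1; case: ifP => _; nia. Qed.

Lemma tcol_lt t : (tcol t < k)%N.
Proof. by rewrite /tcol; case: ifP => _; [apply: ltn_pmod|]; lia. Qed.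

Lemma trow_lt t : (trow t < rows (tcol t))%N.
Proof.
rewrite /trow; case: ifP => tk; last first.
  rewrite /tcol tk /rows eqxx; have := ltn_ord t; move/negbT: tk; rewrite -leqNgt; lia.
by apply: leq_trans (rows_ge _); rewrite ltn_divLR; [move: tk; rewrite expnS expn1|lia].
Qed.

Lemma base_tile_inj s t : tcol s = tcol t -> trow s = trow t -> s = t.
Proof.
have div_lt (a : 'I_m.+1) : (a < k ^ 2)%N -> (a %/ k < k)%N.
  by move=> ak; rewrite ltn_divLR; [move: ak; rewrite expnS expn1|lia].
rewrite /tcol /trow; case: ifP => sk; case: ifP => tk c r; apply: val_inj => /=.
- by rewrite (divn_eq s k) (divn_eq t k) c r.
- by have := div_lt _ sk; lia.
- by have := div_lt _ tk; lia.
- by move/negbT: sk; move/negbT: tk; rewrite -!leqNgt; lia.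
Qed.

Lemma base_tile_ex i y : (i < k)%N -> (y < rows i)%N ->
  exists t, tcol t = i /\ trow t = y.
Proof.
move=> ik yr; have [yk|ky] := ltnP y k.
  have lt2 : (y * k + i < k ^ 2)%N by rewrite expnS expn1; nia.
  exists (inord (y * k + i)); rewrite /tcol /trow inordK; last exact: leq_trans lt2 km.
  by rewrite lt2 modnMDl modn_small // divnMDl; [rewrite divn_small //; lia|lia].
have i1 : i = 1%N by move: yr; rewrite /rows; case: eqP => //; lia.
subst i; move: yr; rewrite /rows eqxx => yr.
exists (inord (y - k + k ^ 2)); rewrite /tcol /trow inordK; last by lia.
have ge : (y - k + k ^ 2 < k ^ 2)%N = false by apply/negbTE; rewrite -leqNgt leq_addl.
by rewrite ge addnK; split=> //; lia.
Qed.

Lemma rows0 : rows 0 = k. Proof. by []. Qed.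

Lemma rows_last : rows k.-1 = k.
Proof. by rewrite /rows; case: eqP => //; lia. Qed.

(** The second tile of the second column, which does not touch the boundary of the
    square. *)
Definition star : 'I_m.+1 := inord k.+1.

Lemma star_lt : (k.+1 < k ^ 2)%N. Proof. by rewrite expnS expn1; nia. Qed.

Lemma starE : star = k.+1 :> nat.
Proof. by rewrite inordK //; exact: leq_trans star_lt km. Qed.

Lemma tcol_star : tcol star = 1%N.
Proof. by rewrite /tcol starE star_lt -addn1 addnC modnDr modn_small //; lia. Qed.

Lemma trow_star : trow star = 1%N.
Proof.
rewrite /trow starE star_lt -addn1 addnC divnDr // divnn divn_small; lia.
Qed.

End base_tile.

Section substitution_tiling.
Variables (R : realType) (k m : nat).
Hypotheses (k3 : (3 <= k)%N) (km : (k ^ 2 <= m.+1)%N).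
Implicit Types (u v w : nat -> 'I_m.+1) (N : nat).
Local Notation rows := (rows k m).
Local Notation tcol := (@tcol k m).
Local Notation trow := (@trow k m).
Let rows_ge := rows_ge k3 km.
Let tcol_lt := tcol_lt k3 km.
Let trow_lt := trow_lt k3 km.
Let base_tile_inj := base_tile_inj k3 km.
Let base_tile_ex := base_tile_ex k3 km.
Let tcol_star := tcol_star k3 km.
Let trow_star := trow_star k3 km.

(** Coordinates in the [N]-fold subdivision of the unit square. The digits of a
    tile are listed from the smallest scale to the largest, so that [u N] is the
    tile of the square in which the stretched subdivision of level [N] is put.
    The tile addressed by the first [N] digits of [u] lies in column [pX N u], at
    height [pY N u], and [ph N u] is the number of tiles of its column. *)
Fixpoint pX N u : nat := if N is N'.+1 then (pX N' u + tcol (u N') * k ^ N')%N else 0%N.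

Fixpoint ph N u : R := if N is N'.+1 then ph N' u * (rows (tcol (u N')))%:R else 1.

Fixpoint pY N u : R :=
  if N is N'.+1 then (pY N' u + (trow (u N'))%:R) / (rows (tcol (u N')))%:R else 0.

Definition agree N u v := forall i, (i < N)%N -> u i = v i.

Lemma agreeS N u v : agree N.+1 u v -> agree N u v.
Proof. by move=> a i iN; apply: a; exact: ltnW. Qed.

Lemma agree_coords N u v : agree N u v ->
  [/\ pX N u = pX N v, pY N u = pY N v & ph N u = ph N v].
Proof.
elim: N => //= N IH a; have [-> -> ->] := IH (agreeS a).
by rewrite (a N) ?ltnSn.
Qed.

Lemma rows_gt0 i : 0 < (rows i)%:R :> R.
Proof. by rewrite ltr0n; have := rows_ge i; lia. Qed.

Lemma rows_ge1 i : 1 <= (rows i)%:R :> R.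
Proof. by rewrite ler1n; have := rows_ge i; lia. Qed.

Lemma kN_gt0 N : (0 < k ^ N)%N.
Proof. by rewrite expn_gt0; lia. Qed.

Lemma pX_lt N u : (pX N u < k ^ N)%N.
Proof.
elim: N => //= N IH; have := tcol_lt (u N); rewrite expnS => c.
apply: leq_trans (_ : (tcol (u N)).+1 * k ^ N <= _)%N; first by rewrite mulSn; lia.
by rewrite leq_mul2r c orbT.
Qed.

Lemma ph_gt0 N u : 0 < ph N u.
Proof. by elim: N => //= N IH; rewrite mulr_gt0 // rows_gt0. Qed.

Lemma ph_ge N u : (k ^ N)%:R <= ph N u.
Proof.
elim: N => //= N IH; rewrite expnS natrM mulrC.
by apply: ler_pM => //; rewrite ler_nat rows_ge.
Qed.

Lemma phV_gt0 N u : 0 < (ph N u)^-1. Proof. by rewrite invr_gt0 ph_gt0. Qed.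

Lemma phSV N u : (ph N.+1 u)^-1 = (ph N u)^-1 / (rows (tcol (u N)))%:R.
Proof. by rewrite /= invfM. Qed.

Lemma pY_ge0 N u : 0 <= pY N u.
Proof. by elim: N => //= N IH; rewrite divr_ge0 ?addr_ge0. Qed.

Lemma pY_le1 N u : pY N u + (ph N u)^-1 <= 1.
Proof.
elim: N => [|N IH]; first by rewrite /= add0r invr1.
rewrite phSV /= -mulrDl ler_pdivrMr ?rows_gt0 // mul1r.
have : (trow (u N)).+1%:R <= (rows (tcol (u N)))%:R :> R.
  by rewrite ler_nat; exact: trow_lt.
by rewrite -natr1; lra.
Qed.

Lemma pY_lt1 N u : pY N u < 1.
Proof. by have := pY_le1 N u; have := phV_gt0 N u; lra. Qed.

Lemma base_k_uniq K a b c d : (a < K)%N -> (b < K)%N ->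
  (a + c * K = b + d * K)%N -> a = b /\ c = d.
Proof.
move=> aK bK e; have cd : c = d.
  have := congr1 (divn^~ K) e; rewrite !(addnC _ (_ * K)%N).
  by rewrite !divnMDl ?(leq_ltn_trans _ aK) // !divn_small // !addn0.
by move: e; rewrite cd => /addIn.
Qed.

Lemma pX_S_inj N u v : pX N.+1 u = pX N.+1 v ->
  pX N u = pX N v /\ tcol (u N) = tcol (v N).
Proof. by apply: base_k_uniq; exact: pX_lt. Qed.

Lemma ph_col N u v : pX N u = pX N v -> ph N u = ph N v.
Proof. by elim: N => // N IH /pX_S_inj[/IH /= -> ->]. Qed.

Let row_le (a b : nat) (x y j : R) : 0 <= x -> y + j <= 1 ->
  x + a%:R < y + b%:R + j -> (a <= b)%N.
Proof. by move=> x0 y1 l; rewrite -ltnS -(ltr_nat R) -natr1; lra. Qed.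

Let row_le_strict (a b : nat) (x y j : R) : y + j < 1 + x ->
  x + a%:R <= y + b%:R + j -> (a <= b)%N.
Proof. by move=> x0 l; rewrite -ltnS -(ltr_nat R) -natr1; lra. Qed.

Lemma prefix_sep N u v : pX N u = pX N v ->
  pY N u < pY N v + (ph N v)^-1 -> pY N v < pY N u + (ph N u)^-1 -> agree N u v.
Proof.
elim: N => // N IH /pX_S_inj[X C]; rewrite !phSV /= -C -!mulrDl.
rewrite !ltr_pM2r ?invr_gt0 ?rows_gt0 // => l1 l2.
have [u0 v0] := (pY_ge0 N u, pY_ge0 N v).
have [u1 v1] := (pY_le1 N u, pY_le1 N v).
have r : trow (u N) = trow (v N).
  by apply/eqP; rewrite eqn_leq (row_le u0 v1 l1) (row_le v0 u1 l2).
have a : agree N u v.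
  by apply: IH => //; move: l1 l2; rewrite r !(addrAC _ _ (_^-1)) !ltrD2r.
move=> i; rewrite ltnS leq_eqVlt => /orP[/eqP->|/a//].
exact: base_tile_inj C r.
Qed.

Lemma prefix_cover N (c : nat) (t : R) : (c < k ^ N)%N -> 0 <= t < 1 ->
  exists w, [/\ pX N w = c, pY N w <= t & t < pY N w + (ph N w)^-1].
Proof.
elim: N c t => [|N IH] c t.
  rewrite expn0 ltnS leqn0 => /eqP-> /andP[t0 t1].
  by exists (fun=> ord0) => /=; rewrite invr1 add0r.
rewrite expnS => cN /andP[t0 t1].
have kN := kN_gt0 N.
have ck : (c %/ k ^ N < k)%N by rewrite ltn_divLR.
set b := rows (c %/ k ^ N); have b0 : 0 < b%:R :> R by exact: rows_gt0.
have bt0 : 0 <= b%:R * t by rewrite mulr_ge0 // ltW.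
pose r := Num.truncn (b%:R * t).
have /andP[r1 r2] := truncn_itv bt0.
have rb : (r < b)%N by rewrite -(ltr_nat R); apply: le_lt_trans r1 _; nra.
have [d [dc dr]] := base_tile_ex ck rb.
have [||w [wX w1 w2]] := IH (c %% k ^ N)%N (b%:R * t - r%:R).
- by rewrite ltn_mod.
- by apply/andP; split; move: r2; rewrite -natr1 /r; lra.
pose w' i := if i == N then d else w i.
have ww' : agree N w' w by move=> i iN; rewrite /w' ltn_eqF.
have [eX eY eh] := agree_coords ww'.
exists w'; rewrite phSV /= eX eY eh /w' eqxx dc dr wX -/b -mulrDl; split.
- by rewrite addnC -divn_eq.
- by rewrite ler_pdivrMr //; lra.
- by rewrite ltr_pdivlMr //; lra.
Qed.

Definition adj N u v : bool :=
  [&& pX N u == pX N v &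
      (pY N v == pY N u + (ph N u)^-1) || (pY N u == pY N v + (ph N v)^-1)] ||
  [&& (pX N v == pX N u + 1)%N || (pX N u == pX N v + 1)%N,
      pY N u < pY N v + (ph N v)^-1 & pY N v < pY N u + (ph N u)^-1].

Lemma adj_agree N u v u' v' : agree N u u' -> agree N v v' -> adj N u v = adj N u' v'.
Proof. by rewrite /adj => /agree_coords[-> -> ->] /agree_coords[-> -> ->]. Qed.

(** Subdivided squares are put in the tiles by affine maps, so adjacency within
    one of them does not depend on the tile. *)
Lemma adjS N u v : u N = v N -> adj N.+1 u v = adj N u v.
Proof.
move=> uv; rewrite /adj !phSV /= uv; set b := (rows _)%:R; set r := (trow _)%:R.
have b0 : 0 < b by exact: rows_gt0.
have bn : b^-1 != 0 by rewrite invr_eq0 gt_eqF.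
rewrite -!mulrDl !ltr_pM2r ?invr_gt0 // !(inj_eq (mulIf bn)).
rewrite !(addrAC _ r) !(inj_eq (addIr r)) !ltrD2r.
by rewrite !(addnAC _ (_ * _)%N) !eqn_add2r.
Qed.

Lemma adj_stable N N' u v : (N <= N')%N ->
  (forall i, (N <= i)%N -> (i < N')%N -> u i = v i) -> adj N' u v = adj N u v.
Proof.
elim: N' => [|N' IH]; first by rewrite leqn0 => /eqP->.
rewrite leq_eqVlt => /orP[/eqP->//|NN' uv]; rewrite adjS ?IH //.
- by move=> i ? ?; apply: uv => //; lia.
- by apply: uv.
Qed.

Definition inside_block N u :=
  [/\ (0 < pX N u)%N, (pX N u + 1 < k ^ N)%N, 0 < pY N u & pY N u + (ph N u)^-1 < 1].

Lemma inside_block_agree N u v : agree N u v -> inside_block N u -> inside_block N v.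
Proof. by move=> /agree_coords[eX eY eh]; rewrite /inside_block eX eY eh. Qed.

Lemma inside_block_star N u : u N = star k m -> inside_block N.+1 u.
Proof.
move=> uN; rewrite /inside_block phSV /= uN tcol_star // trow_star // mul1n -mulrDl.
have X := pX_lt N u; have b0 := rows_gt0 1; have := rows_ge 1 => bk.
have b3 : 3 <= (rows 1)%:R :> R by rewrite (ler_nat R 3); lia.
have Y0 := pY_ge0 N u; have Y1 := pY_le1 N u; have kN := kN_gt0 N.
split; [lia|by rewrite expnS; nia|by rewrite divr_gt0 //; lra|].
by rewrite ltr_pdivrMr //; lra.
Qed.

Lemma inside_blockS N u : inside_block N u -> inside_block N.+1 u.
Proof.
move=> [X0 X1 Y0 Y1]; rewrite /inside_block phSV /= -mulrDl.
have b0 := rows_gt0 (tcol (u N)).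
have := trow_lt (u N); rewrite -(ler_nat R) -natr1 => r.
have := tcol_lt (u N) => c; have r0 : 0 <= (trow (u N))%:R :> R by [].
split.
- lia.
- by rewrite expnS; nia.
- by rewrite divr_gt0 //; lra.
- by rewrite ltr_pdivrMr //; lra.
Qed.

Lemma adj_inside_block N u v : inside_block N u -> adj N.+1 u v -> u N = v N.
Proof.
move=> [X0 X1 Y0 Y1] a.
have XuN := pX_lt N u; have XvN := pX_lt N v.
have C : tcol (u N) = tcol (v N).
  case/orP: a => [/andP[/eqP/pX_S_inj[]//]|/andP[/orP[]/eqP /= e _]].
    have e' : (pX N v + tcol (v N) * k ^ N = pX N u + 1 + tcol (u N) * k ^ N)%N.
      by rewrite e addnAC.
    by have [_ ->] := base_k_uniq XvN X1 e'.
  have XuN1 : (pX N u - 1 < k ^ N)%N by lia.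
  have e' : (pX N u - 1 + tcol (u N) * k ^ N = pX N v + tcol (v N) * k ^ N)%N by lia.
  by have [_ ->] := base_k_uniq XuN1 XvN e'.
apply: base_tile_inj => //.
have b0 := rows_gt0 (tcol (u N)).
have bn : (rows (tcol (u N)))%:R^-1 != 0 :> R by rewrite invr_eq0 gt_eqF.
have [v0 v1] := (pY_ge0 N v, pY_le1 N v).
have pu := phV_gt0 N u; have pv := phV_gt0 N v.
have r01 : pY N u + (ph N u)^-1 < 1 by [].
suff [l1 l2] : pY N u + (trow (u N))%:R <= pY N v + (trow (v N))%:R + (ph N v)^-1 /\
   pY N v + (trow (v N))%:R <= pY N u + (trow (u N))%:R + (ph N u)^-1.
  apply/eqP; rewrite eqn_leq (row_le_strict _ l1) ?(row_le_strict _ l2) //.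
    by apply: lt_le_trans r01 _; rewrite lerDl.
  by apply: le_lt_trans v1 _; rewrite ltrDl.
move: a; rewrite /adj !phSV /= -C -!mulrDl !ltr_pM2r ?invr_gt0 //.
rewrite !(inj_eq (mulIf bn)) => {b0 bn X0 X1 C XuN XvN v0 v1 r01 Y0 Y1}.
move: (pY N u) (pY N v) (ph N u)^-1 (ph N v)^-1 (trow (u N))%:R (trow (v N))%:R pu pv.
by move=> a b c d e f c0 d0 /orP[/andP[_ /orP[]/eqP]|/and3P[_]]; split; lra.
Qed.

End substitution_tiling.

(** * The infinite tiling of a sequence of digits *)

Section digits.
Variable m : nat.
Implicit Types (u : nat -> 'I_m.+1) (x y N i : nat).

(** Digits in base [m.+1], the least significant first, with values in the group
    of integers modulo [m.+1]. *)
Fixpoint dig x i : 'I_m.+1 :=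
  if i is i'.+1 then dig (x %/ m.+1) i' else inord (x %% m.+1).

Fixpoint undig N u : nat :=
  if N is N'.+1 then (undig N' (fun i => u i.+1) * m.+1 + u 0)%N else 0%N.

Lemma dig_small x i : (x < m.+1 ^ i)%N -> dig x i = 0.
Proof.
elim: i x => [|i IH] x /=; last first.
  by rewrite expnSr => xi; apply: IH; rewrite ltn_divLR.
by rewrite expn0 ltnS leqn0 => /eqP->; apply: val_inj; rewrite /= inordK.
Qed.

Lemma undig_lt N u : (undig N u < m.+1 ^ N)%N.
Proof.
elim: N u => //= N IH u; rewrite expnSr -ltn_divLR // divnMDl // divn_small //.
by rewrite addn0 IH.
Qed.

Lemma dig_undig N u i : dig (undig N u) i = if (i < N)%N then u i else 0.
Proof.
elim: N u i => [|N IH] u i; first by rewrite dig_small // expn_gt0.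
case: i => [|i] /=; first by rewrite modnMDl modn_small // inord_val.
by rewrite divnMDl // divn_small // addn0 IH.
Qed.

Lemma dig_divn n x i : dig (x %/ m.+1 ^ n) i = dig x (n + i).
Proof.
by elim: n x => [|n IH] x; rewrite ?expn0 ?divn1 // expnS divnMA IH.
Qed.

Lemma undig_dig N x : (x < m.+1 ^ N)%N -> undig N (dig x) = x.
Proof.
elim: N x => [|N IH] x; first by rewrite expn0 ltnS leqn0 => /eqP->.
rewrite expnSr /= => xN; rewrite inordK ?ltn_mod // [RHS](divn_eq x m.+1).
by rewrite [undig N _](IH (x %/ m.+1)%N) // ltn_divLR.
Qed.

Lemma eq_undig N u v : (forall i, (i < N)%N -> u i = v i) -> undig N u = undig N v.
Proof.
elim: N u v => //= N IH u v uv; rewrite (IH _ (fun i => v i.+1)) ?uv // => i iN.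
exact: uv.
Qed.

End digits.

Section infinite_tiling.
Set Default Proof Using "All".
Variables (R : realType) (k m : nat).
Hypotheses (k3 : (3 <= k)%N) (km : (k ^ 2 <= m.+1)%N).
Implicit Types (u v w om : nat -> 'I_m.+1) (x y z N : nat).
Local Notation pX := (@pX k m).
Local Notation pY := (@pY R k m).
Local Notation ph := (@ph R k m).
Local Notation adj := (@adj R k m).
Local Notation inside_block := (@inside_block R k m).
Local Notation tcol := (@tcol k m).
Local Notation trow := (@trow k m).
Let ph0 N u := ph_gt0 R k3 km N u.

Lemma M_gt1 : (1 < m.+1)%N.
Proof. by apply: leq_trans km; rewrite expnS expn1; nia. Qed.

Lemma ltn_Mexp x : (x < m.+1 ^ x)%N. Proof. exact: ltn_expl M_gt1. Qed.

Lemma ltn_Mexp_le x N : (x <= N)%N -> (x < m.+1 ^ N)%N.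
Proof. by move=> xN; apply: leq_trans (ltn_Mexp x) _; rewrite leq_exp2l ?M_gt1. Qed.

(** The tiles of the infinite tiling around the tile [om] are the sequences of
    digits that agree with [om] from some place on. They are labelled by numbers,
    whose digits are the differences with those of [om]. With this choice of
    labels, a change of root is the addition of a sequence of digits. *)
Definition address om x i : 'I_m.+1 := om i + dig m x i.

Definition label om N u : nat := undig N (fun i => u i - om i).

Lemma address_ge om x N i : (x < m.+1 ^ N)%N -> (N <= i)%N -> address om x i = om i.
Proof.
move=> xN Ni; rewrite /address dig_small ?addr0 //.
by apply: leq_trans xN _; rewrite leq_exp2l ?M_gt1.
Qed.

Lemma label_lt om N u : (label om N u < m.+1 ^ N)%N. Proof. exact: undig_lt. Qed.

Lemma address_label om N u i :
  address om (label om N u) i = if (i < N)%N then u i else om i.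
Proof. by rewrite /address dig_undig; case: ifP; rewrite ?addr0 // addrC subrK. Qed.

Lemma address_inj om x y N : (x < m.+1 ^ N)%N -> (y < m.+1 ^ N)%N ->
  agree N (address om x) (address om y) -> x = y.
Proof.
move=> xN yN a; rewrite -(undig_dig xN) -(undig_dig yN); apply: eq_undig => i iN.
by have := a i iN; rewrite /address => /addrI.
Qed.

(** Two addresses are compared at any level above which they agree, as
    [tile_edgeE] shows; [maxn x y] is such a level because [x < m.+1 ^ x]. *)
Definition tile_edge om : rel nat := fun x y => adj (maxn x y) (address om x) (address om y).

Lemma tile_edgeE om N x y : (x < m.+1 ^ N)%N -> (y < m.+1 ^ N)%N ->
  tile_edge om x y = adj N (address om x) (address om y).
Proof.
have stable N1 N2 : (N1 <= N2)%N -> (x < m.+1 ^ N1)%N -> (y < m.+1 ^ N1)%N ->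
    adj N2 (address om x) (address om y) = adj N1 (address om x) (address om y).
  move=> N12 xN yN; apply: adj_stable => // i Ni _.
  by rewrite !(@address_ge _ _ N1).
move=> xN yN; rewrite /tile_edge; have [le|/ltnW le] := leqP N (maxn x y).
  exact: stable.
by apply/esym/stable; rewrite // ltn_Mexp_le // ?leq_maxl ?leq_maxr.
Qed.

(** The coordinates in the blocks, normalised so that the root, labelled 0, has
    height 1 and its lower left corner at the origin. *)
Definition gcol om x : int := (pX x (address om x))%:Z - (pX x om)%:Z.

Definition glo om x : R := (pY x (address om x) - pY x om) * ph x om.

Definition ght om x : R := ph x om / ph x (address om x).

(** The normalised coordinates do not change when a block is put into the next
    larger one. *)
Lemma coordsE om N x : (x < m.+1 ^ N)%N ->
  [/\ gcol om x = (pX N (address om x))%:Z - (pX N om)%:Z,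
      glo om x = (pY N (address om x) - pY N om) * ph N om &
      ght om x = ph N om / ph N (address om x)].
Proof.
set u := address om x.
have step N1 : (x < m.+1 ^ N1)%N ->
  [/\ (pX N1.+1 u)%:Z - (pX N1.+1 om)%:Z = (pX N1 u)%:Z - (pX N1 om)%:Z,
      (pY N1.+1 u - pY N1.+1 om) * ph N1.+1 om = (pY N1 u - pY N1 om) * ph N1 om &
      ph N1.+1 om / ph N1.+1 u = ph N1 om / ph N1 u].
  move=> xN; have uN : u N1 = om N1 by exact: address_ge xN _.
  rewrite /= uN; have b0 := rows_gt0 R k3 km (tcol (om N1)).
  have bn := lt0r_neq0 b0; split; first lia.
    by rewrite -mulrBl opprD addrACA subrr addr0 mulrACA mulVf // mulr1.
  by rewrite -mulf_div divff // mulr1.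
have steps N1 N2 : (N1 <= N2)%N -> (x < m.+1 ^ N1)%N ->
  [/\ (pX N2 u)%:Z - (pX N2 om)%:Z = (pX N1 u)%:Z - (pX N1 om)%:Z,
      (pY N2 u - pY N2 om) * ph N2 om = (pY N1 u - pY N1 om) * ph N1 om &
      ph N2 om / ph N2 u = ph N1 om / ph N1 u].
  elim: N2 => [|N2 IH]; first by rewrite leqn0 => /eqP->.
  rewrite leq_eqVlt => /orP[/eqP-> _ //|le xN]; have [<- <- <-] := IH le xN.
  by apply: step; apply: leq_trans xN _; rewrite leq_exp2l ?M_gt1.
move=> xN; rewrite /gcol /glo /ght; have [le|/ltnW le] := leqP x N.
  by have [-> -> ->] := steps _ _ le (ltn_Mexp x).
by have [-> -> ->] := steps _ _ le xN.
Qed.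

(** The root is far from all sides of its [N]-th block: at least [B] columns from
    the lateral ones, and [B] times the height of the root tile from the others. *)
Definition deep om (B : nat) N :=
  [/\ (B <= pX N om)%N, (pX N om + B < k ^ N)%N,
      B%:R <= pY N om * ph N om & B%:R <= (1 - pY N om) * ph N om].

(** For such a sequence the blocks of the root exhaust the plane; in general they
    may only exhaust a half plane or a quadrant. *)
Definition good om := forall n, exists2 i, (n <= i)%N & om i = star k m.

Lemma deepS om B N : deep om B N -> deep om B N.+1.
Proof.
move=> [X1 X2 Y1 Y2]; rewrite /deep /=.
have b0 := rows_gt0 R k3 km (tcol (om N)); have bn := lt0r_neq0 b0.
have := tcol_lt k3 km (om N) => c; have kN := kN_gt0 R k3 km N.
have := trow_lt k3 km (om N); rewrite -(ler_nat R) -natr1 => r.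
have r0 : 0 <= (trow (om N))%:R :> R by [].
have h0 := ph0 N om.
split; [lia|by rewrite expnS; nia| |].
  have : 0 <= (trow (om N))%:R * ph N om by rewrite mulr_ge0 // ltW.
  by rewrite mulrCA mulfVK //; lra.
set b := (rows _ _ _)%:R in r *.
have : 0 <= (b - (trow (om N))%:R - 1) * ph N om by rewrite mulr_ge0 ?(ltW h0) //; lra.
by move=> q; rewrite mulrBl mul1r mulrCA mulfVK //; lra.
Qed.

Lemma deep_star om B N : om N = star k m -> deep om B N -> deep om B.+1 N.+1.
Proof.
move=> oN [X1 X2 Y1 Y2]; rewrite /deep /= oN tcol_star // trow_star // mul1n.
have b0 := rows_gt0 R k3 km 1; have bn := lt0r_neq0 b0.
have b3 : 3 <= (rows k m 1)%:R :> R by rewrite (ler_nat R 3); have := rows_ge k3 km 1; lia.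
have kN := kN_gt0 R k3 km N; have h1 := ph_ge R k3 km N om.
have h2 : 1 <= ph N om by apply: le_trans h1; rewrite ler1n.
split; [lia|by rewrite expnS; nia| |].
  by rewrite mulrCA mulfVK // -natr1; lra.
have : 0 <= ((rows k m 1)%:R - 3) * ph N om by rewrite mulr_ge0 ?(ltW (ph0 _ _)) ?subr_ge0.
by move=> q; rewrite mulrBl mul1r mulrCA mulfVK // -natr1; lra.
Qed.

Lemma good_deep om B : good om -> exists N0, forall N, (N0 <= N)%N -> deep om B N.
Proof.
move=> g; suff [N0 d0] : exists N, deep om B N.
  exists N0; elim=> [|N IH]; first by rewrite leqn0 => /eqP <-.
  by rewrite leq_eqVlt => /orP[/eqP <-//|/IH/deepS].
elim: B => [|B [N dN]].
  by exists 0%N; split; rewrite /= ?mul0r ?subr0 ?mulr1.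
have [i Ni oi] := g N; exists i.+1; apply: deep_star oi _.
elim: i Ni => [|i IH]; first by rewrite leqn0 => /eqP <-.
by rewrite leq_eqVlt => /orP[/eqP <-//|/IH/deepS].
Qed.

Lemma good_inside_block om x : good om ->
  exists N, (x < m.+1 ^ N)%N /\ inside_block N (address om x).
Proof.
move=> g; have [i xi oi] := g x; have xM := ltn_Mexp_le xi.
exists i.+1; split; first by apply: ltn_trans xM _; rewrite ltn_exp2l ?M_gt1.
by apply: inside_block_star => //; rewrite (address_ge _ xM).
Qed.

(** The two ends of an edge are compared in a large block, and
    [adj_inside_block] descends from there to the level [N]. *)
Lemma inside_block_edge om N x y : (x < m.+1 ^ N)%N -> inside_block N (address om x) ->
  tile_edge om x y -> (y < m.+1 ^ N)%N.
Proof.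
move=> xN ix exy; pose N' := maxn N y.
have yN' : (y < m.+1 ^ N')%N by apply: ltn_Mexp_le; exact: leq_maxr.
have xN' : (x < m.+1 ^ N')%N.
  by apply: leq_trans xN _; rewrite leq_exp2l ?M_gt1 // leq_maxl.
move: exy; rewrite (tile_edgeE _ xN' yN') => a.
have ag i : (N <= i)%N -> (i < N')%N -> address om x i = address om y i.
  have : (N <= N')%N by exact: leq_maxl.
  elim: N' a {xN' yN'} i => [|n IH] a i Nn Ni iN'; first by [].
  have Nn' : (N <= n)%N by lia.
  have i_n : inside_block n (address om x).
    elim: n Nn' {IH a Nn iN'} => [|n IHn]; first by rewrite leqn0 => /eqP <-.
    by rewrite leq_eqVlt => /orP[/eqP <-//|/IHn/inside_blockS]; exact.
  have en := adj_inside_block k3 km i_n a.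
  move: iN'; rewrite ltnS leq_eqVlt => /orP[/eqP->//|iN'].
  by apply: IH => //; rewrite -adjS.
have -> : y = label om N (address om y); last exact: label_lt.
apply: (@address_inj om _ _ N') => //.
  by apply: leq_trans (label_lt _ _ _) _; rewrite leq_exp2l ?M_gt1 // leq_maxl.
move=> i iN'; rewrite address_label; case: ltnP => // Ni.
by rewrite -ag // (address_ge _ xN).
Qed.

(** Every property is checked in a block that contains the tiles involved. For the
    covering of the plane, there is such a block because blocks exhaust it. *)
Lemma infinite_tiling om : good om ->
  column_tiling (tile_edge om) (gcol om) (glo om) (ght om).
Proof.
move=> g.
have common x y : exists N, [/\ (x < m.+1 ^ N)%N & (y < m.+1 ^ N)%N].
  by exists (maxn x y); split; apply: ltn_Mexp_le; rewrite ?leq_maxl ?leq_maxr.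
have affine (h a b c d : R) : 0 < h ->
    ((a - b) * h < (c - b) * h + h * d) = (a < c + d).
  by move=> h0; rewrite (mulrC h) -mulrDl ltr_pM2r // addrAC ltrD2r.
have affine_eq (h a b c d : R) : 0 < h ->
    ((a - b) * h == (c - b) * h + h * d) = (a == c + d).
  move=> h0; rewrite (mulrC h) -mulrDl (inj_eq (mulIf (lt0r_neq0 h0))).
  by rewrite addrAC (inj_eq (addIr _)).
have Xcol (a b c : nat) : (a%:Z - c%:Z == b%:Z - c%:Z) = (a == b) by lia.
split.
- by move=> x; rewrite /ght divr_gt0.
- move=> x y; have [N [xN yN]] := common x y.
  have [-> _ ->] := coordsE om xN; have [-> _ ->] := coordsE om yN.
  by move=> e; congr (_ / _); apply: ph_col => //; lia.
- move=> c t.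
  have [N0 /(_ N0 (leqnn _))[X1 X2 Y1 Y2]] := good_deep (`|c|%N + (Num.truncn `|t|).+1) g.
  have tB : `|t| < (`|c|%N + (Num.truncn `|t|).+1)%:R.
    by apply: lt_le_trans (truncnS_gt _) _; rewrite ler_nat leq_addl.
  have h0 := ph0 N0 om.
  pose t' := pY N0 om + t / ph N0 om.
  have th : t' * ph N0 om = pY N0 om * ph N0 om + t.
    by rewrite mulrDl mulfVK ?lt0r_neq0.
  have [tt0 tt1] : 0 <= t' * ph N0 om /\ t' * ph N0 om < ph N0 om.
    by move: tB; rewrite th ltr_norml; lra.
  have [||w [wX w1 w2]] := @prefix_cover R k m k3 km N0 `|((pX N0 om)%:Z + c)%R|%N t'.
  - by lia.
  - by rewrite -(pmulr_lge0 _ h0) tt0 -(ltr_pM2r h0) mul1r tt1.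
  have wN := label_lt om N0 w; have aw : agree N0 (address om (label om N0 w)) w.
    by move=> i iN; rewrite address_label iN.
  exists (label om N0 w); have [-> -> ->] := coordsE om wN.
  have [-> -> ->] := agree_coords R k3 km aw; rewrite wX; split; first lia.
    by rewrite mulrBl -(lerD2l (pY N0 om * ph N0 om)) -th addrCA subrr addr0 ler_pM2r.
  rewrite mulrBl (mulrC (ph _ _)) -(ltrD2l (pY N0 om * ph N0 om)) -th.
  by rewrite addrA [X in X + _]addrCA subrr addr0 -mulrDl ltr_pM2r.
- move=> x y; have [N [xN yN]] := common x y.
  have [-> -> ->] := coordsE om xN; have [-> -> ->] := coordsE om yN.
  rewrite !affine // => c l1 l2; apply: (address_inj xN yN).
  by apply: (prefix_sep k3 km) l1 l2; lia.
- move=> x y; have [N [xN yN]] := common x y.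
  rewrite (tile_edgeE _ xN yN) /adj.
  have [-> -> ->] := coordsE om xN; have [-> -> ->] := coordsE om yN.
  rewrite !affine // !affine_eq // Xcol; congr (_ || [&& _ || _, _ & _]); lia.
Qed.

End infinite_tiling.

(** * Graphs of the infinite tilings *)

Section counting_bounds.
Variables (R : realType) (T : choiceType).
Implicit Types (A : set T) (Q : nat).

Lemma counting_le A Q (f : T -> nat) : finite_set A ->
  (forall x, A x -> (f x < Q)%N) -> {in A &, injective f} ->
  (counting A <= Q%:R%:E :> \bar R)%E.
Proof.
move=> finA fQ finj; rewrite /counting asboolT // lee_fin ler_nat.
rewrite -(size_map f) -(size_iota 0 Q); apply: uniq_leq_size.
  rewrite map_inj_in_uniq ?finmap.fset_uniq // => x y.
  by rewrite !in_fset_set //; exact: finj.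
move=> _ /mapP[x + ->]; rewrite in_fset_set // mem_iota add0n => /set_mem; exact: fQ.
Qed.

Lemma counting_ge A Q (g : nat -> T) :
  (forall i, (i < Q)%N -> A (g i)) -> {in gtn Q &, injective g} ->
  (Q%:R%:E <= counting A :> \bar R)%E.
Proof.
move=> Ag ginj; rewrite /counting; case: asboolP => [finA|]; last by rewrite leey.
rewrite lee_fin ler_nat -(size_iota 0 Q) -(size_map g); apply: uniq_leq_size.
  rewrite map_inj_in_uniq ?iota_uniq // => i j.
  by rewrite !mem_iota; exact: ginj.
move=> _ /mapP[i + ->]; rewrite mem_iota add0n => /= iQ.
by rewrite in_fset_set //; apply/mem_set; exact: Ag.
Qed.

End counting_bounds.

Lemma column_tiling_comp (R : realType) (V W : eqType) (h : W -> V) (e : rel V)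
    (col : V -> int) (lo ht : V -> R) : bijective h -> column_tiling e col lo ht ->
  column_tiling (fun x y => e (h x) (h y)) (col \o h) (lo \o h) (ht \o h).
Proof.
move=> [g gK hK] H; split => /=.
- by move=> v; exact: (ct_pos H).
- by move=> u v; exact: (ct_ht H).
- by move=> c t; have [v ?] := ct_cover H c t; exists (g v); rewrite hK.
- move=> u v c l1 l2; apply: (can_inj gK); exact: (ct_sep H).
- by move=> u v; rewrite (ct_edge H).
Qed.

Definition all_nat := {x : nat | predT x}.

Lemma val_all_nat_bij : bijective (val : all_nat -> nat).
Proof. by exists (fun x => exist _ x isT) => // x; exact: val_inj. Qed.

Section tiling_graph.
Set Default Proof Using "All".
Variables (R : realType) (k m : nat).
Hypotheses (k3 : (3 <= k)%N) (km : (k ^ 2 <= m.+1)%N).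
Implicit Types (u v w om : nat -> 'I_m.+1) (x y z N : nat).
Local Notation pX := (@pX k m).
Local Notation pY := (@pY R k m).
Local Notation ph := (@ph R k m).
Local Notation gcol := (@gcol k m).
Local Notation glo := (@glo R k m).
Local Notation ght := (@ght R k m).

Definition nat_edge om : rel all_nat :=
  fun x y : all_nat => tile_edge R k om (val x) (val y).

Lemma nat_tiling om : good k om -> column_tiling (nat_edge om)
  (gcol om \o val) (glo om \o val) (ght om \o val).
Proof.
by move=> g; apply: column_tiling_comp val_all_nat_bij _; exact: infinite_tiling.
Qed.

Lemma nat_edge_connected om : good k om -> connected_in (nat_edge om) setT.
Proof.
move=> g; apply: connected_inP => x y _ _; exact: tile_connected (nat_tiling g) x y.
Qed.

Lemma nat_edge_locally_finite om : good k om ->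
  forall x : all_nat, finite_set [set y | nat_edge om x y].
Proof.
move=> g x; have [N [xN iN]] := good_inside_block R k3 km (val x) g.
apply: (@sub_finite_set _ _ (val @^-1` `I_(m.+1 ^ N))).
  by move=> y /=; exact: inside_block_edge.
apply: finite_preimage; last exact: finite_II.
by move=> ? ? _ _; exact: val_inj.
Qed.

(** All natural numbers are labels. *)
Definition tiling_graph om (g : good k om) : graph :=
  @Graph predT (nat_edge om) (tile_sym (nat_tiling g)) (tile_irr (nat_tiling g))
    (nat_edge_connected g) (nat_edge_locally_finite g).

(** Columns on the two sides of a common vertical line have comparable numbers of
    tiles. Up to the level where the line first appears between two columns of one
    square, the numbers are those of the extreme columns, [k ^ N] on both sides;
    there they get multiplied by numbers of rows between 1 and [m.+1], and above it
    by the same numbers. *)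
Lemma adjacent_columns N u v : pX N u = (pX N v).+1 ->
  ph N u <= m.+1%:R * ph N v /\ ph N v <= m.+1%:R * ph N u.
Proof.
have col0 n w : pX n w = 0%N -> ph n w = (k ^ n)%:R.
  elim: n => //= n IH /eqP; rewrite addn_eq0 muln_eq0 => /andP[/eqP/IH-> /orP[/eqP->|]].
    by rewrite rows0 // -natrM mulnC -expnS.
  by have := kN_gt0 R k3 km n; lia.
have col1 n w : (pX n w).+1 = (k ^ n)%N -> ph n w = (k ^ n)%:R.
  elim: n => //= n IH; have := pX_lt R k3 km n w; have := tcol_lt k3 km (w n).
  rewrite expnS => c X e.
  have cw : @tcol k m (w n) = k.-1.
    have : ~~ ((@tcol k m (w n)).+1 < k)%N by apply/negP => c'; nia.
    lia.
  rewrite cw rows_last // IH; first by rewrite -natrM mulnC.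
  move: e; rewrite cw -{2}(prednK (n := k)) ?mulSn; lia.
elim: N => //= N IH e.
have XuN := pX_lt R k3 km N u; have XvN := pX_lt R k3 km N v.
have r1 i : (rows k m i)%:R <= m.+1%:R :> R by rewrite ler_nat rows_le.
have r2 i : 1 <= (rows k m i)%:R :> R by exact: rows_ge1.
have [XvS|] := ltnP (pX N v).+1 (k ^ N).
  have [X C] := base_k_uniq R k3 km XuN XvS (etrans e (esym (addSn _ _))).
  have [l1 l2] := IH X; have b0 := rows_gt0 R k3 km (@tcol k m (v N)).
  by rewrite C !mulrA !ler_pM2r.
move=> XvL; have {}XvL : (pX N v).+1 = (k ^ N)%N by apply/eqP; rewrite eqn_leq XvN.
have [Xu C] : pX N u = 0%N /\ @tcol k m (u N) = (@tcol k m (v N)).+1.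
  apply: (@base_k_uniq R k m k3 km (k ^ N)) => //; first exact: (kN_gt0 R k3 km).
  by rewrite e mulSn -XvL; lia.
rewrite (col0 _ _ Xu) (col1 _ _ XvL).
have K0 : 0 < (k ^ N)%:R :> R by rewrite ltr0n (kN_gt0 R k3 km).
split; rewrite mulrC [leRHS]mulrCA [leRHS]mulrC ler_pM2r //;
  by rewrite -[leLHS]mulr1; apply: ler_pM.
Qed.

Lemma adjacent_ght om x y : (`|(gcol om x - gcol om y)%R|%N <= 1)%N ->
  ght om x <= m.+1%:R * ght om y.
Proof.
pose N := maxn x y.
have xN : (x < m.+1 ^ N)%N by apply: (ltn_Mexp_le R k3 km); exact: leq_maxl.
have yN : (y < m.+1 ^ N)%N by apply: (ltn_Mexp_le R k3 km); exact: leq_maxr.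
have [-> _ ->] := coordsE R k3 km om xN; have [-> _ ->] := coordsE R k3 km om yN.
set u := address om x; set v := address om y.
have hu := ph_gt0 R k3 km N u; have hv := ph_gt0 R k3 km N v.
have ho := ph_gt0 R k3 km N om => c.
suff l : ph N v <= m.+1%:R * ph N u.
  rewrite mulrCA ler_pM2l // ler_pdivlMr // mulrC ler_pdivrMr // mulrC.
have [e|[e|e]] : pX N u = pX N v \/ (pX N u = (pX N v).+1 \/ pX N v = (pX N u).+1) by lia.
- by rewrite (ph_col R k3 km e); apply: ler_peMl; rewrite ?ler1n // ltW.
- by have [] := adjacent_columns e.
- by have [] := adjacent_columns e.
Qed.

(** The blocks of level [n] are the tiles of the tiling of the shifted sequence,
    stretched. This reduces large balls to bounded ones. *)
Definition shift n om i := om (n + i)%N.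

Lemma good_shift n om : good k om -> good k (shift n om).
Proof.
move=> g j; have [i ji oi] := g (n + j)%N; exists (i - n)%N; first lia.
by rewrite /shift subnKC //; lia.
Qed.

Lemma address_shift n om x i :
  address (shift n om) (x %/ m.+1 ^ n) i = shift n (address om x) i.
Proof. by rewrite /address dig_divn. Qed.

Lemma pX_shift n N u : pX (n + N) u = (pX n u + k ^ n * pX N (shift n u))%N.
Proof.
elim: N => [|N IH]; first by rewrite addn0 muln0 addn0.
by rewrite addnS /= IH expnD mulnDr mulnCA addnA.
Qed.

Lemma ph_shift n N u : ph (n + N) u = ph n u * ph N (shift n u).
Proof. by elim: N => [|N IH]; rewrite ?addn0 ?mulr1 // addnS /= IH mulrA. Qed.

Lemma pY_shift n N u :
  pY (n + N) u = pY n u / ph N (shift n u) + pY N (shift n u).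
Proof.
elim: N => [|N IH]; first by rewrite addn0 /= divr1 addr0.
by rewrite addnS /= IH invfM mulrA -addrA mulrDl.
Qed.

Lemma coarsen n om x (x' := (x %/ m.+1 ^ n)%N) (om' := shift n om) :
  [/\ gcol om x = (pX n (address om x))%:Z - (pX n om)%:Z + (k ^ n)%:Z * gcol om' x',
      glo om x = ph n om * (glo om' x' + pY n (address om x) * ght om' x' - pY n om) &
      ght om x = ph n om * ght om' x' / ph n (address om x)].
Proof.
have xN : (x < m.+1 ^ (n + x))%N by apply: (ltn_Mexp_le R k3 km); exact: leq_addl.
have xN' : (x' < m.+1 ^ x)%N.
  by apply: leq_ltn_trans (leq_div _ _) _; exact: (ltn_Mexp R k3 km).
have [-> -> ->] := coordsE R k3 km om xN; have [-> -> ->] := coordsE R k3 km om' xN'.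
set u := address om x.
have ag : agree x (address om' x') (shift n u) by move=> i _; exact: address_shift.
have [-> -> ->] := agree_coords R k3 km ag.
rewrite !pX_shift !ph_shift !pY_shift -/om'.
have ho := ph_gt0 R k3 km x om'; have hu := ph_gt0 R k3 km x (shift n u).
have ho1 := ph_gt0 R k3 km n om; have hu1 := ph_gt0 R k3 km n u.
split; first by rewrite !PoszD !PoszM; lia.
  move: (ph x om') (ph x (shift n u)) (ph n om) (ph n u) ho hu ho1 hu1.
  move: (pY n u) (pY x (shift n u)) (pY n om) (pY x om') => a b c d e f g h e0 f0 g0 h0.
  have -> : (a / f + b - (c / e + d)) * (g * e) =
     g * ((b - d) * e + a * (e / f) - c * (e / e)) by lra.
  by rewrite divff ?gt_eqF // mulr1.
by rewrite -mulf_div mulrAC.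
Qed.

End tiling_graph.

(** * Volume growth *)

Section tiling_growth.
Set Default Proof Using "All".
Variables (R : realType) (k m : nat).
Hypotheses (k3 : (3 <= k)%N) (km : (k ^ 2 <= m.+1)%N).
Variables (om : nat -> 'I_m.+1) (g : good k om).
Local Notation pX := (@pX k m).
Local Notation pY := (@pY R k m).
Local Notation ph := (@ph R k m).
Local Notation G := (tiling_graph R k3 km g).
Local Notation M := (m.+1).
Implicit Types (v x : vertex G) (n : nat).

Let T : column_tiling (@edge G) (@gcol k m om \o val) (@glo R k m om \o val)
  (@ght R k m om \o val) := nat_tiling R k3 km g.

Let gshift n : good k (shift n om) := good_shift R k3 km n g.

(* The lower left tile of the block of level [n] of [x]. *)
Let corner n x : vertex G :=
  exist _ (label om (maxn n (val x))
    (fun i => if (i < n)%N then ord0 else address om (val x) i)) isT.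

Let address_corner n x i : address om (val (corner n x)) i =
  if (i < n)%N then ord0 else address om (val x) i.
Proof.
rewrite /= (address_label R k3 km); case: (ltnP i (maxn n (val x))) => // ni.
rewrite ifF; last by apply/negbTE; rewrite -leqNgt (leq_trans (leq_maxl _ _) ni).
apply/esym/(address_ge R k3 km om (ltn_Mexp R k3 km (val x))).
exact: leq_trans (leq_maxr _ _) ni.
Qed.

Let corner_coords n x : [/\ pX n (address om (val (corner n x))) = 0%N,
  pY n (address om (val (corner n x))) = 0 &
  ph n (address om (val (corner n x))) = (k ^ n)%:R].
Proof.
have : forall i, (i < n)%N -> address om (val (corner n x)) i = ord0.
  by move=> i iN; rewrite address_corner iN.
move: (address om _) => u; elim: n => //= n IH u0.
have [|-> -> ->] := IH; first by move=> i iN; apply: u0; exact: ltnW.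
have c0 : @tcol k m ord0 = 0%N by rewrite /tcol ifT ?mod0n // expn_gt0; lia.
have r0 : @trow k m ord0 = 0%N by rewrite /trow ifT ?div0n // expn_gt0; lia.
by split; rewrite u0 // c0 // ?r0 ?add0r ?mul0r // rows0 // -natrM mulnC -expnS.
Qed.

Let corner_block n x : (val (corner n x) %/ M ^ n)%N = (val x %/ M ^ n)%N.
Proof.
pose N := maxn (val (corner n x)) (val x).
have cN : (val (corner n x) %/ M ^ n < M ^ N)%N.
  apply: leq_ltn_trans (leq_div _ _) _.
  by apply: (ltn_Mexp_le R k3 km); rewrite leq_maxl.
have xN : (val x %/ M ^ n < M ^ N)%N.
  apply: leq_ltn_trans (leq_div _ _) _.
  by apply: (ltn_Mexp_le R k3 km); rewrite leq_maxr.
apply: (address_inj R k3 km (om := shift n om) cN xN) => i _.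
rewrite !(address_shift R k3 km) /shift address_corner ifF //.
by apply/negbTE; rewrite -leqNgt leq_addr.
Qed.

(** From both tiles one reaches the leftmost column of the block in less than
    [k ^ n] steps at constant height, and this column has only [k ^ n] tiles in the
    block. *)
Lemma block_diameter n v x : (val v %/ M ^ n = val x %/ M ^ n)%N ->
  (gdist v x <= 3 * k ^ n)%N.
Proof.
move=> vx; pose b := corner n v; have [bX bY bh] := corner_coords n v.
have bv : (val b %/ M ^ n = val v %/ M ^ n)%N by exact: corner_block.
have [bc bl bt] := coarsen R k3 km n om (val b).
set t := ght R k om (val b) in bt.
have t0 : 0 < t by exact: (ct_pos T b).
have K0 : 0 < (k ^ n)%:R :> R by rewrite ltr0n (kN_gt0 R k3 km).
have h0 := ph_gt0 R k3 km n om.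
have pos (y : vertex G) : (val y %/ M ^ n = val b %/ M ^ n)%N ->
  [/\ exists2 c : nat, (c < k ^ n)%N & gcol k om (val y) = gcol k om (val b) + c%:Z,
      glo R k om (val b) <= glo R k om (val y) &
      glo R k om (val y) < glo R k om (val b) + (k ^ n)%:R * t].
  move=> yb; have [-> -> _] := coarsen R k3 km n om (val y).
  rewrite bc bl yb bX bY mul0r addr0; split.
  - by exists (pX n (address om (val y))); [exact: (pX_lt R k3 km)|lia].
  - have := pY_ge0 R k3 km n (address om (val y)).
    have := ct_pos (infinite_tiling R k3 km (gshift n)) (val b %/ M ^ n)%N.
    rewrite ler_pM2l // => ? ?; nra.
  - have := pY_lt1 R k3 km n (address om (val y)).
    have := ct_pos (infinite_tiling R k3 km (gshift n)) (val b %/ M ^ n)%N.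
    move: bt; rewrite bh => -> ? ?; rewrite [(k ^ n)%:R * _]mulrC mulfVK ?gt_eqF //.
    rewrite -mulrDr ltr_pM2l //; nra.
have [//|[cv cvk ev] lv1 lv2] := pos v.
have [|[cx cxk ex] lx1 lx2] := pos x; first by rewrite -vx.
have [a [ca ta wa]] := tile_slide_to T (A := setT) (gcol k om (val b))
  (covers_lo T v) (fun _ _ => I).
have [a' [ca' ta' wa']] := tile_slide_to T (A := setT) (gcol k om (val b))
  (covers_lo T x) (fun _ _ => I).
have climb (y y' z z' : vertex G) : gcol k om (val y) = gcol k om (val b) ->
    gcol k om (val y') = gcol k om (val b) ->
    glo R k om (val b) <= glo R k om (val z) ->
    glo R k om (val z') < glo R k om (val b) + (k ^ n)%:R * t ->
    covers (glo R k om \o val) (ght R k om \o val) y (glo R k om (val z)) ->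
    covers (glo R k om \o val) (ght R k om \o val) y' (glo R k om (val z')) ->
    glo R k om (val y) <= glo R k om (val y') -> (gdist y y' <= k ^ n)%N.
  move=> cy cy' lz lz' /andP[/= y1 y2] /andP[/= y1' y2'] yy'.
  have ty : ght R k om (val y) = t by exact: (ct_ht T cy).
  have yb : glo R k om (val b) <= glo R k om (val y).
    have [|->//|/=] := tile_ltP T (esym cy : _ = (gcol k om \o val) y).
      by rewrite /=; lra.
    rewrite -/t; lra.
  have [|//|/=|//|j jk wj] := @tile_climb _ _ _ _ _ _ T setT (k ^ n) y y'.
  - by rewrite /= cy cy'.
  - by rewrite ty -natr1 mulrDl mul1r; lra.
  by apply/gdist_leP; exists j.
have dist_col (y : vertex G) (c : nat) : (c < k ^ n)%N ->
    gcol k om (val y) = gcol k om (val b) + c%:Z ->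
    (`|(gcol k om (val b) - gcol k om (val y))%R| <= k ^ n)%N.
  by move=> ck ->; rewrite opprD addrA subrr sub0r abszN ltnW.
have da : (gdist v a <= k ^ n)%N.
  by apply/gdist_leP; eexists; last exact: wa; exact: dist_col cvk ev.
have da' : (gdist x a' <= k ^ n)%N.
  by apply/gdist_leP; eexists; last exact: wa'; exact: dist_col cxk ex.
have daa' : (gdist a a' <= k ^ n)%N.
  have [l|/ltW l] := leP (glo R k om (val a)) (glo R k om (val a')).
    exact: (climb a a' v x).
  by rewrite gdist_sym; exact: (climb a' a x v).
apply: leq_trans (gdist_triangle a v x) _; rewrite mulSn leq_add //.
apply: leq_trans (gdist_triangle a' a x) _.
by rewrite mul2n -addnn leq_add // gdist_sym.
Qed.

Lemma ball_count_ge n v (A : set (vertex G)) :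
  (forall x, (gdist v x <= 3 * k ^ n)%N -> A x) ->
  ((M ^ n)%:R%:E <= counting A :> \bar R)%E.
Proof.
move=> bA.
apply: (@counting_ge R _ _ _
  (fun i => exist _ (val v %/ M ^ n * M ^ n + i)%N isT : vertex G)).
  move=> i iM /=; apply: bA; apply: block_diameter => /=.
  by rewrite divnMDl ?expn_gt0 // [(i %/ _)%N]divn_small // addn0.
by move=> i j _ _ [/addnI].
Qed.

(** A block has [k ^ n] columns, each made of at least [k ^ n] tiles. So [k ^ n]
    steps cross less than one block sideways, and climb at most the height of a
    block of the three columns of blocks met, which are comparable. *)
Lemma ball_coarse n v x : (gdist v x <= k ^ n)%N ->
  (`|(gcol k (shift n om) (val v %/ M ^ n) - gcol k (shift n om) (val x %/ M ^ n))%R|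
     <= 1)%N /\
  `|glo R k (shift n om) (val v %/ M ^ n) - glo R k (shift n om) (val x %/ M ^ n)|
     <= 2 * M%:R * ght R k (shift n om) (val v %/ M ^ n).
Proof.
set v' := (val v %/ M ^ n)%N; set x' := (val x %/ M ^ n)%N.
set om' := shift n om => dvx.
have gT := infinite_tiling R k3 km (gshift n).
have h0 := ph_gt0 R k3 km n om; have K0 : 0 < (k ^ n)%:R :> R.
  by rewrite ltr0n (kN_gt0 R k3 km).
pose eta := M%:R * ght R k om' v'.
have coarse_col (y : vertex G) : (`|(gcol k om (val v) - gcol k om (val y))%R| <= k ^ n)%N ->
    (`|(gcol k om' v' - gcol k om' (val y %/ M ^ n))%R| <= 1)%N.
  have [-> _ _] := coarsen R k3 km n om (val v).
  have [-> _ _] := coarsen R k3 km n om (val y).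
  have := pX_lt R k3 km n (address om (val v)).
  have := pX_lt R k3 km n (address om (val y)).
  rewrite -/v' -/om'; set a := gcol _ _ _; set c := gcol _ _ _; nia.
have coarse_ht (y : vertex G) : (`|(gcol k om' v' - gcol k om' (val y %/ M ^ n))%R| <= 1)%N ->
    ght R k om' (val y %/ M ^ n) <= eta.
  by move=> c; apply: (adjacent_ght R k3 km); lia.
have [j jk wj] : exists2 j, (j <= k ^ n)%N & walk (@edge G) setT j v x.
  exact/gdist_leP.
have cx : (`|(gcol k om' v' - gcol k om' x')%R| <= 1)%N.
  by apply: coarse_col; apply: leq_trans (walk_col T wj) jk.
split=> //.
have : `|glo R k om (val v) - glo R k om (val x)| <= j%:R * (ph n om * eta / (k ^ n)%:R).
  apply: (walk_lo T wj) => w /= cw.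
  have /coarse_ht lw := coarse_col w (leq_trans cw jk).
  have [_ _ ->] := coarsen R k3 km n om (val w).
  have := ph_ge R k3 km n (address om (val w)).
  have hw := ph_gt0 R k3 km n (address om (val w)) => hk.
  have tw := ct_pos gT (val w %/ M ^ n)%N.
  by apply: ler_pM; [apply: mulr_ge0; exact: ltW|rewrite invr_ge0 ltW|rewrite ler_pM2l|
    rewrite lef_pV2 // posrE].
have [_ -> _] := coarsen R k3 km n om (val v).
have [_ -> _] := coarsen R k3 km n om (val x).
rewrite -/v' -/x' -/om' -mulrBr normrM (gtr0_norm h0).
have -> : j%:R * (ph n om * eta / (k ^ n)%:R) = ph n om * (j%:R * (eta / (k ^ n)%:R)).
  by rewrite -[_ * eta / _]mulrA mulrCA.
rewrite ler_pM2l //.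
have tv := ct_pos gT v'; have tx := ct_pos gT x'.
have ex := coarse_ht x cx; rewrite -/x' in ex.
have ev : ght R k om' v' <= eta by apply: ler_peMl; [exact: ltW|rewrite ler1n].
have := pY_ge0 R k3 km n (address om (val v)); have := pY_lt1 R k3 km n (address om (val v)).
have := pY_ge0 R k3 km n (address om (val x)); have := pY_lt1 R k3 km n (address om (val x)).
have je : j%:R * (eta * (k ^ n)%:R^-1) <= eta.
  rewrite mulrCA ger_pMr ?(lt_le_trans tv ev) // ler_pdivrMr // mul1r ler_nat //.
rewrite -[2 * M%:R * _]mulrA -/eta.
move: (pY n _) (pY n _) (pY n om) => a c d a1 a0 c1 c0.
have la : 0 <= a * ght R k om' v' <= eta by nra.
have lc : 0 <= c * ght R k om' x' <= eta by nra.
rewrite !ler_norml => /andP[? ?]; lra.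
Qed.

(** There are three columns of blocks to consider. In each of them the blocks met
    have their bottoms in a window of height [4 * M] times that of the block of
    [v], and have at least [1 / M] times that height. *)
Lemma ball_count_le n v (A : set (vertex G)) :
  (forall x, A x -> (gdist v x <= k ^ n)%N) ->
  (counting A <= (3 * (4 * M ^ 2 + 1) * M ^ n)%:R%:E :> \bar R)%E.
Proof.
move=> Ab.
set v' := (val v %/ M ^ n)%N; set om' := shift n om.
have gT := infinite_tiling R k3 km (gshift n); rewrite -/om' in gT.
have tv := ct_pos gT v'; pose s := ght R k om' v' / M%:R.
have M0 : 0 < M%:R :> R by rewrite ltr0n.
have s0 : 0 < s by rewrite divr_gt0.
have sM : s * M%:R = ght R k om' v' by rewrite mulfVK ?gt_eqF.
pose a := glo R k om' v' - 2 * M%:R * ght R k om' v'.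
(* A tile is coded by the column of its block, the height of its block rounded
   to a multiple of [s], and its place in the block. *)
pose cc (x : vertex G) := `|(gcol k om' (val x %/ M ^ n)%N - gcol k om' v' + 1)%R|%N.
pose hh (x : vertex G) := Num.floor ((glo R k om' (val x %/ M ^ n)%N - a) / s).
pose Q := (4 * M ^ 2 + 1)%N.
have bound x : (gdist v x <= k ^ n)%N ->
  [/\ (`|(gcol k om' v' - gcol k om' (val x %/ M ^ n)%N)%R| <= 1)%N, (cc x < 3)%N,
      0 <= hh x & (`|hh x| < Q)%N].
  move=> /ball_coarse; rewrite -/v' -/om' => -[c l].
  have [l1 l2] : 0 <= glo R k om' (val x %/ M ^ n) - a /\
     glo R k om' (val x %/ M ^ n) - a <= 4 * M%:R * ght R k om' v'.
    by move: l; rewrite /a ler_norml => /andP[? ?]; split; lra.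
  have h0 : 0 <= hh x by rewrite /hh floor_ge0 divr_ge0 ?(ltW s0).
  split=> //; first by rewrite /cc; lia.
  rewrite -(ltr_nat R) /Q natrD natr_absz ger0_norm //.
  apply: le_lt_trans (floor_le _) _; rewrite ltr_pdivrMr //.
  apply: le_lt_trans l2 _; rewrite -sM natrM natrX; lra.
apply: (@counting_le R _ _ _ (fun x : vertex G =>
  (cc x * Q + `|hh x|) * M ^ n + val x %% M ^ n)%N).
- exact: sub_finite_set Ab (finite_gdist_ball v _).
- move=> x /Ab/bound[_ c _ h].
  have xm : (val x %% M ^ n < M ^ n)%N by rewrite ltn_mod expn_gt0.
  have lt : (cc x * Q + `|hh x| < 3 * Q)%N by nia.
  by rewrite -/Q -ltn_divLR ?expn_gt0 // divnMDl ?expn_gt0 // divn_small // addn0.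
- move=> x y; rewrite !inE => /Ab/bound[bx1 _ bx2 bx3] /Ab/bound[by1 _ by2 by3] e.
  have mod_lt (z : vertex G) : (val z %% M ^ n < M ^ n)%N by rewrite ltn_mod expn_gt0.
  have [em eq] : (val x %% M ^ n = val y %% M ^ n)%N /\
      (cc x * Q + `|hh x| = cc y * Q + `|hh y|)%N.
    by apply: (base_k_uniq R k3 km (K := (M ^ n)%N)) => //; rewrite addnC e addnC.
  have [eh ec] : `|hh x|%N = `|hh y|%N /\ cc x = cc y.
    by apply: (base_k_uniq R k3 km (K := Q)) => //; rewrite addnC eq addnC.
  suff ed : (val x %/ M ^ n = val y %/ M ^ n)%N.
    by apply: val_inj; rewrite /= (divn_eq (val x) (M ^ n)) ed em -divn_eq.
  have ecol : gcol k om' (val x %/ M ^ n)%N = gcol k om' (val y %/ M ^ n)%N.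
    move: bx1 by1 ec; rewrite /cc.
    by move: (gcol _ _ _) (gcol _ _ _) (gcol _ _ _) => cv cx cy; lia.
  apply: (tile_window_inj gT (a := a) (s := s) ecol s0).
    by rewrite /s ler_pdivrMr // mulrC; exact: (adjacent_ght R k3 km).
  by move: eh; rewrite -/(hh x) -/(hh y); lia.
Qed.

(** For radii between [k ^ n] and [k ^ n.+1], volumes are comparable with [M ^ n],
    which is the power [d] of [k ^ n]. *)
Theorem tiling_uniform_growth (d : R) : 0 <= d -> k%:R `^ d = M%:R ->
  uniform_polynomial_growth d G.
Proof.
move=> d0 kd; have M0 : 0 < M%:R :> R by rewrite ltr0n.
have M1 : 1 <= M%:R :> R by rewrite ler1n.
have powd n : (k ^ n)%:R `^ d = (M ^ n)%:R :> R.
  elim: n => [|n IH]; first by rewrite !expn0 powR1.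
  by rewrite !expnS !natrM powRM // IH kd.
exists (M%:R ^- 2), (3 * (4 * M ^ 2 + 1) * M)%:R; split.
- by rewrite invr_gt0 exprn_gt0.
- by rewrite ltr0n; lia.
move=> v r r1; have r0 : 0 <= r by exact: le_trans r1.
have : (0 < Num.truncn r)%N by rewrite truncn_gt0.
have k1 : (1 < k)%N by lia.
move=> /(trunc_log_bounds k1); set n := trunc_log k _ => /andP[n1 n2].
have {}n1 : (k ^ n)%:R <= r by rewrite -truncn_ge_nat.
have {}n2 : r < (k ^ n.+1)%:R by rewrite -truncn_lt_nat.
have rd1 : (M ^ n)%:R <= r `^ d.
  by rewrite -powd; apply: ge0_ler_powR; rewrite ?nnegrE.
have rd2 : r `^ d <= (M ^ n.+1)%:R.
  by rewrite -powd; apply: ge0_ler_powR; rewrite ?nnegrE // ltW.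
apply/andP; split; last first.
  apply: le_trans (@ball_count_le n.+1 v _ _) _.
    by move=> x xr; rewrite -(ler_nat R); apply: le_trans xr _; exact: ltW.
  by rewrite lee_fin [(M ^ n.+1)%N]expnS mulnA natrM ler_wpM2l.
apply: (@le_trans _ _ (M ^ n.-1)%:R%:E); last first.
  have [n0|n0] := posnP n.
    rewrite n0 expn0; apply: (@counting_ge R _ _ 1 (fun=> v)) => //.
      by move=> i _; rewrite /gball /= gdist0.
    by move=> i j; rewrite !inE !ltnS !leqn0 => /eqP-> /eqP->.
  apply: (ball_count_ge (v := v)) => x xv; rewrite /gball /=; apply: le_trans n1.
  rewrite ler_nat; apply: leq_trans xv _; rewrite -[in leqRHS](prednK n0) expnS.
  by rewrite leq_mul2r k3 orbT.
rewrite lee_fin mulrC ler_pdivrMr ?exprn_gt0 // -natrX -natrM -expnD.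
apply: le_trans rd2 _; rewrite ler_nat leq_exp2l ?(M_gt1 R k3 km) //; lia.
Qed.

End tiling_growth.

(** * The local topology *)

Section induced_isomorphisms.
Variables G H : graph.
Implicit Types (A : set (vertex G)) (B : set (vertex H)).

Lemma induced_iso_walk A B f n x y : induced_iso A B f -> A x ->
  walk (@edge G) A n x y -> walk (@edge H) B n (f x) (f y).
Proof.
move=> [[fAB _ _] fe] + w; elim: w => [? _|{}n {}x y' z exy Ay _ IH Ax].
  exact: walk_nil.
by apply: walk_cons (IH Ay); [rewrite fe|exact: fAB].
Qed.

Lemma ball_walk (K : graph) (x : vertex K) n y : (gdist x y <= n)%N ->
  exists2 j, (j <= n)%N & walk (@edge K) [set z | (gdist x z <= n)%N] j x y.
Proof.
move=> xy; exists (gdist x y) => //; have [w _] := gdistP x y.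
have gen : forall i a b, walk (@edge K) setT i a b -> (gdist x a + i <= n)%N ->
    walk (@edge K) [set z | (gdist x z <= n)%N] i a b.
  move=> i a b; elim=> [? _|j {}a c {}b eac _ _ IH le]; first exact: walk_nil.
  have xc : (gdist x c <= gdist x a + 1)%N.
    by apply: leq_trans (gdist_triangle a x c) _; rewrite leq_add2l; exact: gdist_edge.
  by apply: walk_cons eac _ (IH _); rewrite /=; lia.
by apply: gen w _; rewrite gdist0.
Qed.

Lemma induced_iso_ball A B f x n y : induced_iso A B f ->
  [set z | (gdist x z <= n)%N] `<=` A -> (gdist x y <= n)%N ->
  (gdist (f x) (f y) <= n)%N.
Proof.
move=> fi xA xy; have [j jn w] := ball_walk xy; apply/gdist_leP; exists j => //.
apply: walk_sub (induced_iso_walk fi _ (walk_sub xA w)) => //.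
by apply: xA; rewrite /= gdist0.
Qed.

Lemma induced_iso_restrict A B A' B' f : induced_iso A B f -> A' `<=` A -> B' `<=` B ->
  (forall x, A x -> A' x <-> B' (f x)) -> induced_iso A' B' f.
Proof.
move=> [[fAB finj fsurj] fe] AA BB ff; split; last by move=> u v /AA Au /AA Av; exact: fe.
split.
- by move=> x A'x; apply/(ff _ (AA _ A'x)).
- by move=> x y; rewrite !inE => /AA Ax /AA Ay; apply: finj; rewrite inE.
- move=> y B'y; have [x Ax xy] := fsurj y (BB _ B'y); exists x => //.
  by apply/(ff _ Ax); rewrite xy.
Qed.

Lemma induced_iso_inv A B f : induced_iso A B f -> vertex G ->
  exists g, induced_iso B A g /\ forall x, A x -> g (f x) = x.
Proof.
move=> [[fAB finj fsurj] fe] x0.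
pose g y := xget x0 [set x | A x /\ f x = y].
have gP y : B y -> A (g y) /\ f (g y) = y.
  by move=> /fsurj[x Ax xy]; apply: (@xgetPex _ x0 [set x | A x /\ f x = y]); exists x.
have gf x : A x -> g (f x) = x.
  move=> Ax; have [Ag e] := gP _ (fAB _ Ax).
  by apply: finj; rewrite ?inE.
exists g; split=> //; split; last first.
  by move=> u v /gP[Au eu] /gP[Av ev]; rewrite -fe // eu ev.
split.
- by move=> y /gP[].
- by move=> y z; rewrite !inE => /gP[_ e] /gP[_ e'] gyz; rewrite -e -e' gyz.
- by move=> x Ax; exists (f x); [exact: fAB|exact: gf].
Qed.

End induced_isomorphisms.

Lemma induced_iso_comp (G H K : graph) (A : set (vertex G)) (B : set (vertex H))
    (C : set (vertex K)) f g :
  induced_iso A B f -> induced_iso B C g -> induced_iso A C (g \o f).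
Proof.
move=> [[fAB finj fsurj] fe] [[gBC ginj gsurj] ge]; split.
  split.
  - by move=> x /fAB/gBC.
  - by move=> x y Ax Ay /ginj e; apply: finj => //; apply: e; rewrite inE; apply: fAB;
      rewrite -inE.
  - by move=> z /gsurj[y /fsurj[x Ax <-] <-]; exists x.
by move=> u v Au Av /=; rewrite ge ?fe //; exact: fAB.
Qed.

(** Balls around several roots, so as to treat rooted and doubly rooted graphs
    at once. *)
Definition multiball (n : nat) (G : graph) (rs : seq (vertex G)) : set (vertex G) :=
  [set y | exists2 r, r \in rs & (gdist r y <= n)%N].
Arguments multiball : clear implicits.

Definition multiball_iso (n : nat) (G : graph) (rs : seq (vertex G)) (H : graph)
    (ss : seq (vertex H)) : Prop :=
  exists f, induced_iso (multiball n G rs) (multiball n H ss) f /\ map f rs = ss.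

Section multiball_isomorphisms.
Implicit Types (G H K : graph).

Lemma multiball_root n G rs r : r \in rs -> multiball n G rs r.
Proof. by move=> ?; exists r; rewrite ?gdist0. Qed.

Lemma multiball_iso_refl n G rs : multiball_iso n (G := G) rs rs.
Proof.
exists id; rewrite map_id; split=> //; split=> //; split=> //.
by move=> x ?; exists x.
Qed.

Lemma multiball_iso_sym n G rs H ss : rs != [::] ->
  multiball_iso n (G := G) rs (H := H) ss -> multiball_iso n ss rs.
Proof.
move=> rs0 [f [fi e]]; subst ss; have x0 : vertex G by case: rs rs0 {fi}.
have [g [gi gf]] := induced_iso_inv fi x0; exists g; split=> //.
have /eq_in_map : {in rs, g \o f =1 id}.
  by move=> r rr /=; apply: gf; exact: multiball_root.
by rewrite map_id map_comp.
Qed.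

Lemma multiball_iso_trans n G rs H ss K ts : multiball_iso n (G := G) rs (H := H) ss ->
  multiball_iso n ss (H := K) ts -> multiball_iso n rs ts.
Proof.
move=> [f [fi e]] [g [gi e']]; subst ss ts; exists (g \o f).
by split; [apply: (induced_iso_comp fi gi)|rewrite map_comp].
Qed.

(** A geodesic of length at most [n] from [x] stays in the ball of radius [n]
    around [x], where [f] and its inverse transport it. *)
Lemma induced_iso_gdist G H (A : set (vertex G)) (B : set (vertex H)) f x n y :
  induced_iso A B f -> [set z | (gdist x z <= n)%N] `<=` A ->
  [set z | (gdist (f x) z <= n)%N] `<=` B -> A y ->
  (gdist x y <= n)%N <-> (gdist (f x) (f y) <= n)%N.
Proof.
move=> fi xA xB Ay; have [g [gi gf]] := induced_iso_inv fi x; split.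
  exact: induced_iso_ball fi xA.
have Ax : A x by apply: xA; rewrite /= gdist0.
by move=> /(induced_iso_ball gi xB); rewrite !gf.
Qed.

Lemma multiball_iso_le n n' G rs H ss : (n' <= n)%N ->
  multiball_iso n (G := G) rs (H := H) ss -> multiball_iso n' rs ss.
Proof.
move=> nn [f [fi e]]; subst ss; exists f; split=> //.
have sub K (ts : seq (vertex K)) : multiball n' K ts `<=` multiball n K ts.
  by move=> z [t tt tz]; exists t => //; exact: leq_trans nn.
apply: (induced_iso_restrict fi (sub _ _) (sub _ _)) => x Ax.
have key r : r \in rs -> (gdist r x <= n')%N <-> (gdist (f r) (f x) <= n')%N.
  move=> rr; apply: (induced_iso_gdist fi _ _ Ax) => z zr; apply: sub.
    by exists r.
  by exists (f r) => //; exact: map_f.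
split=> [[r rr rx]|[_ /mapP[r rr ->] rx]].
  by exists (f r); [exact: map_f|apply/key].
by exists r => //; apply/key.
Qed.

End multiball_isomorphisms.

Lemma gball_nat (G : graph) (x : vertex G) n :
  gball x n%:Z = [set y | (gdist x y <= n)%N].
Proof.
by apply/seteqP; split=> y; rewrite /gball /= (_ : n%:Z = n%:R) ?ler_nat // natz.
Qed.

Lemma rooted_ball_isoE n G H :
  rooted_ball_iso n G H <-> multiball_iso n [:: groot G] [:: groot H].
Proof.
have mE K : rooted_ball n K = multiball n _ [:: groot K].
  rewrite /rooted_ball gball_nat; apply/seteqP; split=> y /=.
    by exists (groot K); rewrite ?mem_seq1.
  by move=> [r]; rewrite mem_seq1 => /eqP->.
split=> -[f [fi fr]]; exists f; rewrite !mE in fi *; split=> //; first by rewrite /= fr.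
by case: fr.
Qed.

Lemma birooted_ball_isoE n (G H : birooted_graph) : birooted_ball_iso n G H <->
  multiball_iso n [:: Defs.root1 G; root2 G] [:: Defs.root1 H; root2 H].
Proof.
have mE K : birooted_ball n K = multiball n _ [:: Defs.root1 K; root2 K].
  rewrite /birooted_ball !gball_nat; apply/seteqP; split=> y /=.
    by case=> ?; [exists (Defs.root1 K)|exists (root2 K)]; rewrite ?inE ?eqxx ?orbT.
  by move=> [r]; rewrite !inE => /orP[]/eqP->; [left|right].
split=> [[f [fi f1 f2]]|[f [fi [f1 f2]]]]; exists f; rewrite !mE in fi *; split=> //.
by rewrite /= f1 f2.
Qed.

(** The sets [I n x] are a base of neighbourhoods of [x]: they are open because [I n]
    is transitive and increasing [n] shrinks them. *)
Section local_opens.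
Variables (T : ptopologicalType) (I : nat -> T -> T -> Prop).
Hypotheses (Irefl : forall n x, I n x x)
  (Itrans : forall n x y z, I n x y -> I n y z -> I n x z)
  (Ile : forall n n' x y, (n' <= n)%N -> I n x y -> I n' x y).

Lemma local_open_fromP (A : set T) :
  (exists2 D' : set (set T), D' `<=`
     finI_from setT (fun i : nat * T => [set y | I i.1 i.2 y]) & \bigcup_(B in D') B = A)
  <-> forall x, A x -> exists n, forall y, I n x y -> A y.
Proof.
split.
  move=> [D' D'f <-] x [B D'B Bx]; have [E _ EB] := D'f B D'B.
  have [n nE] : exists n, forall i, i \in E -> (i.1 <= n)%N.
    exists (\max_(i <- E) i.1) => i iE.
    exact: (@leq_bigmax_seq _ (enum_fset E) xpredT (fun i : nat * T => i.1) i iE).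
  exists n => y xy; exists B => //; move: Bx; rewrite -EB => Bx i iE.
  have := Bx i iE => /= ix; apply: Itrans ix _.
  exact: Ile (nE i iE) xy.
move=> Aloc.
exists [set B | exists n x, B = [set y | I n x y] /\ B `<=` A].
  move=> B [n [x [-> _]]].
  exists [fset (n, x)]%fset; first by move=> ? _; rewrite inE.
  apply/seteqP; split=> y /=.
    by move=> /(_ (n, x)); apply; rewrite /= inE.
  by move=> xy i /=; rewrite inE => /eqP ->.
apply/seteqP; split=> [y [B [n [x [_ BA]]] /BA//]|x Ax].
have [n xA] := Aloc x Ax; exists [set y | I n x y]; last exact: Irefl.
by exists n, x.
Qed.

End local_opens.

Lemma rooted_openP (A : set rooted_graph) : open A <->
  forall G, A G -> exists n, forall H, rooted_ball_iso n G H -> A H.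
Proof.
have [refl trans le] : [/\ forall n G, rooted_ball_iso n G G,
   forall n G H K, rooted_ball_iso n G H -> rooted_ball_iso n H K -> rooted_ball_iso n G K &
   forall n n' G H, (n' <= n)%N -> rooted_ball_iso n G H -> rooted_ball_iso n' G H].
  split=> [n G|n G H K|n n' G H nn]; rewrite !rooted_ball_isoE.
  - exact: multiball_iso_refl.
  - exact: multiball_iso_trans.
  - exact: multiball_iso_le.
exact: (local_open_fromP refl trans le).
Qed.

Lemma birooted_ball_iso_refl n G : birooted_ball_iso n G G.
Proof. by rewrite birooted_ball_isoE; exact: multiball_iso_refl. Qed.

Lemma birooted_ball_iso_sym n G H : birooted_ball_iso n G H -> birooted_ball_iso n H G.
Proof. by rewrite !birooted_ball_isoE; exact: multiball_iso_sym. Qed.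

Lemma birooted_ball_iso_trans n G H K :
  birooted_ball_iso n G H -> birooted_ball_iso n H K -> birooted_ball_iso n G K.
Proof. by rewrite !birooted_ball_isoE; exact: multiball_iso_trans. Qed.

Lemma birooted_ball_iso_le n n' G H : (n' <= n)%N ->
  birooted_ball_iso n G H -> birooted_ball_iso n' G H.
Proof. by move=> nn; rewrite !birooted_ball_isoE; exact: multiball_iso_le. Qed.

Lemma birooted_openP (A : set birooted_graph) : open A <->
  forall G, A G -> exists n, forall H, birooted_ball_iso n G H -> A H.
Proof.
exact: (local_open_fromP birooted_ball_iso_refl birooted_ball_iso_trans birooted_ball_iso_le).
Qed.

(** Graphs with isomorphic balls of all radii lie in the same open sets, hence in
    the same Borel sets. *)
Lemma borel_birooted_invariant d (T : measurableType d) (F : borel_birooted -> T)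
    (G H : borel_birooted) : measurable_fun setT F ->
  (forall t : T, measurable [set t]) ->
  (forall n, birooted_ball_iso n G H) -> F G = F H.
Proof.
move=> mF mt GH.
pose inv := [set A : set borel_birooted | A G <-> A H].
suff sub : @measurable _ borel_birooted `<=` inv.
  have := mF measurableT _ (mt (F G)); rewrite setTI => m.
  by have [/(_ erefl)/esym] := sub _ m.
apply: smallest_sub => //; last first.
  move=> A /birooted_openP oA; split=> [/oA|/oA] [n]; apply; first exact: GH.
  exact: birooted_ball_iso_sym.
split.
- by [].
- by move=> A iA; rewrite /inv /setD /=; split=> -[_ nA]; split=> // /iA.
- by move=> A iA; split=> -[n _ An]; exists n => //; apply/iA.
Qed.

(** * Measurability of mass sums *)

Lemma finite_uniform (T : eqType) (A : set T) (P : T -> nat -> Prop) :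
  finite_set A -> (forall x, A x -> exists n, P x n) ->
  (forall x n n', (n <= n')%N -> P x n -> P x n') ->
  exists n, forall x, A x -> P x n.
Proof.
move=> /finite_seqP[s ->] + Pmono; elim: s => [|a s IH] ex; first by exists 0%N.
have [|n nP] := IH; first by move=> x xs; apply: ex; rewrite /= inE xs orbT.
have [|m mP] := ex a; first by rewrite /= mem_head.
exists (maxn m n) => x /=; rewrite inE => /orP[/eqP->|/nP].
  exact: Pmono (leq_maxl _ _) mP.
exact: Pmono (leq_maxr _ _).
Qed.

Section mass_measurability.
Variable R : realType.
Local Open Scope ereal_scope.

Lemma esum_vertex (K : graph) (a : vertex K -> \bar R) : (forall x, 0 <= a x) ->
  \esum_(x in setT) a x = \sum_(n <oo) oapp a 0 (insub n).
Proof.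
move=> a0; rewrite nneseries_esumT; last by move=> n; case: insub => /=.
pose b n := oapp a 0 (insub n : option (vertex K)).
rewrite (eq_esum (b := b \o val)); last by move=> x _; rewrite /b /= valK.
rewrite -(esum_image setT val b); last by move=> x y _ _; exact: val_inj.
rewrite esum_mkcond; apply: eq_esum => n _; case: ifPn => // nK.
rewrite /b; case: insubP => //= x _ xn; exfalso; move/negP: nK; apply.
by rewrite inE; exists x.
Qed.

(** The mass that the root sends to the vertices at distance [D] is an integral
    against a finite measure depending on the graph. Its measurability in the graph
    then reduces to that of the measure of open sets. *)
Definition sphere_atom (D : nat) (G : rooted_graph) (n : nat) :
    {measure set borel_birooted -> \bar R} :=
  if insub n is Some x then
    if gdist (groot G) x == D
    then (dirac (Birooted (groot G) x : borel_birooted)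
            : {measure set borel_birooted -> \bar R})
    else (mzero : {measure set borel_birooted -> \bar R})
  else (mzero : {measure set borel_birooted -> \bar R}).

Definition sphere_measure D G : {measure set borel_birooted -> \bar R} :=
  mseries (sphere_atom D G) 0.

Definition sphere D (G : rooted_graph) : set (vertex (rooted_base G)) :=
  [set x | gdist (groot G) x = D].
Arguments sphere : clear implicits.

Lemma finite_sphere D G : finite_set (sphere D G).
Proof.
by apply: sub_finite_set (finite_gdist_ball (groot G) D) => x /= ->.
Qed.

Lemma sphere_measureE D G (A : set borel_birooted) :
  sphere_measure D G A =
  \esum_(x in sphere D G `&` [set x | A (Birooted (groot G) x)]) 1.
Proof.
rewrite esum_mkcond esum_vertex => [|x]; last by case: ifP.
rewrite /sphere_measure /= /mseries; apply: eq_eseriesr => n _.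
rewrite /sphere_atom; case: insub => //= x.
case: eqP => [xD|xD]; last first.
  by rewrite /mzero /= ifF //; apply/negbTE; rewrite notin_setE => -[].
transitivity ((Birooted (groot G) x \in A)%:R%:E : \bar R); first by [].
case: ifPn; rewrite ?inE => h.
  by rewrite mem_set //; case: h.
by rewrite memNset // => xA; move/negP: h; apply; rewrite inE.
Qed.

Lemma sphere_integralE D G (F : borel_birooted -> \bar R) :
  measurable_fun setT F -> (forall x, 0 <= F x) ->
  \int[sphere_measure D G]_x F x = \esum_(x in sphere D G) F (Birooted (groot G) x).
Proof.
move=> mF F0; rewrite ge0_integral_measure_series //.
rewrite esum_mkcond esum_vertex => [|x]; last by case: ifP.
apply: eq_eseriesr => n _.
rewrite /sphere_atom; case: insub => /= [x|]; last by rewrite integral_measure_zero.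
case: eqP => [xD|xD].
  by rewrite integral_dirac // diracT mul1e mem_set.
by rewrite integral_measure_zero memNset.
Qed.

Lemma sphere_measure_fin D G A : measurable A -> sphere_measure D G A < +oo.
Proof.
move=> mA; rewrite sphere_measureE esum_fset //; last first.
  exact: finite_setIl (finite_sphere _ _).
rewrite fsbig_finite /=; last exact: finite_setIl (finite_sphere _ _).
by apply: lte_sum_pinfty => i _; exact: ltry.
Qed.

(** The finitely many points counted have a common radius [n] such that the balls of
    radius [n] around both roots ensure membership in [U]. A graph with the same
    ball of radius [D + n] around its root has at least these points. *)
Lemma open_sphere_measure D (U : set borel_birooted) c :
  open (U : set birooted_graph) ->
  open ([set G | c < sphere_measure D G U] : set rooted_graph).
Proof.
move=> /birooted_openP oU; apply/rooted_openP => G cG.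
pose S := sphere D G `&` [set x | U (Birooted (groot G) x)].
have [n nS] : exists n, forall x, S x -> forall H,
    birooted_ball_iso n (Birooted (groot G) x) H -> U H.
  apply: (@finite_uniform _ S (fun x n => forall H,
    birooted_ball_iso n (Birooted (groot G) x) H -> U H)).
  - exact: finite_setIl (finite_sphere _ _).
  - by move=> x [_ /oU].
  - move=> x n n' nn h H xH; apply: h; exact: birooted_ball_iso_le nn xH.
exists (D + n)%N => H [f [fi fr]]; apply: (lt_le_trans cG).
rewrite /= !sphere_measureE -/S.
rewrite /rooted_ball !gball_nat in fi.
have ballG x z : sphere D G x -> (gdist x z <= n)%N -> (gdist (groot G) z <= D + n)%N.
  move=> xD xz; apply: leq_trans (gdist_triangle x _ _) _.
  by rewrite leq_add // xD.
have same z j : (j <= D + n)%N -> (gdist (groot G) z <= D + n)%N ->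
    (gdist (groot G) z <= j)%N <-> (gdist (groot H) (f z) <= j)%N.
  move=> jn zn; rewrite -fr; apply: (induced_iso_gdist fi) => // y /= yj.
    exact: leq_trans jn.
  by rewrite -fr; exact: leq_trans jn.
have fS x : S x -> sphere D H (f x).
  move=> [xD _]; have xn : (gdist (groot G) x <= D + n)%N by rewrite xD leq_addr.
  have le : (gdist (groot H) (f x) <= D)%N.
    by apply/same => //; rewrite ?leq_addr // xD.
  apply/eqP; rewrite eqn_leq le -{1}xD /=; apply/same => //.
  by apply: leq_trans le _; rewrite leq_addr.
have fU x : S x -> U (Birooted (groot H) (f x)).
  move=> Sx; have fxD := fS x Sx; have [xD _] := Sx.
  apply: (nS x Sx); apply/birooted_ball_isoE; exists f; split; last by rewrite /= fr.
  have subG : multiball n _ [:: groot G; x] `<=` [set y | (gdist (groot G) y <= D + n)%N].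
    move=> z [r]; rewrite !inE => /orP[]/eqP-> zn; last exact: ballG zn.
    by apply: leq_trans zn _; rewrite leq_addl.
  have subH : multiball n _ [:: groot H; f x] `<=` [set y | (gdist (groot H) y <= D + n)%N].
    move=> z [r]; rewrite !inE => /orP[]/eqP-> zn.
      by apply: leq_trans zn _; rewrite leq_addl.
    apply: leq_trans (gdist_triangle (f x) _ _) _.
    by rewrite leq_add // fxD.
  apply: (induced_iso_restrict fi subG subH) => z zn.
  have key r : r \in [:: groot G; x] ->
      (gdist r z <= n)%N <-> (gdist (f r) (f z) <= n)%N.
    move=> rr; apply: (induced_iso_gdist fi _ _ zn) => y yn.
      by apply: subG; exists r.
    by apply: subH; exists (f r) => //; have := map_f f rr; rewrite /= fr.
  split=> [[r rr rz]|[s]].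
    by exists (f r); [have := map_f f rr; rewrite /= fr|apply/key].
  rewrite !inE => /orP[]/eqP-> {s} rz; [exists (groot G)|exists x]; rewrite ?inE ?eqxx ?orbT //.
    by apply/key; rewrite ?inE ?eqxx // fr.
  by apply/key; rewrite ?inE ?eqxx ?orbT.
have finj : set_inj S f.
  move=> x y; rewrite !inE => Sx Sy; have [[_ finj _] _] := fi; apply: finj.
    by rewrite inE /=; have [-> _] := Sx; rewrite leq_addr.
  by rewrite inE /=; have [-> _] := Sy; rewrite leq_addr.
rewrite -(esum_image S f (fun=> 1)) // esum_mkcond [leRHS]esum_mkcond.
apply: le_esum => y _; case: ifPn => [|_]; last by case: ifP.
rewrite inE => -[x Sx <-]; rewrite mem_set //; split; [exact: fS|exact: fU].
Qed.

Lemma measurable_sphere_measure D (U : set borel_birooted) : measurable U ->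
  measurable_fun setT (fun G : borel_rooted => sphere_measure D G U).
Proof.
pose P (A : set borel_birooted) :=
  measurable_fun setT (fun G : borel_rooted => sphere_measure D G A).
have openT_P : @open birooted_graph `<=` P.
  move=> A oA; apply: (measurability _ (ErealGenOInfty.measurableE R)) => //.
  move=> _ [_ [x ->] <-]; rewrite setTI.
  apply: sub_sigma_algebra.
  rewrite (_ : _ @^-1` _ = [set G | x%:E < sphere_measure D G A]).
    exact: open_sphere_measure.
  by apply/seteqP; split=> G /=; rewrite in_itv /= andbT.
apply: (@dynkin_induction _ borel_birooted (@open birooted_graph) P) => //.
- by move=> A B; exact: openI.
- by apply: openT_P; exact: openT.
- move=> S mS PS; rewrite /P.
  rewrite (_ : (fun G : borel_rooted => sphere_measure D G (~` S)) =
    (fun G : borel_rooted => sphere_measure D G setT - sphere_measure D G S)).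
    by apply: emeasurable_funB => //; apply: openT_P; exact: openT.
  apply/funext => G; rewrite -setTD measureD ?setTI //.
  exact: sphere_measure_fin.
- move=> F mF tF PF; rewrite /P.
  rewrite (_ : (fun G : borel_rooted => sphere_measure D G (\bigcup_k F k)) =
    (fun G : borel_rooted => \sum_(k <oo) sphere_measure D G (F k))).
    by apply: ge0_emeasurable_sum => // k _; exact: PF.
  apply/funext => G; rewrite measure_semi_bigcup //.
  exact: bigcupT_measurable.
Qed.

Lemma measurable_mass_out (F : borel_birooted -> \bar R) :
  measurable_fun setT F -> (forall G, 0 <= F G) ->
  measurable_fun setT (fun G : borel_rooted =>
    \esum_(x in [set: vertex (rooted_base G)]) F (Birooted (groot G) x)).
Proof.
move=> mF F0.
rewrite (_ : (fun _ => _) = (fun G : borel_rooted =>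
    \sum_(D <oo) \int[sphere_measure D G]_x F x)).
  apply: ge0_emeasurable_sum => [D G _ _|D _]; first exact: integral_ge0.
  apply: (measurable_fun_integral_kernel (l := fun G : borel_rooted => sphere_measure D G)) => //.
  exact: measurable_sphere_measure.
apply/funext => G.
rewrite (_ : setT = \bigcup_D sphere D G); last first.
  by apply/seteqP; split=> x // _; exists (gdist (groot G) x).
rewrite nneseries_sum_bigcup //; last first.
  by move=> i j _ _ [x [<- <-]].
by apply: eq_eseriesr => D _; rewrite sphere_integralE.
Qed.

Definition swap_roots (G : birooted_graph) : birooted_graph :=
  Birooted (root2 G) (Defs.root1 G).

Lemma measurable_swap_roots :
  measurable_fun setT (swap_roots : borel_birooted -> borel_birooted).
Proof.
apply: (@measurability _ _ borel_birooted borel_birooted setT _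
  (@open birooted_graph)) => //.
move=> _ [A /birooted_openP oA <-]; rewrite setTI; apply: sub_sigma_algebra.
apply/birooted_openP => G /oA[n nA]; exists n => H [f [fi f1 f2]]; apply: nA.
by exists f; split=> //; rewrite /birooted_ball /= ![gball (root2 _) _ `|` _]setUC.
Qed.

Lemma measurable_mass_in (F : borel_birooted -> \bar R) :
  measurable_fun setT F -> (forall G, 0 <= F G) ->
  measurable_fun setT (fun G : borel_rooted =>
    \esum_(x in [set: vertex (rooted_base G)]) F (Birooted x (groot G))).
Proof.
move=> mF F0; apply: (@measurable_mass_out (F \o swap_roots)) => [|G]; last exact: F0.
by apply: measurableT_comp => //; exact: measurable_swap_roots.
Qed.

End mass_measurability.

(** * Independent uniform digits *)

HB.instance Definition _ m := isPointed.Build 'I_m.+1 ord0.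

Definition digit_seq m := nat -> 'I_m.+1.
HB.instance Definition _ m := Pointed.on (digit_seq m).

Definition cylinder m N (w : digit_seq m) : set (digit_seq m) :=
  [set u | forall i, (i < N)%N -> u i = w i].

Definition cylinders m : set (set (digit_seq m)) :=
  [set A | A = set0 \/ exists N w, A = cylinder N w].

Notation digit_space m := (g_sigma_algebraType (@cylinders m)).

Section cylinder_sets.
Variable m : nat.
Implicit Types (u w : digit_seq m) (A : set (digit_space m)).

Lemma cylinders_setI : setI_closed (@cylinders m).
Proof.
move=> A B [->|[N [w ->]]]; first by rewrite set0I; left.
move=> [->|[N' [w' ->]]]; first by rewrite setI0; left.
wlog le : N w N' w' / (N <= N')%N => [h|].
  by have [|/ltnW] := leqP N N'; [|rewrite setIC]; exact: h.
have [|no] := pselect (exists u, (cylinder N w `&` cylinder N' w') u); last first.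
  by left; apply/seteqP; split=> u // h; apply: no; exists u.
move=> [u [uw uw']]; right; exists N', w'; apply/seteqP; split=> [v []//|v vw'].
split=> // i iN; rewrite vw' ?(leq_trans iN) // -uw' ?uw //.
exact: leq_trans iN le.
Qed.

Lemma measurable_cylinder N w : measurable (cylinder N w : set (digit_space m)).
Proof. by apply: sub_sigma_algebra; right; exists N, w. Qed.

(** Such a set is the union of the cylinders that it contains, and there are
    countably many cylinders. *)
Lemma measurable_finitary A :
  (forall u, A u -> exists N, cylinder N u `<=` A) -> measurable A.
Proof.
move=> Afin.
have -> : A = \bigcup_N \bigcup_j
   (if `[< cylinder N (dig m j : digit_seq m) `<=` A >]
    then cylinder N (dig m j) else set0).
  apply/seteqP; split=> [u Au|u [N _ [j _]]]; last by case: asboolP => // h /h.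
  have [N uA] := Afin u Au; exists N => //; exists (undig N u) => //.
  have e : cylinder N (dig m (undig N u) : digit_seq m) = cylinder N u.
    by apply/seteqP; split=> v h i iN; have := h i iN; rewrite dig_undig iN.
  by rewrite e asboolT // => i _.
apply: bigcupT_measurable => N; apply: bigcupT_measurable => j.
by case: asboolP => _; [exact: measurable_cylinder|exact: measurable0].
Qed.

Lemma measurable_digit i (a : nat) :
  measurable ([set u | u i = a :> nat] : set (digit_space m)).
Proof.
apply: measurable_finitary => u ua; exists i.+1 => v uv.
by rewrite /= uv.
Qed.

Definition translate (s : digit_seq m) (u : digit_space m) : digit_space m :=
  fun i => u i + s i.

Lemma translate_cylinder s N w : translate s @^-1` cylinder N w =
  cylinder N ((fun i => w i - s i) : digit_seq m).
Proof.
apply/seteqP; split=> u h i iN; have := h i iN; rewrite /translate.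
  by move=> <-; rewrite addrK.
by move=> ->; rewrite subrK.
Qed.

Lemma measurable_translate s : measurable_fun setT (translate s).
Proof.
apply: (@measurability _ _ (digit_space m) (digit_space m) setT _ (@cylinders m)) => //.
move=> _ [A [->|[N [w ->]]] <-]; rewrite setTI ?preimage_set0 //.
by rewrite translate_cylinder; exact: measurable_cylinder.
Qed.

End cylinder_sets.

Section digit_measure.
Variables (R : realType) (m : nat).
Local Notation M := m.+1.
Implicit Types (w : digit_seq m) (x : R).
Local Open Scope ereal_scope.

Definition unit_uniform : probability (measurableTypeR R) R :=
  uniform_prob (@ltr01 R).

(** The digits of a real number in base [M]. Those of a uniform real number are
    independent and uniform, which gives the law of a random sequence. *)
Definition expansion (x : measurableTypeR R) : digit_space m :=
  fun i => if (0 <= x < 1)%R then inord (Num.truncn (x * (M ^ i.+1)%:R)%R %% M) else ord0.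

(** The real numbers whose first [N] digits are those of [w] are those between
    [code N w] and [(code N w).+1], in units of [M ^ - N]. *)
Fixpoint code N w : nat := if N is N'.+1 then (code N' w * M + w N')%N else 0%N.

Let code_lt N w : (code N w < M ^ N)%N.
Proof.
elim: N => //= N IH; rewrite expnSr -ltn_divLR // divnMDl // divn_small //.
by rewrite addn0.
Qed.

Let truncn_divM x : (0 <= x)%R -> (Num.truncn (x * M%:R)%R %/ M = Num.truncn x)%N.
Proof.
move=> x0; apply/esym/truncn_def; have M0 : (0 < M%:R :> R)%R by rewrite ltr0n.
have /truncn_itv/andP[t1 t2] : (0 <= x * M%:R)%R by rewrite mulr_ge0.
set q := Num.truncn _ in t1 t2 *; apply/andP; split.
  rewrite -(ler_pM2r M0); apply: le_trans t1; rewrite -natrM ler_nat.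
  exact: leq_trunc_div.
rewrite -(ltr_pM2r M0); apply: lt_le_trans t2 _; rewrite -natrM ler_nat.
by rewrite ltn_ceil.
Qed.

Let expansion_code N w x : (0 <= x < 1)%R ->
  cylinder N w (expansion x) <-> Num.truncn (x * (M ^ N)%:R)%R = code N w.
Proof.
move=> x01; have x0 : (0 <= x)%R by case/andP: x01.
elim: N => [|N IH].
  by split=> // _; rewrite /= expn0 mulr1; apply: truncn_def; rewrite mulr0n.
have -> : (cylinder N.+1 w (expansion x) <->
    cylinder N w (expansion x) /\ expansion x N = w N).
  split=> [h|[h e] i]; first by split=> [i iN|]; apply: h; rewrite // ltnS ltnW.
  by rewrite ltnS leq_eqVlt => /orP[/eqP->//|]; exact: h.
rewrite IH /expansion x01; set q := Num.truncn (x * (M ^ N.+1)%:R)%R.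
have <- : (q %/ M = Num.truncn (x * (M ^ N)%:R)%R)%N.
  by rewrite -truncn_divM ?mulr_ge0 // /q expnSr natrM mulrA.
split=> [[e1 /(congr1 val)]|/= e].
  by rewrite /= inordK ?ltn_mod // => e2; rewrite (divn_eq q M) e1 e2.
rewrite e divnMDl // divn_small // addn0; split=> //.
by apply: val_inj; rewrite /= inordK ?ltn_mod // modnMDl modn_small.
Qed.

Let code_itv N w : set (measurableTypeR R) :=
  `[((code N w)%:R / (M ^ N)%:R)%R, ((code N w).+1%:R / (M ^ N)%:R)%R[%classic.

Let MN_gt0 N : (0 < (M ^ N)%:R :> R)%R. Proof. by rewrite ltr0n expn_gt0. Qed.

Let code_itv_unit N w : code_itv N w `<=` `[0%R, 1%R[%classic.
Proof.
move=> x; rewrite /code_itv /= !in_itv /= => /andP[x1 x2]; apply/andP; split.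
  by apply: le_trans x1; rewrite divr_ge0.
apply: lt_le_trans x2 _; rewrite ler_pdivrMr // mul1r ler_nat.
exact: code_lt.
Qed.

Let expansion_cylinder N w : expansion @^-1` cylinder N w =
  code_itv N w `|` (if `[< cylinder N w (fun=> ord0) >] then ~` `[0%R, 1%R[%classic else set0).
Proof.
apply/seteqP; split=> x.
  move=> /= xw; have [x01|x01] := boolP (0 <= x < 1)%R.
    left; move: xw; rewrite (expansion_code N w x01) => e.
    have x0 : (0 <= x)%R by case/andP: x01.
    have /truncn_itv : (0 <= x * (M ^ N)%:R)%R by rewrite mulr_ge0.
    by rewrite e /code_itv /= in_itv /= ler_pdivrMr // ltr_pdivlMr.
  right; rewrite asboolT; first by rewrite /= in_itv /=; exact/negP.
  by move=> i iN; rewrite -(xw i iN) /expansion (negPf x01).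
case=> [xw|].
  have := code_itv_unit xw; rewrite /= in_itv /= => x01.
  apply/(expansion_code N w x01)/truncn_def.
  by move: xw; rewrite /code_itv /= in_itv /= ler_pdivrMr // ltr_pdivlMr.
case: asboolP => // w0; rewrite /= in_itv /= => /negP x01 i iN.
by rewrite /expansion (negPf x01) -w0.
Qed.

Let measurable_code_itv N w : measurable (code_itv N w).
Proof. exact: measurable_itv. Qed.

Lemma measurable_expansion : measurable_fun setT expansion.
Proof.
apply: (@measurability _ _ (measurableTypeR R) (digit_space m) setT _ (@cylinders m)) => //.
move=> _ [A [->|[N [w ->]]] <-]; rewrite setTI ?preimage_set0 //.
rewrite expansion_cylinder; apply: measurableU => //.
by case: asboolP => _ //; apply: measurableC; exact: measurable_itv.
Qed.

HB.instance Definition _ := isMeasurableFun.Build _ _ _ _ expansion measurable_expansion.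

Let unit_uniform_itv (a b : R) : (0 <= a)%R -> (a < b)%R -> (b <= 1)%R ->
  unit_uniform `[a, b[%classic = (b - a)%:E.
Proof.
move=> a0 ab b1; rewrite /unit_uniform /= /uniform_prob.
rewrite (eq_integral (fun=> 1)); last first.
  move=> x; rewrite inE /= in_itv /= => /andP[x1 x2].
  by rewrite /uniform_pdf subr0 invr1 ifT //; apply/andP; split;
    [exact: le_trans x1|apply: ltW; exact: lt_le_trans b1].
rewrite integral_cst //= mul1e lebesgue_measure_itv /= lte_fin ab.
by rewrite -EFinB.
Qed.

Let expansion_prob_cylinder N w :
  distribution unit_uniform expansion (cylinder N w) = ((M ^ N)%:R^-1)%:E.
Proof.
rewrite /distribution /pushforward expansion_cylinder.
have out : unit_uniform (~` `[0%R, 1%R[%classic) = 0.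
  by rewrite probability_setC // unit_uniform_itv // subr0 subee.
have itv : unit_uniform (code_itv N w) = ((M ^ N)%:R^-1)%:E.
  rewrite unit_uniform_itv ?divr_ge0 ?ltr_pM2r ?invr_gt0 ?ltr_nat //.
    by rewrite -mulrBl -natr1 addrAC subrr add0r mul1r.
  by rewrite ler_pdivrMr // mul1r ler_nat code_lt.
case: asboolP => _; last by rewrite setU0.
have mC : measurable (~` `[0%R, 1%R[%classic : set (measurableTypeR R)).
  by apply: measurableC; exact: measurable_itv.
have disj : code_itv N w `&` ~` `[0%R, 1%R[%classic = set0.
  by apply/seteqP; split=> x // [/code_itv_unit].
have -> := measureU unit_uniform (measurable_code_itv N w) mC disj.
by rewrite [X in X + _]itv [X in _ + X]out adde0.
Qed.

Fact digit_prob_exists : {P : probability (digit_space m) R |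
  forall N w, P (cylinder N w) = ((M ^ N)%:R^-1)%:E}.
Proof.
exists (distribution unit_uniform expansion); exact: expansion_prob_cylinder.
Qed.

(** The law of a sequence of independent and uniform digits. *)
Definition digit_prob : probability (digit_space m) R := sval digit_prob_exists.

Lemma digit_prob_cylinder N w : digit_prob (cylinder N w) = ((M ^ N)%:R^-1)%:E.
Proof. exact: (svalP digit_prob_exists). Qed.

(** Translations permute the cylinders of a given length, which have equal
    probabilities. *)
Lemma digit_prob_translate (s : digit_seq m) (A : set (digit_space m)) : measurable A ->
  digit_prob (translate s @^-1` A) = digit_prob A.
Proof.
move=> mA.
have mt := measurable_translate s.
pose tX : {mfun digit_space m >-> digit_space m} :=
  HB.pack (translate s) (isMeasurableFun.Build _ _ _ _ _ mt).
apply: (@measure_unique _ R (digit_space m) (@cylinders m) (fun=> setT) _ _ _ _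
  (distribution digit_prob tX) digit_prob) => //.
- exact: cylinders_setI.
- by move=> _; right; exists 0%N, (fun=> ord0); apply/seteqP; split=> u // _ i.
- by rewrite bigcup_const.
- move=> B [->|[N [w ->]]]; first by rewrite !measure0.
  rewrite [LHS]/(digit_prob (translate s @^-1` cylinder N w)) translate_cylinder.
  exact: etrans (digit_prob_cylinder N _) (esym (digit_prob_cylinder N w)).
- move=> _; apply: le_lt_trans (ltry 1).
  exact: (probability_le1 (distribution digit_prob tX) measurableT).
Qed.

End digit_measure.

(** * Recurrence of a digit *)

Section independent_digits.
Variables (R : realType) (m : nat) (a : 'I_m.+1).
Local Notation M := m.+1.
Local Notation nu := (digit_prob R m).
Implicit Types (A : set (digit_space m)).
Local Open Scope ereal_scope.

Definition single_digit i (b : 'I_m.+1) : digit_seq m :=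
  fun j => if j == i then b else 0%R.

Let digit_is i (b : nat) : set (digit_space m) := [set u | u i = b :> nat].

(** The [M] sets of sequences in [A] with a given digit in place [i] are
    translates of one another. *)
Lemma digit_independent A i : measurable A ->
  (forall b, translate (single_digit i b) @^-1` A = A) ->
  nu A = M%:R%:E * nu (A `&` digit_is i a).
Proof.
move=> mA inv.
have AE : A = \big[setU/set0]_(b < M) (A `&` digit_is i b).
  rewrite -(bigcup_mkord M (fun b => A `&` digit_is i b)).
  apply/seteqP; split=> [u Au|u [b _ []//]].
  by exists (u i : nat) => //; exact: ltn_ord.
have mF b : measurable (A `&` digit_is i b).
  by apply: measurableI => //; exact: measurable_digit.
have tF : trivIset setT (fun b => A `&` digit_is i b).
  by move=> b c _ _ [u [[_ <-] [_ <-]]].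
have := measure_bigsetU nu mF tF M; rewrite -AE => ->.
rewrite (eq_bigr (fun=> (fine (nu (A `&` digit_is i a)))%:E)) => [|b _].
  rewrite sumEFin sumr_const card_ord -[in LHS]mulr_natl EFinM fineK //.
  by apply: fin_num_measure; exact: mF.
rewrite fineK; last by apply: fin_num_measure; exact: mF.
rewrite -(digit_prob_translate R (single_digit i (a - b)%R)); last first.
  by apply: measurableI => //; exact: measurable_digit.
congr (nu _); rewrite preimage_setI inv; congr (_ `&` _).
apply/seteqP; split=> u; rewrite /digit_is /preimage /mkset /translate /single_digit eqxx.
  by move=> /val_inj ->; rewrite addrCA subrr addr0.
by move=> /val_inj e; congr val; apply: (addIr (a - b)%R); rewrite e addrCA subrr addr0.
Qed.

Definition avoids n K : set (digit_space m) :=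
  [set u | forall i, (n <= i)%N -> (i < n + K)%N -> u i <> a].

Lemma measurable_avoids n K : measurable (avoids n K).
Proof.
apply: measurable_finitary => u uK; exists (n + K)%N => v vu i ni iK.
by rewrite vu //; exact: uK.
Qed.

Let fin A : measurable A -> nu A \is a fin_num.
Proof. exact: fin_num_measure. Qed.

(** The probability is [(1 - 1/M) ^ K]; this weaker bound, by induction on [K],
    suffices to see that it vanishes as [K] grows. *)
Lemma avoids_prob n K : (fine (nu (avoids n K)) * (K + M)%:R <= M%:R)%R.
Proof.
elim: K => [|K IH].
  rewrite add0n ler_piMl // -[leRHS]/(fine 1%:E) fine_le ?fin //.
    exact: measurable_avoids.
  exact: (probability_le1 nu (measurable_avoids _ _)).
have mD := measurable_digit (n + K) a; have mA := measurable_avoids n K.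
have split : avoids n K = avoids n K.+1 `|` (avoids n K `&` digit_is (n + K) a).
  apply/seteqP; split=> u.
    move=> uK; have [e|ne] := eqVneq (u (n + K)%N) a.
      by right; split => //; rewrite /digit_is /= e.
    left=> i ni; rewrite addnS ltnS leq_eqVlt => /orP[/eqP->|]; first exact/eqP.
    exact: uK.
  by case=> [uK i ni iK|[]//]; apply: uK => //; rewrite addnS ltnW.
have U : nu (avoids n K) =
    nu (avoids n K.+1) + nu (avoids n K `&` digit_is (n + K) a).
  rewrite {1}split (measureU nu) //; [exact: measurable_avoids|exact: measurableI|].
  apply/seteqP; split=> // u [uK [_ ua]]; apply: (uK (n + K)%N).
  - by rewrite leq_addr.
  - by rewrite addnS.
  - exact: val_inj.
have I : nu (avoids n K) = M%:R%:E * nu (avoids n K `&` digit_is (n + K) a).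
  apply: digit_independent => // b; apply/seteqP; split=> u uK i ni iK;
  have := uK i ni iK; rewrite /= /translate /single_digit;
  by rewrite (ltn_eqF iK) addr0.
have mAS := measurable_avoids n K.+1.
have mI : measurable (avoids n K `&` digit_is (n + K) a) by exact: measurableI.
have {}U := etrans (congr1 fine U) (fineD (fin mAS) (fin mI)).
have {}I := etrans (congr1 fine I) (fineM (erefl : M%:R%:E \is a fin_num) (fin mI)).
rewrite /= in I.
have y0 := fine_ge0 (measure_ge0 nu (avoids n K.+1)).
have z0 := fine_ge0 (measure_ge0 nu (avoids n K `&` digit_is (n + K) a)).
move: U I IH y0 z0; set x := fine (nu (avoids n K)).
set y := fine (nu (avoids n K.+1)).
set z := fine (nu (avoids n K `&` _)) => U I IH y0 z0.
rewrite natrD in IH; rewrite natrD -(natr1 K).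
move: (K%:R : R) (M%:R : R) (ler0n R K) (ler0n R M) U I IH => k M0 k0 M1 U I IH.
have -> : y = (M0 * z - z)%R by lra.
have : (0 <= z * (k + 1))%R by rewrite mulr_ge0 ?addr_ge0.
by move: IH; rewrite I; lra.
Qed.

(** Unlike the mere infinite occurrence of [a], this is a closed condition. *)
Definition recurrent (L : nat -> nat) : set (digit_space m) :=
  [set u | forall n, exists i, [/\ (n <= i)%N, (i < n + L n)%N & u i = a]].

Lemma recurrentC L : ~` recurrent L = \bigcup_n avoids n (L n).
Proof.
apply/seteqP; split=> u.
  move=> /existsNP[n nu_]; exists n => // i ni iL e; apply: nu_; by exists i.
move=> [n _ un] /(_ n)[i [ni iL ui]]; exact: un ui.
Qed.

Lemma measurable_recurrent L : measurable (recurrent L).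
Proof.
rewrite -[recurrent L]setCK recurrentC; apply: measurableC.
by apply: bigcupT_measurable => n; exact: measurable_avoids.
Qed.

(** The gaps [L n] are chosen such that the digits from [n] on avoid [a] for that
    long with probability at most [e / 2 ^ n.+1]. *)
Lemma recurrent_prob (e : R) : (0 < e)%R ->
  exists L, nu (~` recurrent L) <= e%:E.
Proof.
move=> e0.
have exL n : exists K, nu (avoids n K) <= (e / (2 ^ n.+1)%:R)%:E.
  have d0 : (0 < e / (2 ^ n.+1)%:R)%R by rewrite divr_gt0 // ltr0n expn_gt0.
  set d := (e / _)%R in d0 *; pose K := (Num.truncn (M%:R / d)%R).+1.
  exists K; rewrite -(fineK (fin (measurable_avoids n K))) lee_fin.
  have := avoids_prob n K; set x := fine _ => xK.
  have x0 : (0 <= x)%R by rewrite fine_ge0.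
  have := truncnS_gt (M%:R / d)%R; rewrite -/K ltr_pdivrMr // => MK.
  rewrite leNgt; apply/negP => dx; move: xK; apply/negP; rewrite -ltNge natrD.
  apply: lt_le_trans MK _; rewrite mulrC mulrDr.
  have : (0 <= x * M%:R)%R by rewrite mulr_ge0.
  have : (d * K%:R <= x * K%:R)%R by rewrite ler_wpM2r // ltW.
  by move: (x * _)%R (x * _)%R (d * _)%R => p q r; lra.
have [L hL] := choice exL; exists L.
rewrite recurrentC.
apply: le_trans (@measure_sigma_subadditive _ _ _ nu (\bigcup_n avoids n (L n))
  (fun n => avoids n (L n)) _ _ _) _.
- by move=> n; exact: measurable_avoids.
- by apply: bigcupT_measurable => n; exact: measurable_avoids.
- exact: subset_refl.
apply: le_trans (_ : \sum_(n <oo) (0 + (e / (2 ^ n.+1)%:R)%:E) <= _).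
  by apply: lee_nneseries => // n _; rewrite add0e; exact: hL.
apply: le_trans (epsilon_trick _ _ _) _ => //; first exact: ltW.
by rewrite eseries0 ?add0e.
Qed.

End independent_digits.

(** * The random tiling graph *)

Section tiling_locality.
Set Default Proof Using "All".
Variables (R : realType) (k m : nat).
Hypotheses (k3 : (3 <= k)%N) (km : (k ^ 2 <= m.+1)%N).
Local Notation M := m.+1.
Local Notation TG := (tiling_graph R k3 km).
Local Notation inside_block := (@inside_block R k m).
Implicit Types (u v : digit_seq m).

(** All the edges of a vertex off the boundary of its block are in the block, and
    are determined by the digits that place tiles in the block. *)
Lemma edge_agree u v N (x y : all_nat) : (val x < M ^ N)%N ->
  inside_block N (address u (val x)) -> cylinder N u v ->
  nat_edge R k u x y = nat_edge R k v x y.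
Proof.
move=> xN ix uv.
have ag z : agree N (address u z) (address v z).
  by move=> i iN; rewrite /address uv.
have ix' := inside_block_agree k3 km (ag _) ix.
apply/idP/idP; rewrite /nat_edge => e.
  have yN := inside_block_edge k3 km xN ix e; move: e.
  by rewrite !(tile_edgeE _ k3 km _ xN yN) (adj_agree _ k3 km (ag _) (ag _)).
have yN := inside_block_edge k3 km xN ix' e; move: e.
by rewrite !(tile_edgeE _ k3 km _ xN yN) (adj_agree _ k3 km (ag _) (ag _)).
Qed.

Lemma finite_multiball n (G : graph) (rs : seq (vertex G)) :
  finite_set (multiball n G rs).
Proof.
rewrite (_ : multiball n G rs =
    \bigcup_(r in [set` rs]) [set y | (gdist r y <= n)%N]).
  apply: bigcup_finite => [|r _]; first exact: finite_seq.
  exact: finite_gdist_ball.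
by apply/seteqP; split=> y [r rr ry]; exists r.
Qed.

(** Balls are finite, so one block contains them off its boundary. *)
Lemma tiling_local u (g : good k u) n (rs : seq all_nat) : exists N,
  forall v, cylinder N u v -> forall x y : all_nat,
    multiball n (TG g) rs x -> nat_edge R k u x y = nat_edge R k v x y.
Proof.
have [N hN] : exists N, forall x : all_nat, multiball n (TG g) rs x ->
    (val x < M ^ N)%N /\ inside_block N (address u (val x)).
  apply: (@finite_uniform _ (multiball n (TG g) rs)
    (fun (x : all_nat) N => (val x < M ^ N)%N /\ inside_block N (address u (val x)))).
  - exact: finite_multiball.
  - by move=> x _; exact: good_inside_block.
  - move=> x N N' NN' [xN ix]; split.
      by apply: leq_trans xN _; rewrite leq_exp2l // (M_gt1 R k3 km).
    elim: N' NN' => [|N' IH]; first by rewrite leqn0 => /eqP <-.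
    by rewrite leq_eqVlt => /orP[/eqP <-//|/IH/(inside_blockS k3 km)].
by exists N => v uv x y /hN[xN ix]; exact: edge_agree xN ix uv.
Qed.

Lemma tiling_ball_agree u v (g : good k u) (g' : good k v) n (rs : seq all_nat) :
  (forall x y : all_nat, multiball n (TG g) rs x ->
     nat_edge R k u x y = nat_edge R k v x y) ->
  forall n' (r z : all_nat), (n' <= n)%N -> r \in rs ->
    (@gdist (TG g) r z <= n')%N = (@gdist (TG g') r z <= n')%N.
Proof.
move=> uv; elim=> [|n' IH] r z nn rr.
  by apply/idP/idP; rewrite leqn0 => /eqP/gdist_eq0 ->; rewrite gdist0.
have step (y : all_nat) : (@gdist (TG g) r y <= n')%N ->
    nat_edge R k u y z = nat_edge R k v y z.
  by move=> ry; apply: uv; exists r => //; apply: leq_trans ry _; exact: ltnW.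
apply/idP/idP => /gdistS[<-|[y eyz ry]]; rewrite ?gdist0 //.
  have e' : @edge (TG g') y z by rewrite /= -(step y).
  apply: leq_trans (gdist_triangle (G := TG g') y _ _) _.
  by rewrite -addn1; apply: leq_add (gdist_edge e'); rewrite -IH // ltnW.
rewrite -(IH _ _ (ltnW nn) rr) in ry.
have e' : @edge (TG g) y z by rewrite /= (step y).
apply: leq_trans (gdist_triangle (G := TG g) y _ _) _.
by rewrite -addn1; apply: leq_add (gdist_edge e').
Qed.

Lemma tiling_local_iso u (g : good k u) n (rs : seq all_nat) : exists N,
  forall v (g' : good k v), cylinder N u v ->
    @multiball_iso n (TG g) rs (TG g') rs.
Proof.
have [N hN] := tiling_local g n rs; exists N => v g' uv.
have e := hN v uv; exists (id : all_nat -> all_nat); rewrite map_id; split=> //.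
have b : multiball n (TG g) rs = multiball n (TG g') rs.
  by apply/seteqP; split=> z [r rr rz]; exists r => //;
    rewrite (tiling_ball_agree g' e z (leqnn n) rr) in rz *.
rewrite -[X in induced_iso _ X _]b; split; last by move=> x y xb _; rewrite /= (e x y xb).
by split=> // z bz; exists z.
Qed.

Definition graph_vertex u (g : good k u) (x : nat) : vertex (TG g) :=
  exist _ x (erefl true).

(** The sequences that are not good, which have probability zero, are sent to a
    default graph. *)
Definition sample u : rooted_graph :=
  match pselect (good k u) with
  | left g => Rooted (graph_vertex g 0)
  | right _ => point
  end.

Definition bisample x y u : birooted_graph :=
  match pselect (good k u) with
  | left g => Birooted (graph_vertex g x) (graph_vertex g y)
  | right _ => point
  end.

Lemma sampleE u (g : good k u) : sample u = Rooted (graph_vertex g 0).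
Proof. by rewrite /sample; case: pselect => // g'; rewrite (Prop_irrelevance g' g). Qed.

Lemma bisampleE x y u (g : good k u) :
  bisample x y u = Birooted (graph_vertex g x) (graph_vertex g y).
Proof. by rewrite /bisample; case: pselect => // g'; rewrite (Prop_irrelevance g' g). Qed.

Definition good_set : set (digit_space m) := [set u | good k u].

Lemma measurable_good : measurable good_set.
Proof.
rewrite (_ : good_set = \bigcap_n ~` \bigcap_K avoids (star k m) n K).
  apply: bigcapT_measurable => n; apply: measurableC.
  by apply: bigcapT_measurable => K; exact: measurable_avoids.
apply/seteqP; split=> u.
  move=> gu n _ av; have [i ni ui] := gu n.
  by apply: (av (i - n).+1 I i ni _ ui); lia.
move=> h n.
have /existsNP[K /not_implyP[_]] : ~ (forall K, setT K -> avoids (star k m) n K u) := h n I.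
by move=> /existsNP[i /not_implyP[ni /not_implyP[_ /contrapT ui]]]; exists i.
Qed.

(** The preimage of a set [A] of [G] consists of the good sequences in the union of
    the cylinders whose good sequences map into [A], and possibly of all sequences
    that are not good. *)
Lemma measurable_local d (T : measurableType d) (G : set (set T))
    (f : digit_space m -> T) (t : T) : @measurable _ T = <<s G >> ->
  (forall u, ~ good k u -> f u = t) ->
  (forall A u, G A -> good k u -> A (f u) -> exists N, forall v, good k v ->
     cylinder N u v -> A (f v)) -> measurable_fun setT f.
Proof.
move=> mG bad loc; apply: (measurability _ mG) => _ [A GA <-]; rewrite setTI.
pose B := [set u | exists N, forall v, good k v -> cylinder N u v -> A (f v)].
have mB : measurable (B : set (digit_space m)).
  apply: measurable_finitary => u [N uN]; exists N => v uv; exists N => w gw vw.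
  by apply: uN => // i iN; rewrite vw // uv.
rewrite (_ : f @^-1` A = (good_set `&` B) `|`
    (~` good_set `&` (if `[< A t >] then setT else set0))).
  apply: measurableU; first by apply: measurableI => //; exact: measurable_good.
  apply: measurableI; first by apply: measurableC; exact: measurable_good.
  by case: asboolP => _; [exact: measurableT|exact: measurable0].
apply/seteqP; split=> u.
  move=> /= Au; have [gu|nu] := pselect (good k u).
    by left; split=> //; exact: loc.
  by right; split=> //; rewrite asboolT // -(bad _ nu).
case=> [[gu [N uN]]|[nu]]; first by apply: uN.
by case: asboolP => // At _; rewrite /preimage /mkset bad.
Qed.

Lemma measurable_sample :
  measurable_fun setT (sample : digit_space m -> borel_rooted).
Proof.
apply: (@measurable_local _ borel_rooted (@open rooted_graph) _ point) => //.
  by move=> u nu; rewrite /sample; case: pselect.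
move=> A u /rooted_openP oA g; rewrite (sampleE g) => /oA[n nA].
have [N hN] := tiling_local_iso g n [:: graph_vertex g 0].
exists N => v g' uv; rewrite (sampleE g'); apply: nA; apply/rooted_ball_isoE.
exact: hN.
Qed.

Lemma measurable_bisample x y :
  measurable_fun setT (bisample x y : digit_space m -> borel_birooted).
Proof.
apply: (@measurable_local _ borel_birooted (@open birooted_graph) _ point) => //.
  by move=> u nu; rewrite /bisample; case: pselect.
move=> A u /birooted_openP oA g; rewrite (bisampleE _ _ g) => /oA[n nA].
have [N hN] := tiling_local_iso g n [:: graph_vertex g x; graph_vertex g y].
exists N => v g' uv; rewrite (bisampleE _ _ g'); apply: nA; apply/birooted_ball_isoE.
exact: hN.
Qed.

End tiling_locality.

(** * Unimodularity *)

Section mass_transport.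
Set Default Proof Using "All".
Variables (R : realType) (k m : nat).
Hypotheses (k3 : (3 <= k)%N) (km : (k ^ 2 <= m.+1)%N).
Local Notation M := m.+1.
Local Notation TG := (tiling_graph R k3 km).
Local Notation nu := (digit_prob R m).
Local Notation sample := (sample R k3 km).
Local Notation bisample := (bisample R k3 km).
Implicit Types (u v : digit_space m) (n x y N : nat).

Lemma dig_inj x y : (forall i, dig m x i = dig m y i) -> x = y.
Proof.
move=> e; have xN : (x < M ^ maxn x y)%N by apply: (ltn_Mexp_le R k3 km); exact: leq_maxl.
have yN : (y < M ^ maxn x y)%N by apply: (ltn_Mexp_le R k3 km); exact: leq_maxr.
apply: etrans (esym (undig_dig xN)) (etrans _ (undig_dig yN)).
by apply: eq_undig => i _; exact: e.
Qed.

Lemma undig_finite (w : digit_seq m) N : (forall i, (N <= i)%N -> w i = 0) ->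
  forall i, dig m (undig N w) i = w i.
Proof. by move=> w0 i; rewrite dig_undig; case: ltnP => // /w0 ->. Qed.

Let dig_large x i : (x <= i)%N -> dig m x i = 0.
Proof. by move=> xi; apply: dig_small; exact: (ltn_Mexp_le R k3 km). Qed.

(** The label of a vertex relative to the vertex [n] as root. *)
Definition sub_label n x := undig (maxn x n) (fun i => dig m x i - dig m n i).

Definition add_label n x := undig (maxn x n) (fun i => dig m x i + dig m n i).

Lemma dig_sub_label n x i : dig m (sub_label n x) i = dig m x i - dig m n i.
Proof.
apply: (undig_finite (w := fun i => dig m x i - dig m n i)) => j.
by rewrite geq_max => /andP[? ?]; rewrite !dig_large // subr0.
Qed.

Lemma dig_add_label n x i : dig m (add_label n x) i = dig m x i + dig m n i.
Proof.
apply: (undig_finite (w := fun i => dig m x i + dig m n i)) => j.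
by rewrite geq_max => /andP[? ?]; rewrite !dig_large // addr0.
Qed.

Lemma sub_labelK n : cancel (sub_label n) (add_label n).
Proof. by move=> x; apply: dig_inj => i; rewrite dig_add_label dig_sub_label subrK. Qed.

Lemma add_labelK n : cancel (add_label n) (sub_label n).
Proof. by move=> x; apply: dig_inj => i; rewrite dig_sub_label dig_add_label addrK. Qed.

Definition opp_label n := sub_label n 0.

Lemma dig0 i : dig m 0 i = 0. Proof. by apply: dig_small; rewrite expn_gt0. Qed.

Lemma opp_labelK : involutive opp_label.
Proof.
by move=> n; apply: dig_inj => i; rewrite !dig_sub_label dig0 !sub0r opprK.
Qed.

Lemma sub_label_diag n : sub_label n n = 0%N.
Proof. by apply: dig_inj => i; rewrite dig_sub_label subrr dig0. Qed.

(** The sequence of digits seen from the vertex [n]. *)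
Definition reroot n u : digit_space m := translate (dig m n : digit_seq m) u.

Lemma good_reroot n u : good k (reroot n u) <-> good k u.
Proof.
have e i : (n <= i)%N -> reroot n u i = u i.
  by move=> ni; rewrite /reroot /translate dig_large // addr0.
split=> g j; have [i] := g (maxn n j); rewrite geq_max => /andP[ni ji];
  by [rewrite e // => ui; exists i|move=> ui; exists i; rewrite // e].
Qed.

Lemma reroot_iso n u (g : good k u) (g' : good k (reroot n u)) N :
  birooted_ball_iso N
    (Birooted (graph_vertex R k3 km g n) (graph_vertex R k3 km g 0))
    (Birooted (graph_vertex R k3 km g' 0) (graph_vertex R k3 km g' (opp_label n))).
Proof.
pose f (x : vertex (TG g)) : vertex (TG g') := graph_vertex R k3 km g' (sub_label n (val x)).
have fi : induced_iso setT setT f.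
  split; first split=> //.
  - move=> x y _ _ /(congr1 val) /= e; apply: val_inj; exact: can_inj (sub_labelK n) _ _ e.
  - move=> y _; exists (graph_vertex R k3 km g (add_label n (val y))) => //.
    by apply: val_inj; rewrite /= add_labelK.
  move=> x y _ _ /=; rewrite /nat_edge /=.
  pose L := maxn (maxn (val x) (val y)) (maxn (sub_label n (val x)) (sub_label n (val y))).
  have lt z : (z <= L)%N -> (z < M ^ L)%N by exact: (ltn_Mexp_le R k3 km).
  rewrite !(tile_edgeE R k3 km _ (N := L)) ?lt // /L ?leq_max ?leqnn ?orbT //.
  by apply: (adj_agree R k3 km) => i _;
    rewrite /address /reroot /translate dig_sub_label (addrC _ (- _)) addrA addrK.
apply/birooted_ball_isoE; exists f; split; last first.
  by rewrite /= /f /= sub_label_diag.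
apply: (induced_iso_restrict fi) => // x _.
have key (r : vertex (TG g)) : (gdist r x <= N)%N <-> (gdist (f r) (f x) <= N)%N.
  by apply: (induced_iso_gdist fi).
have f1 : f (graph_vertex R k3 km g n) = graph_vertex R k3 km g' 0.
  by rewrite /f /= sub_label_diag.
have f2 : f (graph_vertex R k3 km g 0) = graph_vertex R k3 km g' (opp_label n) by [].
split=> -[r]; rewrite !inE => /orP[]/eqP -> /= h.
- by exists (graph_vertex R k3 km g' 0); rewrite ?inE ?eqxx // -f1; apply/key.
- by exists (graph_vertex R k3 km g' (opp_label n)); rewrite ?inE ?eqxx ?orbT // -f2; apply/key.
- by exists (graph_vertex R k3 km g n); rewrite ?inE ?eqxx //; apply/key; rewrite f1.
- by exists (graph_vertex R k3 km g 0); rewrite ?inE ?eqxx ?orbT //; apply/key; rewrite f2.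
Qed.

Definition sample_rv : {mfun digit_space m >-> borel_rooted} :=
  HB.pack (sample : digit_space m -> borel_rooted)
    (isMeasurableFun.Build _ _ (digit_space m) borel_rooted _ (measurable_sample R k3 km)).

Definition tiling_law : probability borel_rooted R := distribution nu sample_rv.

Local Open Scope ereal_scope.

Section transport.
Variable F : borel_birooted -> \bar R.
Hypotheses (mF : measurable_fun setT F) (F0 : forall G, 0 <= F G).

(* The contribution of the [n]-th vertex to the mass sums. The sequences that are
   not good are mapped to the graph with the single vertex 0. *)
Let term (b : digit_space m -> borel_birooted) n u : \bar R :=
  if `[< good k u >] then F (b u) else if n == 0%N then F point else 0.

Let term_ge0 b n u : 0 <= term b n u.
Proof. by rewrite /term; case: ifP => // _; case: ifP. Qed.

Let measurable_term b n : measurable_fun setT b -> measurable_fun setT (term b n).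
Proof.
move=> mb; apply: measurable_fun_ifT => //.
- apply: (measurable_fun_bool true).
  rewrite setTI (_ : _ @^-1` _ = good_set k (m := m)); first exact: (measurable_good R k3 km).
  by apply/seteqP; split=> u /= /asboolP.
- exact: measurableT_comp.
Qed.

Let out_sample u :
  \esum_(x in [set: vertex (rooted_base (sample u))]) F (Birooted (groot (sample u)) x) =
  \sum_(n <oo) term (bisample 0 n) n u.
Proof.
rewrite esum_vertex //; apply: eq_eseriesr => n _; rewrite /term.
case: asboolP => gu.
  rewrite (bisampleE _ _ _ _ _ gu) (sampleE _ _ _ gu) /=.
  by rewrite (insubT (fun x => vset (TG gu) x) (erefl true)).
rewrite /sample; case: pselect => // _ /=.
case: insubP => [x /eqP n0 xn|/negPf n0] /=; last by rewrite ifF.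
by rewrite n0 eqxx; congr F; congr Birooted; apply: val_inj; rewrite /= xn.
Qed.

Let in_sample u :
  \esum_(x in [set: vertex (rooted_base (sample u))]) F (Birooted x (groot (sample u))) =
  \sum_(n <oo) term (bisample n 0) n u.
Proof.
rewrite esum_vertex //; apply: eq_eseriesr => n _; rewrite /term.
case: asboolP => gu.
  rewrite (bisampleE _ _ _ _ _ gu) (sampleE _ _ _ gu) /=.
  by rewrite (insubT (fun x => vset (TG gu) x) (erefl true)).
rewrite /sample; case: pselect => // _ /=.
case: insubP => [x /eqP n0 xn|/negPf n0] /=; last by rewrite ifF.
by rewrite n0 eqxx; congr F; congr Birooted; apply: val_inj; rewrite /= xn.
Qed.

Let term_reroot n u : term (bisample 0 (opp_label n)) (opp_label n) (reroot n u) =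
  term (bisample n 0) n u.
Proof.
rewrite /term (asbool_equiv_eq (good_reroot n u)); case: asboolP => gu.
  have gu' : good k (reroot n u) by apply/good_reroot.
  rewrite (bisampleE _ _ _ _ _ gu') (bisampleE _ _ _ _ _ gu).
  apply/esym/borel_birooted_invariant => // N; exact: reroot_iso.
have -> : (opp_label n == 0%N) = (n == 0%N); last by [].
apply/eqP/eqP => [e|->]; last exact: sub_label_diag.
by rewrite -(opp_labelK n) e; exact: sub_label_diag.
Qed.

(* The law of the digits is invariant under translations. *)
Let integral_reroot n (h : digit_space m -> \bar R) : measurable_fun setT h ->
  (forall u, 0 <= h u) -> \int[nu]_u h u = \int[nu]_u h (reroot n u).
Proof.
move=> mh h0; have mt : measurable_fun setT (reroot n) by exact: measurable_translate.
pose rX : {mfun digit_space m >-> digit_space m} :=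
  HB.pack (reroot n) (isMeasurableFun.Build _ _ (digit_space m) (digit_space m) _ mt).
rewrite -[RHS](ge0_integral_distribution (P := nu) rX) //.
by apply: eq_measure_integral => A mA _; exact/esym/digit_prob_translate.
Qed.

(** The mass sent by the root to the vertex [n] has the same expectation as the mass
    received by the root from the vertex with the opposite label, by a change of
    root. *)
Lemma tiling_mass_transport :
  \int[tiling_law]_G (\esum_(x in [set: vertex (rooted_base G)]) F (Birooted (groot G) x)) =
  \int[tiling_law]_G (\esum_(x in [set: vertex (rooted_base G)]) F (Birooted x (groot G))).
Proof.
have mout := measurable_mass_out mF F0; have min := measurable_mass_in mF F0.
rewrite (ge0_integral_distribution (P := nu) sample_rv mout); last by move=> G; exact: esum_ge0.
rewrite (ge0_integral_distribution (P := nu) sample_rv min); last by move=> G; exact: esum_ge0.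
under eq_integral do rewrite /= out_sample.
under [RHS]eq_integral do rewrite /= in_sample.
have mb x y n := measurable_term n (measurable_bisample R k3 km x y).
rewrite !integral_nneseries //.
have i0 x y n : 0 <= \int[nu]_u term (bisample x y) n u by exact: integral_ge0.
rewrite !nneseries_esumT // (reindex_esum setT setT opp_label); last first.
  split=> //; first by move=> x y _ _; exact: (can_inj opp_labelK).
  by move=> y _; exists (opp_label y); rewrite ?opp_labelK.
apply: eq_esum => n _; rewrite (integral_reroot n) //.
by apply: eq_integral => u _; exact: term_reroot.
Qed.

End transport.

Theorem tiling_law_unimodular : unimodular tiling_law.
Proof. by move=> F mF F0; exact: tiling_mass_transport. Qed.

End mass_transport.

(** * Graphs isomorphic to tiling graphs *)

Section graph_isomorphisms.
Variables (R : realType) (G H : graph) (f : vertex G -> vertex H).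
Hypotheses (fbij : bijective f) (fe : forall x y, edge (f x) (f y) = edge x y).

Let f_induced : induced_iso setT setT f.
Proof.
have [g fK gK] := fbij; split; last by move=> x y _ _; exact: fe.
split=> //; first by move=> x y _ _; exact: (can_inj fK).
by move=> y _; exists (g y); rewrite ?gK.
Qed.

Lemma iso_gdist x y : gdist (f x) (f y) = gdist x y.
Proof.
have key n : (gdist x y <= n)%N <-> (gdist (f x) (f y) <= n)%N.
  exact: (induced_iso_gdist f_induced).
by apply/eqP; rewrite eqn_leq; apply/andP; split; apply/key.
Qed.

Lemma iso_gball v (r : R) : gball (f v) r = f @` gball v r.
Proof.
have [g fK gK] := fbij; apply/seteqP; split=> y.
  by move=> yr; exists (g y); rewrite ?gK // /gball /= -iso_gdist gK.
by move=> [x xr <-]; rewrite /gball /= iso_gdist.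
Qed.

Lemma iso_growth (d : R) : uniform_polynomial_growth d G -> uniform_polynomial_growth d H.
Proof.
have [g fK gK] := fbij; move=> [c [C [c0 C0 h]]]; exists c, C; split=> // v r r1.
suff -> : counting (gball v r) = counting (gball (g v) r) :> \bar R by exact: h.
have fin := finite_gball (g v) r.
rewrite -[v in LHS]gK iso_gball /counting !asboolT //; last exact: finite_image.
by rewrite fset_set_image // card_imfset //; exact: (can_inj fK).
Qed.

Lemma iso_complements : ball_complements_connected R G -> ball_complements_connected R H.
Proof.
have [g fK gK] := fbij; move=> h v r x y Ax Ay.
have out z : (~` gball v r) z <-> (~` gball (g v) r) (g z).
  by rewrite /gball /setC /mkset /= -iso_gdist !gK.
have [p [pp lp Ap]] := h (g v) r (g x) (g y) ((out x).1 Ax) ((out y).1 Ay).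
exists (map f p); split.
- rewrite -[x]gK path_map; apply: sub_path pp => a b /=.
  by rewrite fe.
- by rewrite -[x]gK last_map lp gK.
- by move=> z /mapP[a /Ap + ->]; rewrite -{1}(fK a); apply: (out (f a)).2.
Qed.

Lemma iso_planar : planar R G -> planar R H.
Proof.
have [g fK gK] := fbij; move=> [pos [arc D]].
have ge x y : edge (g x) (g y) = edge x y by rewrite -fe !gK.
exists (pos \o g), (fun x y => arc (g x) (g y)); split.
- move=> x y /(pos_inj D); exact: (can_inj gK).
- by move=> x y; rewrite -ge; exact: (arc_sym D).
- by move=> x y; rewrite -ge; exact: (arcP D).
- move=> x y z; rewrite -ge => /(arc_vertex D) h /h[]/(can_inj gK) ->; by [left|right].
- move=> x y x' y'; rewrite -ge -(ge x') => e e' n; apply: (arc_arc D) => // E; apply: n.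
  have im a b : [set a; b] = f @` [set g a; g b] by rewrite image_setU !image_set1 !gK.
  by rewrite (im x y) (im x' y') E.
Qed.

End graph_isomorphisms.

(** A sequence with finitely many values is eventually constant along an
    ultrafilter. *)
Lemma ultra_pigeonhole (U : set_system nat) (T : eqType) (A : set T) (h : nat -> T) :
  UltraFilter U -> finite_set A -> U [set n | A (h n)] ->
  exists2 a, A a & U [set n | h n = a].
Proof.
move=> UU /finite_seqP[s ->]; elim: s => [|a s IH] hs.
  by have [n] := filter_ex hs.
have [ha|hna] := in_ultra_setVsetC [set n | h n = a] UU.
  by exists a => //=; rewrite mem_head.
have [|b bs hb] := IH.
  apply: filterS (filterI hs hna) => n [/=]; rewrite inE => /orP[/eqP->|//].
  by move=> /(_ erefl).
by exists b => //=; rewrite inE bs orbT.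
Qed.

Section limits_of_samples.
Set Default Proof Using "All".
Variables (R : realType) (k m : nat).
Hypotheses (k3 : (3 <= k)%N) (km : (k ^ 2 <= m.+1)%N).
Local Notation M := m.+1.
Local Notation TG := (tiling_graph R k3 km).
Local Notation root g := (graph_vertex R k3 km g 0).
Implicit Types (L : nat -> nat) (u : digit_seq m).

Lemma recurrent_good L u : recurrent (star k m) L u -> good k u.
Proof. by move=> h n; have [i [ni _ ui]] := h n; exists i. Qed.

(** Compactness: if the [n]-th ball of [G] is the image under a map [f_n] of a ball
    in the graph of a sequence [u_n], for every [n], let [u] and [f] be the
    pointwise limits of [u_n] and [f_n] along an ultrafilter. Recurrence with
    uniform gaps passes to the limit and makes [u] good. Then balls in the graph of
    [u] are eventually those in the graph of [u_n], hence [f] preserves distances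
    to the root and is an isomorphism. *)
Lemma limit_of_samples L (G : rooted_graph) :
  (forall n, exists u, recurrent (star k m) L u /\
     rooted_ball_iso n (sample R k3 km u) G) ->
  exists u (g : good k u) (f : vertex (TG g) -> vertex (rooted_base G)),
    bijective f /\ forall x y, edge (f x) (f y) = edge x y.
Proof.
move=> approx.
have /choice[w hw] : forall n, exists w : digit_seq m * (all_nat -> vertex (rooted_base G)),
    recurrent (star k m) L w.1 /\ forall g : good k w.1,
      @induced_iso (TG g) (rooted_base G) [set x | (gdist (root g) x <= n)%N]
        [set y | (gdist (groot G) y <= n)%N] w.2 /\ w.2 (root g) = groot G.
  move=> n; have [u [ru]] := approx n; have g := recurrent_good ru.
  rewrite (sampleE _ _ _ g) => -[f [fi fr]]; exists (u, f); split=> // g'.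
  by rewrite (Prop_irrelevance g' g) -!gball_nat.
pose gn n : good k (w n).1 := recurrent_good (hw n).1.
have fi n := ((hw n).2 (gn n)).1; have fr n := ((hw n).2 (gn n)).2.
have [U [UU ooU]] := ultraFilterLemma (eventually_filter : ProperFilter eventually).
have Uge j : U [set n | (j <= n)%N] by apply: ooU; exact: nbhs_infty_ge.
have /choice[u hu] i : exists a, U [set n | (w n).1 i = a].
  have [|a _ ha] := @ultra_pigeonhole U _ setT (fun n => (w n).1 i) UU (@finite_finset _ _).
    by apply: filterS (Uge 0%N).
  by exists a.
have Ucyl N : U [set n | cylinder N (u : digit_seq m) (w n).1].
  elim: N => [|N IH]; first by apply: filterS (Uge 0%N).
  apply: filterS (filterI IH (hu N)) => n [h e] i; rewrite ltnS leq_eqVlt.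
  by move=> /orP[/eqP->|/h].
have ru : recurrent (star k m) L u.
  move=> j; have [n un] := filter_ex (Ucyl (j + L j)%N).
  by have [i [ji iL wi]] := (hw n).1 j; exists i; split=> //; rewrite -(un i iL).
pose g := recurrent_good ru.
(* Eventually along the ultrafilter, balls around the root are those of [u]. *)
have Uball r : U [set n | forall x y : all_nat, (@gdist (TG g) (root g) x <= r)%N ->
     nat_edge R k u x y = nat_edge R k (w n).1 x y].
  have [N hN] := tiling_local R k3 km g r [:: root g].
  apply: filterS (Ucyl N) => n un x y xr; apply: hN => //.
  by exists (root g); rewrite ?mem_seq1.
have Udist r : U [set n | forall x : all_nat, (@gdist (TG g) (root g) x <= r)%N =
     (@gdist (TG (gn n)) (root (gn n)) x <= r)%N].
  have [N hN] := tiling_local R k3 km g r [:: root g].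
  apply: filterS (Ucyl N) => n un x.
  apply: (@tiling_ball_agree R k m k3 km _ _ g (gn n) r [:: root g]) => //.
  exact: hN.
have Uin (x : all_nat) : U [set n | (@gdist (TG (gn n)) (root (gn n)) x <= n)%N].
  pose r := @gdist (TG g) (root g) x.
  apply: filterS (filterI (Udist r) (Uge r)) => n [/(_ x) /= e rn].
  by apply: leq_trans rn; rewrite -e.
have image_dist n (x : all_nat) r : (r <= n)%N ->
    (@gdist (TG (gn n)) (root (gn n)) x <= n)%N ->
    (@gdist (TG (gn n)) (root (gn n)) x <= r)%N <->
    (gdist (groot G) ((w n).2 x) <= r)%N.
  move=> rn xn; rewrite -(fr n); apply: (induced_iso_gdist (fi n)) => // z /= zr.
    exact: leq_trans rn.
  by rewrite -(fr n); exact: leq_trans rn.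
have /choice[f hf] (x : all_nat) : exists y, U [set n | (w n).2 x = y].
  pose r := @gdist (TG g) (root g) x.
  have [|y _ hy] := @ultra_pigeonhole U _ [set y | (gdist (groot G) y <= r)%N]
      (fun n => (w n).2 x) UU (finite_gdist_ball _ _).
    apply: filterS (filterI (Uin x) (filterI (Udist r) (Uge r))) => n [xn [e rn]].
    by apply/(image_dist n x r rn xn); rewrite -e.
  by exists y.
have finj : injective f.
  move=> x y fxy.
  have [n [[xn yn] [fx fy]]] :=
    filter_ex (filterI (filterI (Uin x) (Uin y)) (filterI (hf x) (hf y))).
  have [[_ inj _] _] := fi n; apply: inj; rewrite ?inE //.
  by rewrite fx fy.
have fsurj y : exists x, f x = y.
  pose r := gdist (groot G) y.
  have /choice[h hh] n : exists x : all_nat, (r <= n)%N ->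
      (@gdist (TG (gn n)) (root (gn n)) x <= n)%N /\ (w n).2 x = y.
    have [rn|rn] := leqP r n; last by exists (root g).
    have [[_ _ surj] _] := fi n; have [x xn xy] := surj y rn.
    by exists x.
  have [|x _ hx] := @ultra_pigeonhole U _ [set x | (@gdist (TG g) (root g) x <= r)%N]
      h UU (finite_gdist_ball _ _).
    apply: filterS (filterI (Udist r) (Uge r)) => n [/= e rn].
    have [xn xy] := hh n rn; rewrite e; apply/(image_dist n _ r rn xn).
    by rewrite xy.
  exists x; have [n [[hn fx] rn]] := filter_ex (filterI (filterI hx (hf x)) (Uge r)).
  by rewrite -fx -hn; have [] := hh n rn.
have /choice[f' ff'] := fsurj.
exists u, g, f; split.
  by exists f' => // x; apply: finj.
move=> x y; pose r := @gdist (TG g) (root g) x.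
have [n [[xn yn] [[fx fy] e]]] :=
  filter_ex (filterI (filterI (Uin x) (Uin y))
    (filterI (filterI (hf x) (hf y)) (Uball r))).
have [_ ee] := fi n; rewrite -fx -fy ee //.
by rewrite /= (e x y).
Qed.

End limits_of_samples.

(** * Almost sure properties *)

Section almost_sure_properties.
Variables (R : realType) (k m : nat).
Hypotheses (k3 : (3 <= k)%N) (km : (k ^ 2 <= m.+1)%N).
Local Notation nu := (digit_prob R m).
Local Notation law := (tiling_law R k3 km).

(** A Borel set of graphs isomorphic to tiling graphs. Each of the conditions
    involves a single ball, so it defines an open set. *)
Definition sample_limits L : set borel_rooted :=
  \bigcap_n [set G | exists u, recurrent (star k m) L u /\
                       rooted_ball_iso n (sample R k3 km u) G].

Lemma measurable_sample_limits L : measurable (sample_limits L).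
Proof.
apply: bigcapT_measurable => n; apply: sub_sigma_algebra.
apply/rooted_openP => G [u [ru uG]]; exists n => H GH; exists u; split=> //.
by move: uG GH; rewrite !rooted_ball_isoE; exact: multiball_iso_trans.
Qed.

Lemma tiling_law_sample_limits L : (law (~` sample_limits L) <= nu (~` recurrent (star k m) L))%E.
Proof.
rewrite /tiling_law /distribution /= /pushforward.
have mR := measurable_recurrent R (star k m) L.
have mS : measurable (sample R k3 km @^-1` (~` sample_limits L) : set (digit_space m)).
  rewrite -[X in measurable X]setTI; apply: (measurable_sample R k3 km) => //.
  by apply: measurableC; exact: measurable_sample_limits.
apply: (le_measure nu); rewrite ?inE //; first exact: measurableC.
move=> u /= nS ru; apply: nS => n _; exists u; split=> //.
by apply/rooted_ball_isoE; exact: multiball_iso_refl.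
Qed.

(** The graphs with the property contain the sets [sample_limits (L j)], whose
    probabilities tend to one when the [L j] are chosen with [recurrent_prob]. *)
Lemma tiling_law_ae (P : graph -> Prop) :
  (forall u (g : good k u), P (tiling_graph R k3 km g)) ->
  (forall (G H : graph) (f : vertex G -> vertex H), bijective f ->
     (forall x y, edge (f x) (f y) = edge x y) -> P G -> P H) ->
  {ae law, forall G : borel_rooted, P (rooted_base G)}.
Proof.
move=> Ptiling Piso.
have /choice[L hL] (j : nat) : exists L,
    (nu (~` recurrent (star k m) L) <= (j.+1%:R^-1)%:E)%E.
  by apply: recurrent_prob; rewrite invr_gt0 ltr0n.
pose N := \bigcap_j ~` sample_limits (L j).
have mN : measurable N.
  by apply: bigcapT_measurable => j; apply: measurableC; exact: measurable_sample_limits.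
exists N; split=> //.
  apply/eqP; rewrite eq_le measure_ge0 andbT; apply/lee_addgt0Pr => e e0; rewrite add0e.
  have [j je] : exists j : nat, j.+1%:R^-1 <= e.
    exists (Num.truncn e^-1); rewrite invf_ple ?posrE ?ltr0n //.
    by apply: ltW; exact: truncnS_gt.
  apply: (@le_trans _ _ (law (~` sample_limits (L j)))).
    apply: le_measure; rewrite ?inE //.
      by apply: measurableC; exact: measurable_sample_limits.
    by move=> G; apply.
  apply: le_trans (tiling_law_sample_limits _) _; apply: le_trans (hL j) _.
  by rewrite lee_fin.
move=> G nP j _ /= GL; apply: nP.
have [|u [g [f [fb fe]]]] := @limit_of_samples R k m k3 km (L j) G.
  by move=> n; have := GL n I.
exact: Piso fb fe (Ptiling u g).
Qed.

End almost_sure_properties.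

(** For [d = p / q] take [k = 3 ^ q] and [m.+1 = 3 ^ p]. The base 3 makes [k] at
    least 3, so that a subdivided square has a column off its sides. *)
Lemma rational_exponents (R : realType) (d : rat) : 2 <= d -> exists k m : nat,
  [/\ (3 <= k)%N, (k ^ 2 <= m.+1)%N & k%:R `^ (ratr d) = m.+1%:R :> R].
Proof.
move=> d2; pose p := `|numq d|%N; pose q := `|denq d|%N.
have q0 : (0 < q)%N by rewrite absz_gt0 denq_neq0.
have dE : d = p%:R / q%:R.
  rewrite -[LHS]divq_num_den /p /q !natr_absz ger0_norm ?ger0_norm //.
  by rewrite numq_ge0 (le_trans _ d2).
have qp : (2 * q <= p)%N.
  by move: d2; rewrite dE ler_pdivlMr ?ltr0n // -natrM ler_nat.
exists (3 ^ q)%N, (3 ^ p).-1; rewrite prednK ?expn_gt0 //; split.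
- by rewrite -{1}[3%N]expn1 leq_pexp2l.
- by rewrite -expnM leq_pexp2l // mulnC.
- have -> : ratr d = p%:R / q%:R :> R by rewrite dE fmorph_div /= !rmorph_nat.
  rewrite !natrX -powR_mulrn // -powRrM mulrCA divff ?mulr1 ?powR_mulrn //.
  by rewrite pnatr_eq0 -lt0n.
Qed.

Theorem theorem1p4 (R : realType) (d : rat) (hd : 2 <= d) :
  exists P : probability borel_rooted R,
    unimodular P /\
    {ae P, forall G : borel_rooted,
       [/\ planar R (rooted_base G),
           uniform_polynomial_growth (ratr d : R) (rooted_base G) &
           ball_complements_connected R (rooted_base G)]}.
Proof.
have [k [m [k3 km kd]]] := rational_exponents R hd.
have d0 : 0 <= ratr d :> R by rewrite ler0q (le_trans _ hd).
exists (tiling_law R k3 km); split; first exact: tiling_law_unimodular.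
apply: (@tiling_law_ae _ _ _ k3 km (fun G => [/\ planar R G,
  uniform_polynomial_growth (ratr d) G & ball_complements_connected R G])).
  move=> u g; have T := nat_tiling R k3 km g; split.
  - exact: (@tiling_planar _ (tiling_graph R k3 km g) _ _ _ T).
  - exact: tiling_uniform_growth.
  - exact: (@tiling_ball_complements_connected _ (tiling_graph R k3 km g) _ _ _ T).
move=> G H f fb fe [? ? ?]; split.
- exact: iso_planar fb fe _.
- exact: iso_growth fb fe _ _.
- exact: iso_complements fb fe _.
Qed.
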